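(* Let $M_n$ denote the length of the largest interval after $n$ steps of Kakutani's interval-splitting process, and let $\sigma^2 := 16\log 2 - 10$. There exists a constant $C\in[0,\infty)$ such that for every $n\in\mathbb N=\{1,2,\dots\}$, \[ \sup_{x\in\mathbb R}\left|\Pr\left(\sqrt{\frac{n^3}{\sigma^2}}\left(M_n-\frac{2}{n}\right)\le x\right)-\Phi(x)\right|\le \frac{C}{\sqrt n}. \]
   Context: Kakutani's interval-splitting process: let $U_1,U_2,\dots$ be i.i.d. uniform random variables on $[0,1]$. At time $0$ the partition of $[0,1]$ consists of the single interval $[0,1]$. Given the partition at time $n\in\mathbb Z_+$ (which consists of $n+1$ intervals, whose lengths are a.s. distinct), let $[a,b]$ be the interval of maximal length; the partition at time $n+1$ is obtained by replacing $[a,b]$ by the two intervals $[a,a+U_{n+1}(b-a)]$ and $[a+U_{n+1}(b-a),b]$. Write $L_{n,1},\dots,L_{n,n+1}$ for the lengths of the $n+1$ intervals at time $n$ (in left-to-right order), $M_n:=\max_i L_{n,i}$ and $m_n:=\min_i L_{n,i}$. $\Phi$ is the standard normal distribution function. *)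

(* Defs.v *)
From HB Require Import structures.
From mathcomp Require Import all_boot all_order all_algebra.
From mathcomp Require Import all_classical all_reals all_analysis.
Set Implicit Arguments. Unset Strict Implicit. Unset Printing Implicit Defensive.
Import Order.TTheory GRing.Theory Num.Theory.
Import numFieldNormedType.Exports.
Local Open Scope classical_set_scope.
Local Open Scope ring_scope.

Section kakutani.
Variable R : realType.

(* an interval [a,b] is represented by the pair (a,b) *)
Definition ilen (p : R * R) : R := p.2 - p.1.

(* maximal length in a partition (lengths are nonnegative, so 0 is a safe
   initial value for the fold) *)
Definition maxlen (s : seq (R * R)) : R := foldr Num.max 0 (map ilen s).

Definition ksplit (v : R) (s : seq (R * R)) : seq (R * R) :=
  let i := find (fun p => ilen p == maxlen s) s in
  let p := nth (0, 0) s i in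
  let c := p.1 + v * (p.2 - p.1) in
  take i s ++ [:: (p.1, c); (c, p.2)] ++ drop i.+1 s.

(* partition at time n (left-to-right order); [u k] plays the role of
   U_{k+1}, i.e. the step from time n to time n+1 uses u n = U_{n+1} *)
Fixpoint kakutani (u : nat -> R) (n : nat) : seq (R * R) :=
  match n with
  | 0 => [:: (0, 1)]
  | n'.+1 => ksplit (u n') (kakutani u n')
  end.

Definition Mn (u : nat -> R) (n : nat) : R := maxlen (kakutani u n).

Definition Phi (x : R) : R := fine (normal_prob 0 1 `]-oo, x]).

End kakutani.

Definition mutually_independent d (T : measurableType d) (R : realType)
  (P : probability T R) (U : nat -> {RV P >-> R}) : Prop :=
  forall (s : seq nat) (B : nat -> set R), uniq s ->
    (forall i, measurable (B i)) ->
    P (\bigcap_(i in [set` s]) (U i @^-1` B i)) =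
    (\prod_(i <- s) P (U i @^-1` B i))%E.

(* Main.v *)
Require Import Defs.
From HB Require Import structures.
From mathcomp Require Import all_boot all_order all_algebra.
From mathcomp Require Import all_classical all_reals all_analysis.
From mathcomp Require Import measurable_realfun complex zify ring lra.
Set Implicit Arguments. Unset Strict Implicit. Unset Printing Implicit Defensive.
Import Order.TTheory GRing.Theory Num.Theory.
Import numFieldNormedType.Exports.
Local Open Scope classical_set_scope.
Local Open Scope ring_scope.

(* Let tau be the number of splits needed to bring every interval below length t, so that
   M_n <= t if and only if tau <= n almost surely. Conditioning on the first split, the
   characteristic function of tau at s, suitably normalised and seen as a function of
   y = 1 / t, satisfies r(y) = int_0^1 r(y u) r(y (1 - u)) du for y > 1 and is an explicit
   exponential for y <= 1. Solving this equation by Picard iteration around its expansion to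
   order s^2 gives |r(y) - 1| <= exp (K |s|^3 y) - 1: the cumulants of order at least three
   grow at most linearly in y, so the characteristic function of tau + 1 - 2 y is
   exp (- v y s^2 / 2 + O(s^3 y)) with v = 8 ln 2 - 5. The product of r over all current
   intervals is a martingale, which identifies r with the characteristic function of tau. A
   smoothing inequality in the manner of Esseen turns this into a bound O(1 / sqrt y) for the
   distance between the law of tau + 1 - 2 y and a centred normal law of variance v y, and
   substituting t = 2 / n + x sigma / n^(3/2) yields the theorem. *)

Local Notation Re := complex.Re.
Local Notation Im := complex.Im.
Local Notation normc := ComplexField.Normc.normc.
Local Notation "x %:C" := (real_complex_def (Phant _) x) : ring_scope.
Local Notation Rintegrable mu f := (mu.-integrable [set: _] (EFin \o f)).

(** * Expectations of bounded real and complex functions *)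

Definition bounded_mfun d (T : measurableType d) (R : realType) (f : T -> R) : Prop :=
  measurable_fun [set: T] f /\ exists M : R, forall x, `|f x| <= M.

Definition mean d (T : measurableType d) (R : realType) (mu : probability T R)
  (f : T -> R) : R := \int[mu]_x f x.

Section bounded_mfun_theory.
Context d (T : measurableType d) (R : realType).
Implicit Types f g : T -> R.

Lemma bounded_mfun_cst (c : R) : bounded_mfun (fun _ : T => c).
Proof. by split; [exact: measurable_cst | exists `|c|]. Qed.

Lemma bounded_mfunD f g :
  bounded_mfun f -> bounded_mfun g -> bounded_mfun (fun x => f x + g x).
Proof.
move=> [mf [M Mf]] [mg [N Ng]]; split; first exact: measurable_funD.
by exists (M + N) => x; rewrite (le_trans (ler_normD _ _))// lerD.
Qed.

Lemma bounded_mfunN f : bounded_mfun f -> bounded_mfun (fun x => - f x).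
Proof.
move=> [mf [M Mf]]; split; first exact: measurableT_comp.
by exists M => x; rewrite normrN.
Qed.

Lemma bounded_mfunM f g :
  bounded_mfun f -> bounded_mfun g -> bounded_mfun (fun x => f x * g x).
Proof.
move=> [mf [M Mf]] [mg [N Ng]]; split; first exact: measurable_funM.
by exists (M * N) => x; rewrite normrM ler_pM.
Qed.

Lemma bounded_mfun_norm f : bounded_mfun f -> bounded_mfun (fun x => `|f x|).
Proof.
move=> [mf [M Mf]]; split; first exact: measurableT_comp.
by exists M => x; rewrite normr_id.
Qed.

Lemma bounded_mfun_indic (A : set T) : measurable A -> bounded_mfun (\1_A : T -> R).
Proof.
move=> mA; split; first exact: measurable_indic.
by exists 1 => x; rewrite indicE; case: (_ \in _); rewrite ?normr1 ?normr0.
Qed.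

Lemma bounded_mfun_comp d' (S : measurableType d') (h : S -> T) f :
  measurable_fun [set: S] h -> bounded_mfun f -> bounded_mfun (fun x => f (h x)).
Proof. by move=> mh [mf [M fM]]; split; [exact: measurableT_comp mf mh | exists M]. Qed.
End bounded_mfun_theory.

Ltac solve_bounded := repeat first [ assumption | exact: bounded_mfun_cst
  | apply: bounded_mfunN | apply: bounded_mfunD | apply: bounded_mfunM
  | apply: bounded_mfun_norm ].

Section mean_theory.
Context d (T : measurableType d) (R : realType) (mu : probability T R).
Implicit Types f g : T -> R.

Lemma bounded_mfun_integrable f : bounded_mfun f -> Rintegrable mu f.
Proof.
move=> [mf [M Mf]]; apply: measurable_bounded_integrable => //.
  by rewrite (@le_lt_trans _ _ 1%E) ?probability_le1 ?ltry.
exists M; split; first exact: num_real.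
by move=> x Mx y _; exact: (le_trans (Mf y) (ltW Mx)).
Qed.

Lemma mean_cst (c : R) : mean mu (fun=> c) = c.
Proof.
transitivity (c * fine (mu setT)); first exact: Rintegral_cst.
by rewrite (probability_setT mu) mulr1.
Qed.

Lemma meanD f g : Rintegrable mu f -> Rintegrable mu g ->
  mean mu (fun x => f x + g x) = mean mu f + mean mu g.
Proof. by move=> *; exact: RintegralD. Qed.

Lemma meanB f g : Rintegrable mu f -> Rintegrable mu g ->
  mean mu (fun x => f x - g x) = mean mu f - mean mu g.
Proof. by move=> *; exact: RintegralB. Qed.

Lemma meanZl (c : R) f : Rintegrable mu f -> mean mu (fun x => c * f x) = c * mean mu f.
Proof. by move=> *; exact: RintegralZl. Qed.

Lemma meanN f : Rintegrable mu f -> mean mu (fun x => - f x) = - mean mu f.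
Proof.
move=> mf; under eq_fun do rewrite -mulN1r.
by rewrite meanZl// mulN1r.
Qed.

Lemma le_mean f g : Rintegrable mu f -> Rintegrable mu g ->
  (forall x, f x <= g x) -> mean mu f <= mean mu g.
Proof. by move=> *; apply: le_Rintegral. Qed.

Lemma mean_ge0 f : (forall x, 0 <= f x) -> 0 <= mean mu f.
Proof. by move=> f0; apply: Rintegral_ge0. Qed.

Lemma integrable_norm_fun f : Rintegrable mu f -> Rintegrable mu (fun x => `|f x|).
Proof. by move=> /integrable_norm. Qed.

Lemma le_norm_mean f g : Rintegrable mu f -> Rintegrable mu g ->
  (forall x, `|f x| <= g x) -> `|mean mu f| <= mean mu g.
Proof.
move=> mf mg fg; apply: (@le_trans _ _ (mean mu (fun x => `|f x|))).
  exact: le_normr_Rintegral.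
by apply: le_mean => //; exact: integrable_norm_fun.
Qed.

Lemma norm_mean_le f (M : R) : bounded_mfun f -> (forall x, `|f x| <= M) -> `|mean mu f| <= M.
Proof.
move=> bf fM; rewrite -[leRHS]mean_cst; apply: le_norm_mean => //;
  apply: bounded_mfun_integrable => //; exact: bounded_mfun_cst.
Qed.

Lemma mean_indic (A : set T) : measurable A -> mean mu (\1_A : T -> R) = fine (mu A).
Proof. by move=> mA; rewrite /mean /Rintegral integral_indic// setIT. Qed.

Lemma mean_cvg_dominated (f : nat -> T -> R) (g h : T -> R) :
  (forall n, measurable_fun setT (f n)) -> Rintegrable mu h ->
  (forall n x, `|f n x| <= h x) -> (forall x, f n x @[n --> \oo] --> g x) ->
  mean mu (f n) @[n --> \oo] --> mean mu g.
Proof.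
move=> mf ih fh fg.
have mg : measurable_fun setT g by apply: (measurable_fun_cvg mf) => x _; exact: fg.
have [|||||ig _ c] := @dominated_convergence _ _ _ mu setT measurableT
  (fun n => EFin \o f n) (EFin \o g) (EFin \o h).
- by move=> n; exact/measurable_EFinP.
- exact/measurable_EFinP.
- by apply: aeW => x _ /=; apply: cvg_EFin => //; [exact: nearW | exact: fg].
- exact: ih.
- by apply: aeW => x n _ /=; rewrite lee_fin.
apply: (@fine_cvg R).
rewrite fineK//; exact: integrable_fin_num.
Qed.

Lemma mean_cvg_bounded (f : nat -> T -> R) (g : T -> R) (M : R) :
  (forall n, measurable_fun setT (f n)) -> (forall n x, `|f n x| <= M) ->
  (forall x, f n x @[n --> \oo] --> g x) -> mean mu (f n) @[n --> \oo] --> mean mu g.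
Proof.
move=> mf fM fg; apply: (@mean_cvg_dominated f g (fun=> M)) => //.
exact/bounded_mfun_integrable/bounded_mfun_cst.
Qed.

Lemma integrable_nondecreasing_lim (f : nat -> T -> R) (g : T -> R) (M : R) :
  (forall n, bounded_mfun (f n)) -> (forall n x, 0 <= f n x) ->
  (forall x, nondecreasing_seq (f ^~ x)) -> (forall n, mean mu (f n) <= M) ->
  (forall x, f n x @[n --> \oo] --> g x) -> Rintegrable mu g.
Proof.
move=> bf f0 fnd fM fg.
have mf n : measurable_fun setT (EFin \o f n) by apply/measurable_EFinP; have [] := bf n.
have g0 x : 0 <= g x.
  by rewrite -(cvg_lim _ (fg x))//; apply: limr_ge; [exact: cvgP (fg x) | exact: nearW].
apply/integrableP; split.
  apply/measurable_EFinP; apply: measurable_fun_cvg (fun x _ => fg x) => n.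
  by have [] := bf n.
under eq_integral do rewrite /= ger0_norm//.
have -> : (\int[mu]_x (g x)%:E = limn (fun n => \int[mu]_x (f n x)%:E))%E.
  rewrite -monotone_convergence//.
  - apply: eq_integral => x _; apply/esym/cvg_lim => //.
    by apply: cvg_EFin; [exact: nearW | exact: fg].
  - by move=> n x _; rewrite lee_fin.
  - by move=> x _ m n mn; rewrite lee_fin fnd.
apply: (@le_lt_trans _ _ M%:E); last exact: ltry.
apply: lime_le.
  apply: ereal_nondecreasing_is_cvgn => m n mn; apply: ge0_le_integral.
  - exact: measurableT.
  - by move=> x _; rewrite lee_fin.
  - exact: mf.
  - exact: mf.
  - by move=> x _; rewrite lee_fin fnd.
apply: nearW => n.
have := integrable_fin_num measurableT (bounded_mfun_integrable (bf n)) => /fineK <-.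
by rewrite lee_fin; exact: fM.
Qed.
End mean_theory.

Section mean_fubini.
Context d1 d2 (T1 : measurableType d1) (T2 : measurableType d2) (R : realType).
Variables (m1 : probability T1 R) (m2 : probability T2 R).

Lemma measurable_mean (f : T1 * T2 -> R) : measurable_fun setT f ->
  measurable_fun setT (fun x => mean m2 (fun y => f (x, y))).
Proof.
move=> mf; rewrite /mean /Rintegral.
apply: (measurableT_comp (f := fine)) => //.
under eq_fun do rewrite integralE.
have mf' : measurable_fun setT (EFin \o f) by exact/measurable_EFinP.
apply: emeasurable_funB.
  rewrite [X in measurable_fun _ X](_ : _ = fubini_F m2 ((EFin \o f)^\+)%E); last first.
    by apply/funext => x; apply: eq_integral => y _; rewrite !funeposE.
  apply: measurable_fun_fubini_tonelli_F; first exact: measurable_funepos.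
  by move=> x; exact: funepos_ge0.
rewrite [X in measurable_fun _ X](_ : _ = fubini_F m2 ((EFin \o f)^\-)%E); last first.
  by apply/funext => x; apply: eq_integral => y _; rewrite !funenegE.
apply: measurable_fun_fubini_tonelli_F; first exact: measurable_funeneg.
by move=> x; exact: funeneg_ge0.
Qed.

Lemma mean_fubini_integrable (f : T1 * T2 -> R) :
  Rintegrable (m1 \x m2)%E f ->
  (forall x, Rintegrable m2 (fun y => f (x, y))) ->
  (forall y, Rintegrable m1 (fun x => f (x, y))) ->
  mean m1 (fun x => mean m2 (fun y => f (x, y))) =
  mean m2 (fun y => mean m1 (fun x => f (x, y))).
Proof.
move=> itf i2 i1; rewrite /mean /Rintegral.
under eq_integral.
  move=> x _; rewrite fineK; last by have /= := integrable_fin_num measurableT (i2 x).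
  over.
under [in RHS]eq_integral.
  move=> x _; rewrite fineK; last by have /= := integrable_fin_num measurableT (i1 x).
  over.
by rewrite (@Fubini _ _ _ _ _ m1 m2 (EFin \o f)).
Qed.

Lemma bounded_mfun_section1 (f : T1 * T2 -> R) x :
  bounded_mfun f -> bounded_mfun (fun y => f (x, y)).
Proof. by apply: bounded_mfun_comp; exact: pair1_measurable. Qed.

Lemma bounded_mfun_section2 (f : T1 * T2 -> R) y :
  bounded_mfun f -> bounded_mfun (fun x => f (x, y)).
Proof. by apply: bounded_mfun_comp; exact: pair2_measurable. Qed.

Lemma bounded_mfun_mean (f : T1 * T2 -> R) : bounded_mfun f ->
  bounded_mfun (fun x => mean m2 (fun y => f (x, y))).
Proof.
move=> bf; have [mf [M fM]] := bf; split; first exact: measurable_mean.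
by exists M => x; apply: norm_mean_le => //; exact: bounded_mfun_section1.
Qed.

Lemma mean_fubini (f : T1 * T2 -> R) : bounded_mfun f ->
  mean m1 (fun x => mean m2 (fun y => f (x, y))) =
  mean m2 (fun y => mean m1 (fun x => f (x, y))).
Proof.
move=> bf; apply: mean_fubini_integrable.
- exact: (@bounded_mfun_integrable _ _ _ (m1 \x m2)%E f bf).
- by move=> x; exact/bounded_mfun_integrable/bounded_mfun_section1.
- by move=> x; exact/bounded_mfun_integrable/bounded_mfun_section2.
Qed.

Lemma mean_prod (f : T1 * T2 -> R) : bounded_mfun f ->
  mean (m1 \x m2)%E f = mean m1 (fun x => mean m2 (fun y => f (x, y))).
Proof.
move=> bf; rewrite /mean /Rintegral.
under [in RHS]eq_integral.
  move=> x _; rewrite fineK; last first.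
    have /bounded_mfun_integrable := (@bounded_mfun_section1 f x bf) => /(_ m2) ib.
    by have /= := integrable_fin_num measurableT ib.
  over.
rewrite (@integral12_prod_meas1 _ _ _ _ _ m1 m2 (EFin \o f))//.
exact: (@bounded_mfun_integrable _ _ _ (m1 \x m2)%E f bf).
Qed.
End mean_fubini.

Section complex_modulus.
Variable R : realType.
Implicit Types (z w : R[i]) (t x : R).

Lemma complex_eqP z w : Re z = Re w -> Im z = Im w -> z = w.
Proof. by case: z => a b; case: w => c e /= -> ->. Qed.

Lemma ReD z w : Re (z + w) = Re z + Re w.
Proof. by case: z => a b; case: w. Qed.

Lemma ImD z w : Im (z + w) = Im z + Im w.
Proof. by case: z => a b; case: w. Qed.

Lemma ReN z : Re (- z) = - Re z. Proof. by case: z. Qed.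

Lemma ImN z : Im (- z) = - Im z. Proof. by case: z. Qed.

Lemma ReM z w : Re (z * w) = Re z * Re w - Im z * Im w.
Proof. by case: z => a b; case: w. Qed.

Lemma ImM z w : Im (z * w) = Re z * Im w + Im z * Re w.
Proof. by case: z => a b; case: w. Qed.

Lemma normcE z : normc z = Num.sqrt (Re z ^+ 2 + Im z ^+ 2).
Proof. by case: z. Qed.

Lemma normc_ge0 z : 0 <= normc z. Proof. by rewrite normcE sqrtr_ge0. Qed.

Lemma sqr_normcE z : normc z ^+ 2 = Re z ^+ 2 + Im z ^+ 2.
Proof. by rewrite normcE sqr_sqrtr// addr_ge0 ?sqr_ge0. Qed.

Lemma normc_leD z w : normc (z + w) <= normc z + normc w.
Proof. exact: le_normcD. Qed.

Lemma normc_leB z w : normc (z - w) <= normc z + normc w.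
Proof. by rewrite -[normc w]normcN; exact: normc_leD. Qed.

Lemma norm_Re_le z : `|Re z| <= normc z.
Proof. by rewrite normcE -sqrtr_sqr ler_wsqrtr// lerDl sqr_ge0. Qed.

Lemma norm_Im_le z : `|Im z| <= normc z.
Proof. by rewrite normcE -sqrtr_sqr ler_wsqrtr// lerDr sqr_ge0. Qed.

Lemma normc_le_Re_Im z : normc z <= `|Re z| + `|Im z|.
Proof.
rewrite -(@ler_pXn2r _ 2)// ?nnegrE ?normc_ge0 ?addr_ge0//.
rewrite sqr_normcE sqrrD !real_normK ?num_real//.
by rewrite lerD2r lerDl mulrn_wge0// mulr_ge0.
Qed.

Lemma normc_real x : normc x%:C = `|x|.
Proof. by rewrite normcE/= expr0n/= addr0 sqrtr_sqr. Qed.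

Lemma Re_realM x z : Re (x%:C * z) = x * Re z.
Proof. by rewrite ReM/= mul0r subr0. Qed.

Lemma Im_realM x z : Im (x%:C * z) = x * Im z.
Proof. by rewrite ImM/= mul0r addr0. Qed.

Definition cis t : R[i] := Complex (cos t) (sin t).

Lemma normc_cis t : normc (cis t) = 1.
Proof. by rewrite normcE/= cos2Dsin2 sqrtr1. Qed.

Lemma cis0 : cis 0 = 1.
Proof. by rewrite /cis cos0 sin0. Qed.

Lemma cisD a b : cis (a + b) = cis a * cis b.
Proof.
apply: complex_eqP; rewrite ?ReM ?ImM/= ?cosD ?sinD//.
by rewrite addrC mulrC (mulrC (sin a)).
Qed.
End complex_modulus.

Definition measurable_cfun d (T : measurableType d) (R : realType) (f : T -> R[i]) : Prop :=
  measurable_fun [set: T] (fun x => Re (f x)) /\ measurable_fun [set: T] (fun x => Im (f x)).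

Definition bounded_cfun d (T : measurableType d) (R : realType) (f : T -> R[i]) : Prop :=
  bounded_mfun (fun x => Re (f x)) /\ bounded_mfun (fun x => Im (f x)).

Definition cmean d (T : measurableType d) (R : realType) (mu : probability T R)
  (f : T -> R[i]) : R[i] :=
  Complex (mean mu (fun x => Re (f x))) (mean mu (fun x => Im (f x))).

(* Convergence in the topology of [R * R]: the library puts on [R[i]] a complex-valued norm. *)
Definition ccvg (R : realType) (z : nat -> R[i]) (l : R[i]) : Prop :=
  Re (z n) @[n --> \oo] --> Re l /\ Im (z n) @[n --> \oo] --> Im l.

Section measurable_cfun_theory.
Context d (T : measurableType d) (R : realType).
Implicit Types f g : T -> R[i].

Lemma measurable_cfun_comp d' (T' : measurableType d') (f : T' -> R[i]) (h : T -> T') :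
  measurable_cfun f -> measurable_fun setT h -> measurable_cfun (fun x => f (h x)).
Proof.
by move=> [f1 f2] mh; split; [exact: (measurableT_comp f1 mh)|exact: (measurableT_comp f2 mh)].
Qed.

Lemma measurable_cfun_cst (c : R[i]) : measurable_cfun (fun _ : T => c).
Proof. by split; exact: measurable_cst. Qed.

Lemma measurable_cfunM f g :
  measurable_cfun f -> measurable_cfun g -> measurable_cfun (fun x => f x * g x).
Proof.
move=> [f1 f2] [g1 g2]; split.
  by under eq_fun do rewrite ReM; apply: measurable_funB; exact: measurable_funM.
by under eq_fun do rewrite ImM; apply: measurable_funD; exact: measurable_funM.
Qed.

Lemma measurable_cfun_prod (s : seq nat) (F : nat -> T -> R[i]) :
  (forall i, measurable_cfun (F i)) -> measurable_cfun (fun w => \prod_(i <- s) F i w).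
Proof.
move=> mF; elim: s => [|a s IH].
  by under eq_fun do rewrite big_nil; exact: measurable_cfun_cst.
by under eq_fun do rewrite big_cons; exact: measurable_cfunM.
Qed.

Lemma measurable_cfun_if (b : T -> bool) f g : measurable_fun setT b ->
  measurable_cfun f -> measurable_cfun g -> measurable_cfun (fun x => if b x then f x else g x).
Proof.
move=> mb [f1 f2] [g1 g2]; split.
  by under eq_fun do rewrite (fun_if (@complex.Re R)); exact: measurable_fun_ifT.
by under eq_fun do rewrite (fun_if (@complex.Im R)); exact: measurable_fun_ifT.
Qed.

Lemma measurable_fcos (f : T -> R) :
  measurable_fun setT f -> measurable_fun setT (fun x => cos (f x)).
Proof.
move=> mf; apply: (measurableT_comp (f := @cos R)) => //.
by apply: continuous_measurable_fun; exact: continuous_cos.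
Qed.

Lemma measurable_fsin (f : T -> R) :
  measurable_fun setT f -> measurable_fun setT (fun x => sin (f x)).
Proof.
move=> mf; apply: (measurableT_comp (f := @sin R)) => //.
by apply: continuous_measurable_fun; exact: continuous_sin.
Qed.

Lemma measurable_cfun_cis (f : T -> R) :
  measurable_fun setT f -> measurable_cfun (fun w => cis (f w)).
Proof. by move=> mf; split; [exact: measurable_fcos | exact: measurable_fsin]. Qed.

Lemma measurable_cfun_cvg (f : nat -> T -> R[i]) g : (forall n, measurable_cfun (f n)) ->
  (forall x, ccvg (f ^~ x) (g x)) -> measurable_cfun g.
Proof.
move=> mf fg; split.
  apply: (measurable_fun_cvg (h := fun n x => Re (f n x))) => [n|x _]; first by have [] := mf n.
  by have [] := fg x.
apply: (measurable_fun_cvg (h := fun n x => Im (f n x))) => [n|x _]; first by have [] := mf n.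
by have [] := fg x.
Qed.

Lemma measurable_cfun_bounded f (M : R) :
  measurable_cfun f -> (forall x, normc (f x) <= M) -> bounded_cfun f.
Proof.
move=> [f1 f2] fM; split; split => //; exists M => x.
  exact: (le_trans (norm_Re_le _)).
exact: (le_trans (norm_Im_le _)).
Qed.

Lemma bounded_cfun_cst (c : R[i]) : bounded_cfun (fun _ : T => c).
Proof. by split; exact: bounded_mfun_cst. Qed.

Lemma bounded_cfunD f g :
  bounded_cfun f -> bounded_cfun g -> bounded_cfun (fun x => f x + g x).
Proof.
move=> [f1 f2] [g1 g2]; split; first by under eq_fun do rewrite ReD; exact: bounded_mfunD.
by under eq_fun do rewrite ImD; exact: bounded_mfunD.
Qed.

Lemma bounded_cfunN f : bounded_cfun f -> bounded_cfun (fun x => - f x).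
Proof.
move=> [f1 f2]; split; first by under eq_fun do rewrite ReN; exact: bounded_mfunN.
by under eq_fun do rewrite ImN; exact: bounded_mfunN.
Qed.

Lemma bounded_cfunM f g :
  bounded_cfun f -> bounded_cfun g -> bounded_cfun (fun x => f x * g x).
Proof.
move=> [f1 f2] [g1 g2]; split; first by under eq_fun do rewrite ReM; solve_bounded.
by under eq_fun do rewrite ImM; solve_bounded.
Qed.

Lemma bounded_mfun_normc f : bounded_cfun f -> bounded_mfun (fun x => normc (f x)).
Proof.
move=> [[m1 [M1 b1]] [m2 [M2 b2]]]; split.
  under eq_fun do rewrite normcE; apply: (@measurableT_comp _ _ _ _ _ _ (@Num.sqrt R)).
    by apply: continuous_measurable_fun; exact: sqrt_continuous.
  by apply: measurable_funD; exact: measurable_funX.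
exists (M1 + M2) => x; rewrite ger0_norm ?normc_ge0//.
by rewrite (le_trans (normc_le_Re_Im _))// lerD.
Qed.
End measurable_cfun_theory.

Ltac solve_cbounded := repeat first [ assumption | exact: bounded_cfun_cst
  | apply: bounded_cfunN | apply: bounded_cfunD | apply: bounded_cfunM ].

Section cmean_theory.
Context d (T : measurableType d) (R : realType) (mu : probability T R).
Implicit Types f g : T -> R[i].

Lemma cmean_cst c : cmean mu (fun=> c) = c.
Proof. by rewrite /cmean !mean_cst; case: c. Qed.

Lemma cmeanD f g : bounded_cfun f -> bounded_cfun g ->
  cmean mu (fun x => f x + g x) = cmean mu f + cmean mu g.
Proof.
move=> [f1 f2] [g1 g2]; apply: complex_eqP; rewrite ?ReD ?ImD/=.
  by under eq_fun do rewrite ReD; apply: meanD; exact: bounded_mfun_integrable.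
by under eq_fun do rewrite ImD; apply: meanD; exact: bounded_mfun_integrable.
Qed.

Lemma cmeanN f : bounded_cfun f -> cmean mu (fun x => - f x) = - cmean mu f.
Proof.
move=> [f1 f2]; apply: complex_eqP; rewrite ?ReN ?ImN/=.
  by under eq_fun do rewrite ReN; apply: meanN; exact: bounded_mfun_integrable.
by under eq_fun do rewrite ImN; apply: meanN; exact: bounded_mfun_integrable.
Qed.

Lemma cmeanB f g : bounded_cfun f -> bounded_cfun g ->
  cmean mu (fun x => f x - g x) = cmean mu f - cmean mu g.
Proof. by move=> bf bg; rewrite cmeanD ?cmeanN//; exact: bounded_cfunN. Qed.

Lemma cmeanZl c f : bounded_cfun f -> cmean mu (fun x => c * f x) = c * cmean mu f.
Proof.
move=> [f1 f2]; apply: complex_eqP; rewrite ?ReM ?ImM/=.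
  under eq_fun do rewrite ReM.
  by rewrite meanB ?meanZl//; apply: bounded_mfun_integrable; solve_bounded.
under eq_fun do rewrite ImM.
by rewrite meanD ?meanZl//; apply: bounded_mfun_integrable; solve_bounded.
Qed.

(* Rotating the mean onto the positive real axis reduces this to the real case. *)
Lemma normc_cmean_le_mean f : bounded_cfun f -> normc (cmean mu f) <= mean mu (fun x => normc (f x)).
Proof.
move=> bf.
have [->|z0] := eqVneq (normc (cmean mu f)) 0; first exact/mean_ge0/(fun x => normc_ge0 _).
have zp : 0 < normc (cmean mu f) by rewrite lt_neqAle eq_sym z0 normc_ge0.
rewrite -(ler_pM2l zp) -expr2.
set c := Complex (Re (cmean mu f)) (- Im (cmean mu f)).
have cc : normc c = normc (cmean mu f) by rewrite !normcE/= sqrrN.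
have -> : normc (cmean mu f) ^+ 2 = Re (cmean mu (fun x => c * f x)).
  by rewrite cmeanZl// sqr_normcE ReM /c/= mulNr opprK !expr2.
rewrite -cc -meanZl; last exact/bounded_mfun_integrable/bounded_mfun_normc.
apply: le_mean => [||x].
- have [bRe _] : bounded_cfun (fun x => c * f x) by solve_cbounded.
  exact: bounded_mfun_integrable.
- by apply: bounded_mfun_integrable; solve_bounded; exact: bounded_mfun_normc.
- by rewrite -ComplexField.Normc.normcM (le_trans (ler_norm _))// norm_Re_le.
Qed.

Lemma normc_cmean_le f (g : T -> R) : bounded_cfun f -> Rintegrable mu g ->
  (forall x, normc (f x) <= g x) -> normc (cmean mu f) <= mean mu g.
Proof.
move=> bf bg fg; rewrite (le_trans (normc_cmean_le_mean bf))//; apply: le_mean => //.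
exact/bounded_mfun_integrable/bounded_mfun_normc.
Qed.

Lemma cmean_cvg_bounded (f : nat -> T -> R[i]) g (M : R) :
  (forall n, measurable_cfun (f n)) -> (forall n x, normc (f n x) <= M) ->
  (forall x, ccvg (f ^~ x) (g x)) -> ccvg (fun n => cmean mu (f n)) (cmean mu g).
Proof.
move=> mf fM fg; split => /=.
  apply: (@mean_cvg_bounded _ _ _ mu (fun n x => Re (f n x)) _ M) => [n|n x|x].
  - by have [] := mf n.
  - exact: le_trans (norm_Re_le _) (fM n x).
  - by have [] := fg x.
apply: (@mean_cvg_bounded _ _ _ mu (fun n x => Im (f n x)) _ M) => [n|n x|x].
- by have [] := mf n.
- exact: le_trans (norm_Im_le _) (fM n x).
- by have [] := fg x.
Qed.
End cmean_theory.

Section measurable_cmean.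
Context d1 d2 (T1 : measurableType d1) (T2 : measurableType d2) (R : realType).

Lemma measurable_cmean (mu : probability T2 R) (f : T1 * T2 -> R[i]) : measurable_cfun f ->
  measurable_cfun (fun x => cmean mu (fun y => f (x, y))).
Proof.
move=> [f1 f2]; split.
  exact: (@measurable_mean _ _ _ _ _ mu _ f1).
exact: (@measurable_mean _ _ _ _ _ mu _ f2).
Qed.
End measurable_cmean.

Section complex_convergence.
Variable R : realType.
Implicit Types (z w : nat -> R[i]) (k l : R[i]) (M : R).

Lemma ccvg_unique z k l : ccvg z k -> ccvg z l -> k = l.
Proof.
by move=> [zk1 zk2] [zl1 zl2]; apply: complex_eqP;
  [exact: cvg_unique zk1 zl1 | exact: cvg_unique zk2 zl2].
Qed.

Lemma ccvg_shiftS z l : ccvg (fun n => z n.+1) l -> ccvg z l.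
Proof. by move=> [z1 z2]; split; rewrite -cvg_shiftS. Qed.

Lemma ccvgBr z k l : ccvg z l -> ccvg (fun n => z n - k) (l - k).
Proof.
move=> [z1 z2]; split.
  by rewrite ReD ReN; under eq_fun do rewrite ReD ReN; apply: cvgB => //; exact: cvg_cst.
by rewrite ImD ImN; under eq_fun do rewrite ImD ImN; apply: cvgB => //; exact: cvg_cst.
Qed.

Lemma ccvgM z w k l : ccvg z k -> ccvg w l -> ccvg (fun n => z n * w n) (k * l).
Proof.
move=> [z1 z2] [w1 w2]; split.
  by rewrite ReM; under eq_fun do rewrite ReM; apply: cvgB; exact: cvgM.
by rewrite ImM; under eq_fun do rewrite ImM; apply: cvgD; exact: cvgM.
Qed.

Lemma normc_lim_le z l M : ccvg z l -> (forall n, normc (z n) <= M) -> normc l <= M.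
Proof.
move=> [zx zy] zM.
have M0 : 0 <= M by apply: le_trans (zM 0%N); exact: normc_ge0.
rewrite -(@ler_pXn2r _ 2)// ?nnegrE ?normc_ge0// sqr_normcE.
have c : (Re (z n) ^+ 2 + Im (z n) ^+ 2) @[n --> \oo] --> Re l ^+ 2 + Im l ^+ 2.
  by apply: cvgD; rewrite !expr2; under eq_fun do rewrite expr2; exact: cvgM.
apply: (@closed_cvg _ _ \oo _ _ (fun t => t <= M ^+ 2)) c => //.
by apply: nearW => n; rewrite -sqr_normcE lerXn2r ?nnegrE ?normc_ge0.
Qed.

Lemma geometric_cauchy_cvg (a : nat -> R) M : (forall n, `|a n.+1 - a n| <= M / 2 ^+ n) -> cvgn a.
Proof.
move=> aM; pose b := fun n => a n.+1 - a n.
have b_cvg : cvgn (series b).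
  apply: normed_cvg.
  apply: (@series_le_cvg _ _ (geometric M 2^-1)).
  - by move=> n /=.
  - by move=> n; rewrite /geometric/= exprVn; apply: le_trans (aM n).
  - by move=> n; rewrite /geometric/= exprVn; exact: aM.
  - by apply: is_cvg_geometric_series; rewrite ger0_norm ?invr_ge0// invf_lt1// ltr1n.
have -> : a = (fun n => a 0%N + series b n).
  apply/funext => n; elim: n => [|n IH]; first by rewrite /series/= big_geq// addr0.
  by rewrite seriesSr addrA -IH /b addrC subrK.
by apply: is_cvgD => //; exact: is_cvg_cst.
Qed.

Definition clim z : R[i] := Complex (limn (fun n => Re (z n))) (limn (fun n => Im (z n))).

Lemma geometric_cauchy_ccvg z M :
  (forall n, normc (z n.+1 - z n) <= M / 2 ^+ n) -> ccvg z (clim z).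
Proof.
move=> zM.
suff [c1 c2] : cvgn (fun n => Re (z n)) /\ cvgn (fun n => Im (z n)) by split; [exact: c1 | exact: c2].
split; apply: (@geometric_cauchy_cvg _ M) => n; apply: le_trans (zM n).
  by rewrite -ReN -ReD norm_Re_le.
by rewrite -ImN -ImD norm_Im_le.
Qed.
End complex_convergence.

Lemma eq_ler (R : realType) (x y : R) : x = y -> x <= y.
Proof. by move->. Qed.

Lemma ler0_archimedean (R : realType) (x c : R) : (forall n, x <= c / n.+1%:R) -> x <= 0.
Proof.
move=> xc; have harmonic_cvg : (c * harmonic n) @[n --> \oo] --> c * 0.
  by apply: cvgM; [exact: cvg_cst | exact: cvg_harmonic].
rewrite -(mulr0 c) -(cvg_lim _ harmonic_cvg)//; apply: limr_ge; first exact: cvgP harmonic_cvg.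
by apply: nearW => n; exact: xc.
Qed.

(** * Calculus and integration against the uniform law *)

Section pointwise_derivatives.
Variable R : realType.
Implicit Types (f g : R -> R) (x : R).

(* Unlike [is_derive], this is not a type class: a premise of this form is left as a subgoal
   by [rewrite], and the rules below apply to pointwise expressions. *)
Definition has_derive f x (a : R) : Prop := is_derive x 1 f a.

Lemma has_derive_id x : has_derive (fun y => y) x 1.
Proof. exact: is_derive_id. Qed.

Lemma has_derive_cst x (c : R) : has_derive (fun=> c) x 0.
Proof. exact: is_derive_cst. Qed.

Lemma has_deriveD f g x (a b : R) : has_derive f x a -> has_derive g x b ->
  has_derive (fun y => f y + g y) x (a + b).
Proof. by move=> hf hg; exact: is_deriveD. Qed.

Lemma has_deriveN f x (a : R) : has_derive f x a -> has_derive (fun y => - f y) x (- a).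
Proof. by move=> hf; exact: is_deriveN. Qed.

Lemma has_deriveM f g x (a b : R) : has_derive f x a -> has_derive g x b ->
  has_derive (fun y => f y * g y) x (f x * b + g x * a).
Proof. by move=> hf hg; exact: is_deriveM. Qed.

Lemma has_derive_comp f g x (a b : R) : has_derive f (g x) a -> has_derive g x b ->
  has_derive (fun y => f (g y)) x (a * b).
Proof. by move=> hf hg; exact: is_derive1_comp. Qed.

Lemma eq_has_derive f x (a b : R) : has_derive f x a -> a = b -> has_derive f x b.
Proof. by move=> fa <-. Qed.

Lemma has_deriveX f n x (a : R) : has_derive f x a ->
  has_derive (fun y => f y ^+ n) x (n%:R * f x ^+ n.-1 * a).
Proof.
case: n => [|n] hf.
  by rewrite mul0r mul0r; under eq_fun do rewrite expr0; exact: has_derive_cst.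
elim: n => [|n IH].
  by under eq_fun do rewrite expr1; rewrite expr0 !mul1r.
under eq_fun do rewrite exprS.
apply: eq_has_derive (has_deriveM hf IH) _; rewrite /= exprS -(natr1 n.+1); ring.
Qed.

Lemma has_derive_expR f x (a : R) : has_derive f x a ->
  has_derive (fun y => expR (f y)) x (expR (f x) * a).
Proof. by move=> hf; apply: (@has_derive_comp expR) => //; exact: is_derive_expR. Qed.

Lemma has_derive_cos f x (a : R) : has_derive f x a ->
  has_derive (fun y => cos (f y)) x (- sin (f x) * a).
Proof. by move=> hf; apply: (@has_derive_comp cos) => //; exact: is_derive_cos. Qed.

Lemma has_derive_sin f x (a : R) : has_derive f x a ->
  has_derive (fun y => sin (f y)) x (cos (f x) * a).
Proof. by move=> hf; apply: (@has_derive_comp sin) => //; exact: is_derive_sin. Qed.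

Lemma has_derive_ln f x (a : R) : 0 < f x -> has_derive f x a ->
  has_derive (fun y => ln (f y)) x ((f x)^-1 * a).
Proof. by move=> f0 hf; apply: (@has_derive_comp (@ln R)) => //; exact: is_derive1_ln. Qed.

Lemma has_deriveV f x (a : R) : f x != 0 -> has_derive f x a ->
  has_derive (fun y => (f y)^-1) x (- (f x) ^- 2 * a).
Proof. by move=> f0 hf; have := @is_deriveV _ f x a 1 f0 hf. Qed.

Lemma has_derive_derivable f x (a : R) : has_derive f x a -> derivable f x 1.
Proof. by case. Qed.

Lemma has_derive_continuous f x (a : R) : has_derive f x a -> {for x, continuous f}.
Proof. by case=> df _; exact/differentiable_continuous/derivable1_diffP. Qed.
End pointwise_derivatives.

Ltac derive_expr :=
  match goal with
  | |- has_derive (fun _ => ?c) _ _ => eapply has_derive_cst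
  | |- has_derive (fun x => x) _ _ => eapply has_derive_id
  | |- has_derive (fun x => @GRing.add _ (@?f x) (@?g x)) _ _ =>
    eapply (@has_deriveD _ f g); derive_expr
  | |- has_derive (fun x => @GRing.opp _ (@?f x)) _ _ => eapply (@has_deriveN _ f); derive_expr
  | |- has_derive (fun x => @GRing.mul _ (@?f x) (@?g x)) _ _ =>
    eapply (@has_deriveM _ f g); derive_expr
  | |- has_derive (fun x => @GRing.exp _ (@?f x) _) _ _ => eapply (@has_deriveX _ f); derive_expr
  | |- has_derive (fun x => expR (@?f x)) _ _ => eapply (@has_derive_expR _ f); derive_expr
  | |- has_derive (fun x => cos (@?f x)) _ _ => eapply (@has_derive_cos _ f); derive_expr
  | |- has_derive (fun x => sin (@?f x)) _ _ => eapply (@has_derive_sin _ f); derive_expr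
  | |- has_derive (fun x => ln (@?f x)) _ _ => eapply (@has_derive_ln _ f); [|derive_expr]
  | |- has_derive (fun x => GRing.inv (@?f x)) _ _ => eapply (@has_deriveV _ f); [|derive_expr]
  | _ => idtac
  end.

Ltac derive_expr_eq := eapply eq_has_derive; first derive_expr; rewrite /=.
Ltac derivable_expr := eapply has_derive_derivable; derive_expr.

Section interval_integrals.
Variable R : realType.
Implicit Types (f g F : R -> R) (a b c x : R).
Local Notation leb := (@lebesgue_measure R).

Definition itv_integral a b f : R := \int[leb]_(x in `]a, b[) f x.

Lemma eq_itv_integral a b f g :
  (forall x, a < x < b -> f x = g x) -> itv_integral a b f = itv_integral a b g.
Proof. by move=> fg; apply: eq_Rintegral => x; rewrite inE/= in_itv/= => /fg. Qed.

Lemma itv_integral0 a b : itv_integral a b (fun=> 0) = 0.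
Proof. by rewrite /itv_integral Rintegral_cst// mul0r. Qed.

Lemma bounded_integrable (A : set R) f : measurable A -> (leb A < +oo)%E ->
  measurable_fun setT f -> (exists M, forall x, A x -> `|f x| <= M) ->
  leb.-integrable A (EFin \o f).
Proof.
move=> mA Afin mf [M fM]; apply: measurable_bounded_integrable => //.
  exact: measurable_funTS.
exists M; split; first exact: num_real.
by move=> x Mx y /fM fy; exact: (le_trans fy (ltW Mx)).
Qed.

Lemma lebesgue_measure_oo_lty a b : (leb `]a, b[ < +oo)%E.
Proof. by rewrite lebesgue_measure_itv/=; case: ifP => _; rewrite -?EFinD ltry. Qed.

Lemma itv_integrable a b f : measurable_fun setT f ->
  (exists M, forall x, a < x < b -> `|f x| <= M) -> leb.-integrable `]a, b[ (EFin \o f).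
Proof.
move=> mf [M fM]; apply: bounded_integrable => //; first exact: lebesgue_measure_oo_lty.
by exists M => x /=; rewrite in_itv; exact: fM.
Qed.

Lemma itv_integral_cat a b c f : a <= b <= c -> measurable_fun setT f ->
  (exists M, forall x, a < x < c -> `|f x| <= M) ->
  itv_integral a c f = itv_integral a b f + itv_integral b c f.
Proof.
move=> /andP[]; rewrite le_eqVlt => /predU1P[<- _ _ _|ab].
  by rewrite /itv_integral set_itvoo0// Rintegral_set0 add0r.
rewrite le_eqVlt => /predU1P[<- _ _|bc mf [M fM]].
  by rewrite {3}/itv_integral set_itvoo0// Rintegral_set0 addr0.
have split_at_b : `]a, c[%classic = `]a, b[%classic `|` `[b, c[%classic :> set R.
  apply/seteqP; split => x /=; rewrite !in_itv/=.
    by move=> /andP[-> ->]/=; rewrite andbT; case: (ltP x b) => ?; [left|right].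
  move=> [/andP[-> /lt_trans->]//|/andP[/(lt_le_trans ab) -> ->]//].
rewrite {1}/itv_integral split_at_b Rintegral_setU//=.
- congr (_ + _); rewrite -Rintegral_itv_obnd_cbnd//.
  by apply: itv_integrable => //; exists M => x /andP[bx xc]; apply: fM; rewrite (lt_trans ab bx).
- rewrite -split_at_b; apply: itv_integrable => //; by exists M.
- apply/disj_set2P; rewrite -subset0 => x /=; rewrite !in_itv/= => -[/andP[_ xb] /andP[]].
  by rewrite leNgt xb.
Qed.

Lemma itv_integral_primitive a b F f g : a <= b ->
  (forall x, a < x < b -> f x = g x) ->
  (forall x, a <= x <= b -> has_derive F x (g x)) ->
  (forall x, a <= x <= b -> derivable g x 1) ->
  itv_integral a b f = F b - F a.
Proof.
rewrite le_eqVlt => /predU1P[<- _ _ _|ab fg dF dg].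
  by rewrite /itv_integral set_itvoo0// Rintegral_set0 subrr.
have cF x : a <= x <= b -> {for x, continuous F} by move=> /dF; exact: has_derive_continuous.
have cg : {within `[a, b], continuous g}.
  apply: continuous_in_subspaceT => x; rewrite inE/= in_itv/= => /dg.
  by move=> /derivable1_diffP/differentiable_continuous.
have FTC : (\int[leb]_(x in `[a, b]) (g x)%:E)%E = ((F b)%:E - (F a)%:E)%E.
  apply: (continuous_FTC2 ab cg).
  - split.
    + by move=> x; rewrite in_itv/= => /andP[ax xb]; have [] := dF x _; rewrite ?(ltW ax) ?(ltW xb).
    + by apply: cvg_at_right_filter; apply: cF; rewrite lexx ltW.
    + by apply: cvg_at_left_filter; apply: cF; rewrite lexx ltW.
  - move=> x; rewrite in_itv/= => /andP[ax xb]; rewrite derive1E.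
    by have [|_ ->] := dF x _; rewrite ?(ltW ax) ?(ltW xb).
have ig : leb.-integrable `[a, b] (EFin \o g).
  by apply: continuous_compact_integrable => //; exact: segment_compact.
rewrite (eq_itv_integral fg) /itv_integral Rintegral_itv_bndo_bndc; last first.
  by apply: integrableS ig => //; exact: subset_itv_oo_cc.
rewrite Rintegral_itv_obnd_cbnd; last by apply: integrableS ig => //; exact: subset_itv_oc_cc.
by rewrite /Rintegral FTC.
Qed.

Lemma measurable_affine a c : measurable_fun setT (fun x : R => a + c * x).
Proof. by apply: measurable_funD => //; exact: measurable_funM. Qed.

Lemma lebesgue_measure_affine a c (A : set R) : c != 0 -> measurable A ->
  leb A = (`|c|%:E * leb ((fun x => a + c * x)%R @^-1` A))%E.
Proof.
move=> c0 mA; pose h (x : measurableTypeR R) : measurableTypeR R := a + c * x.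
have mh : measurable_fun setT h := measurable_affine a c.
apply: (@lebesgue_measure_unique R (pushforward (mscale (NngNum (normr_ge0 c)) leb) h)) => //.
move=> X [[x y] /= xy <-]; rewrite /pushforward /mscale/= !lebesgue_measure_itv/= !lte_fin.
have cn : 0 < `|c| by rewrite normr_gt0.
have [cp|cn'] : 0 < c \/ c < 0 by case: (ltgtP c 0) c0 => //; [right|left].
  have -> : h @^-1` `]x, y] = `](x - a) / c, (y - a) / c]%classic.
    apply/seteqP; split => z/=; rewrite !in_itv/= /h ltr_pdivrMr// ler_pdivlMr// (mulrC z);
    lra.
  rewrite lebesgue_measure_itv/= lte_fin ltr_pM2r ?invr_gt0// ltrD2r.
  case: ifP => _; last by rewrite mule0.
  by rewrite -!EFinD -EFinM (gtr0_norm cp); congr EFin; field.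
have -> : h @^-1` `]x, y] = `[(y - a) / c, (x - a) / c[%classic.
  apply/seteqP; split => z/=; rewrite !in_itv/= /h ltr_ndivlMr// ler_ndivrMr// (mulrC z); lra.
rewrite lebesgue_measure_itv/= lte_fin ltr_nM2r ?invr_lt0// ltrD2r.
case: ifP => _; last by rewrite mule0.
by rewrite -!EFinD -EFinM (ltr0_norm cn'); congr EFin; field.
Qed.

Lemma ge0_integral_affine a c (D : set R) (f : R -> \bar R) : c != 0 -> measurable D ->
  measurable_fun setT f -> (forall x, 0 <= f x)%E ->
  (\int[leb]_(x in D) f x =
   `|c|%:E * \int[leb]_(x in (fun x => a + c * x)%R @^-1` D) f (a + c * x)%R)%E.
Proof.
move=> c0 mD mf f0; pose h (x : measurableTypeR R) : measurableTypeR R := a + c * x.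
have mh : measurable_fun setT h := measurable_affine a c.
have mhD : measurable (h @^-1` D) by rewrite -[X in measurable X]setTI; exact: mh.
have mfh : measurable_fun (h @^-1` D) (f \o h).
  by apply: measurable_funTS; exact: measurableT_comp mf mh.
have /= <- := ge0_integral_mscale leb mhD (NngNum (normr_ge0 c)) mfh (fun x _ => f0 (h x)).
rewrite -(ge0_integral_pushforward mh)//; last exact: measurable_funTS.
by apply: eq_measure_integral => A mA _; rewrite [LHS](lebesgue_measure_affine a c0).
Qed.

Lemma Rintegral_affine a c (D : set R) f : c != 0 -> measurable D -> measurable_fun setT f ->
  leb.-integrable D (EFin \o f) ->
  \int[leb]_(x in D) f x =
  `|c| * \int[leb]_(x in (fun x => a + c * x) @^-1` D) f (a + c * x).
Proof.
move=> c0 mD mf itf; set h := fun x => a + c * x.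
have mh : measurable_fun setT h := measurable_affine a c.
have mf' : measurable_fun setT (EFin \o f) by exact/measurable_EFinP.
have ch : 0 < `|c| by rewrite normr_gt0.
have pos := ge0_integral_affine a c0 mD (measurable_funepos mf') (funepos_ge0 (EFin \o f)).
have neg := ge0_integral_affine a c0 mD (measurable_funeneg mf') (funeneg_ge0 (EFin \o f)).
have fin_cancel (v : \bar R) : (`|c|%:E * v)%E \is a fin_num -> v \is a fin_num.
  by case: v => [r _||]; rewrite ?gt0_muley ?gt0_muleNy ?lte_fin.
have fine_cancel (u v u' v' : \bar R) : u \is a fin_num -> v \is a fin_num ->
    u = (`|c|%:E * u')%E -> v = (`|c|%:E * v')%E -> fine (u - v)%E = `|c| * fine (u' - v')%E.
  move=> ufin vfin uE vE; rewrite uE in ufin *; rewrite vE in vfin *.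
  have ufin' := fin_cancel _ ufin; have vfin' := fin_cancel _ vfin.
  by rewrite !fineB// !fineM// mulrBr.
have ifin : (\int[leb]_(x in D) (EFin \o f)^\+ x)%E \is a fin_num.
  exact: integrable_pos_fin_num.
have nfin : (\int[leb]_(x in D) (EFin \o f)^\- x)%E \is a fin_num.
  exact: integrable_neg_fin_num.
rewrite /Rintegral integralE [in RHS]integralE; apply: fine_cancel ifin nfin _ _.
  by rewrite pos; congr (_ * _)%E; apply: eq_integral => x _; rewrite !funeposE.
by rewrite neg; congr (_ * _)%E; apply: eq_integral => x _; rewrite !funenegE.
Qed.
End interval_integrals.

Section uniform_mean.
Variable R : realType.
Implicit Types (f : R -> R) (u w y c M : R).

Definition unif01 : probability (measurableTypeR R) R := uniform_prob (@ltr01 R).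

(* Composing with [clamp] does not change an integral against [unif01], but it turns
   functions bounded on [0, 1] into bounded functions. *)
Definition clamp u : R := Num.max 0 (Num.min u 1).

Lemma clamp_ge0 u : 0 <= clamp u. Proof. by rewrite /clamp le_max lexx. Qed.

Lemma clamp_le1 u : clamp u <= 1.
Proof. by rewrite /clamp ge_max ler01 ge_min lexx orbT. Qed.

Lemma clamp01 u : 0 <= clamp u <= 1. Proof. by rewrite clamp_ge0 clamp_le1. Qed.

Lemma clamp_id u : 0 <= u <= 1 -> clamp u = u.
Proof. by move=> /andP[u0 u1]; rewrite /clamp min_l// max_r. Qed.

Lemma measurable_clamp : measurable_fun setT clamp.
Proof. by apply: measurable_maxr => //; exact: measurable_minr. Qed.

Lemma measurable_fclamp d (T : measurableType d) (f : T -> R) :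
  measurable_fun setT f -> measurable_fun setT (fun x => clamp (f x)).
Proof. exact: measurableT_comp measurable_clamp. Qed.

Lemma mean_unif01E f : bounded_mfun f -> mean unif01 f = itv_integral 0 1 f.
Proof.
move=> bf; have [mf [M fM]] := bf.
have i01 g : bounded_mfun g -> (@lebesgue_measure R).-integrable `[0, 1] (EFin \o g).
  move=> [mg [N gN]]; apply: bounded_integrable => //; last by exists N.
  by rewrite lebesgue_measure_itv/= lte_fin ltr01 -EFinD ltry.
(* [integral_uniform] is stated for nonnegative functions. *)
have : mean unif01 (fun x => f x + M) = mean unif01 f + M.
  by rewrite meanD ?mean_cst//; apply: bounded_mfun_integrable => //; exact: bounded_mfun_cst.
rewrite [X in X = _]/mean /Rintegral integral_uniform; last 2 first.
- by apply/measurable_EFinP; exact: measurable_funD.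
- by move=> x; rewrite lee_fin -lerBlDr sub0r; have := fM x; rewrite ler_norml => /andP[].
rewrite subr0 invr1 mul1e -/(Rintegral _ _ _) RintegralD//; last 2 first.
- exact: i01.
- exact/i01/bounded_mfun_cst.
rewrite Rintegral_cst//= lebesgue_measure_itv/= lte_fin ltr01 oppr0 adde0/= mulr1.
move=> /addIr <-; rewrite /itv_integral Rintegral_itv_bndo_bndc; last first.
  by apply: itv_integrable => //; exists M.
rewrite Rintegral_itv_obnd_cbnd//; apply: integrableS (i01 _ bf) => //.
exact: subset_itv_oc_cc.
Qed.

Lemma mean_unif01_clamp f : measurable_fun setT f ->
  (exists M, forall x, 0 <= x <= 1 -> `|f x| <= M) ->
  mean unif01 (fun u => f (clamp u)) = itv_integral 0 1 f.
Proof.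
move=> mf [M fM]; rewrite mean_unif01E.
  by apply: eq_itv_integral => x /andP[x0 x1]; rewrite clamp_id// (ltW x0) (ltW x1).
split; first exact: measurableT_comp mf measurable_clamp.
by exists M => x; apply: fM; exact: clamp01.
Qed.

Lemma le_mean_unif01 (f g : measurableTypeR R -> R) : bounded_mfun f -> bounded_mfun g ->
  (forall u : R, 0 < u < 1 -> f u <= g u) -> mean unif01 f <= mean unif01 g.
Proof.
move=> bf bg fg; rewrite !mean_unif01E//; apply: le_Rintegral => //.
  by have [mf [M fM]] := bf; apply: itv_integrable => //; exists M.
by have [mg [M gM]] := bg; apply: itv_integrable => //; exists M.
Qed.

Definition left_piece y u : R := y * clamp u.
Definition right_piece y u : R := y * (1 - clamp u).

Lemma left_pieceDright_piece y u : left_piece y u + right_piece y u = y.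
Proof. by rewrite /left_piece /right_piece; ring. Qed.

Lemma left_piece_itv y u : 0 <= y -> 0 <= left_piece y u <= y.
Proof. by move=> y0; rewrite mulr_ge0 ?clamp_ge0//= ler_piMr ?clamp_le1. Qed.

Lemma right_piece_itv y u : 0 <= y -> 0 <= right_piece y u <= y.
Proof.
move=> /(left_piece_itv u); have := left_pieceDright_piece y u; lra.
Qed.

Lemma measurable_left_piece y : measurable_fun setT (left_piece y).
Proof. by apply: measurable_funM => //; exact: measurable_clamp. Qed.

Lemma measurable_right_piece y : measurable_fun setT (right_piece y).
Proof.
by apply: measurable_funM => //; apply: measurable_funB => //; exact: measurable_clamp.
Qed.

Lemma mean_left_piece f y : 0 < y -> measurable_fun setT f ->
  (exists M, forall w, 0 <= w <= y -> `|f w| <= M) ->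
  mean unif01 (fun u => f (left_piece y u)) = y^-1 * itv_integral 0 y f.
Proof.
move=> y0 mf [M fM]; have yn : y != 0 by rewrite gt_eqF.
rewrite (@mean_unif01_clamp (fun u => f (y * u))); last 2 first.
- by apply: (measurableT_comp mf); exact: measurable_funM.
- by exists M => x /andP[x0 x1]; apply: fM; rewrite mulr_ge0 ?ler_piMr// ltW.
rewrite [in RHS]/itv_integral (Rintegral_affine 0 yn)//; last first.
  by apply: itv_integrable => //; exists M => x /andP[x0 xy]; apply: fM; rewrite !ltW.
rewrite (gtr0_norm y0) mulKf//; have -> : (fun x => 0 + y * x) @^-1` `]0, y[ = `]0, 1[%classic.
  apply/seteqP; split => x /=; rewrite !in_itv/= add0r pmulr_rgt0// gtr_pMr//.
by apply: eq_Rintegral => x _; rewrite add0r.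
Qed.

Lemma mean_right_piece f y : 0 < y -> measurable_fun setT f ->
  (exists M, forall w, 0 <= w <= y -> `|f w| <= M) ->
  mean unif01 (fun u => f (right_piece y u)) = y^-1 * itv_integral 0 y f.
Proof.
move=> y0 mf [M fM]; have yn : - y != 0 by rewrite oppr_eq0 gt_eqF.
rewrite (@mean_unif01_clamp (fun u => f (y * (1 - u)))); last 2 first.
- by apply: (measurableT_comp mf); apply: measurable_funM => //; exact: measurable_funB.
- by exists M => x /andP[x0 x1]; apply: fM; nra.
rewrite [in RHS]/itv_integral (Rintegral_affine y yn)//; last first.
  by apply: itv_integrable => //; exists M => x /andP[x0 xy]; apply: fM; rewrite !ltW.
rewrite normrN (gtr0_norm y0) mulKf ?gt_eqF//.
have -> : (fun x => y + - y * x) @^-1` `]0, y[ = `]0, 1[%classic.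
  by apply/seteqP; split => x /=; rewrite !in_itv/= => /andP[? ?]; apply/andP; split; nra.
by apply: eq_Rintegral => x _; congr f; ring.
Qed.

Lemma bounded_mfun_left_piece f y M : 0 <= y -> measurable_fun setT f ->
  (forall w, 0 <= w <= y -> `|f w| <= M) -> bounded_mfun (fun u => f (left_piece y u)).
Proof.
move=> y0 mf fM; split; first exact: (measurableT_comp mf (measurable_left_piece y)).
by exists M => u; apply: fM; exact: left_piece_itv.
Qed.

Lemma bounded_mfun_right_piece f y M : 0 <= y -> measurable_fun setT f ->
  (forall w, 0 <= w <= y -> `|f w| <= M) -> bounded_mfun (fun u => f (right_piece y u)).
Proof.
move=> y0 mf fM; split; first exact: (measurableT_comp mf (measurable_right_piece y)).
by exists M => u; apply: fM; exact: right_piece_itv.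
Qed.

Lemma bounded_cfun_left_piece (f : R -> R[i]) y M : 0 <= y -> measurable_cfun f ->
  (forall w, 0 <= w <= y -> normc (f w) <= M) -> bounded_cfun (fun u => f (left_piece y u)).
Proof.
move=> y0 mf fM; apply: (@measurable_cfun_bounded _ _ _ _ M).
  exact: (measurable_cfun_comp mf (measurable_left_piece y)).
by move=> u; apply: fM; exact: left_piece_itv.
Qed.

Lemma bounded_cfun_right_piece (f : R -> R[i]) y M : 0 <= y -> measurable_cfun f ->
  (forall w, 0 <= w <= y -> normc (f w) <= M) -> bounded_cfun (fun u => f (right_piece y u)).
Proof.
move=> y0 mf fM; apply: (@measurable_cfun_bounded _ _ _ _ M).
  exact: (measurable_cfun_comp mf (measurable_right_piece y)).
by move=> u; apply: fM; exact: right_piece_itv.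
Qed.
End uniform_mean.

Arguments clamp {R} u.

Ltac solve_integrable := apply: bounded_mfun_integrable; solve_bounded.

Ltac solve_measurable := repeat first [ assumption | exact: measurable_cst | exact: measurable_id
  | exact: measurable_fst | exact: measurable_snd | apply: measurable_fcos | apply: measurable_fsin
  | apply: measurable_fclamp | apply: measurable_maxr | apply: measurable_funX
  | apply: measurable_funB | apply: measurable_funD | apply: measurable_funM
  | apply: measurable_funN ].

(** * Elementary Taylor bounds *)

Section taylor_bounds.
Variable R : realType.
Implicit Types (f : R -> R) (t x B M : R).

Lemma norm_sub0_le_derive f (f' : R -> R) t M :
  (forall x, `|x| <= `|t| -> has_derive f x (f' x)) ->
  (forall x, `|x| <= `|t| -> `|f' x| <= M) -> `|f t - f 0| <= M * `|t|.
Proof.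
move=> df bf.
wlog t0 : t f f' df bf / 0 <= t.
  move=> H; have [t0|t0] := leP 0 t; first exact: (H t f f' df bf t0).
  have := H (- t) (fun x => f (- x)) (fun x => - f' (- x)).
  rewrite !normrN opprK oppr0; apply.
  - move=> x xt; have dfN := df (- x); rewrite normrN in dfN.
    rewrite -[- f' (- x)]mulrN1; apply: (@has_derive_comp _ f (fun x => - x)); first exact: dfN.
    by derive_expr.
  - by move=> x xt; rewrite normrN; apply: bf; rewrite normrN.
  - by rewrite oppr_ge0 ltW.
have inb x : 0 <= x <= t -> `|x| <= `|t|.
  by move=> /andP[x0 xt]; rewrite !ger0_norm// (le_trans x0).
have [||c] := @MVT_segment R f f' 0 t t0.
- by move=> x; rewrite in_itv/= => /andP[x0 xt]; apply: df; apply: inb; rewrite !ltW.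
- apply: continuous_in_subspaceT => x; rewrite inE/= in_itv/= => /inb /df.
  exact: has_derive_continuous.
rewrite in_itv/= => /inb cb ->; rewrite subr0 normrM ler_wpM2r//.
exact: bf.
Qed.

Lemma sqr_le_norm x t : `|x| <= `|t| -> x ^+ 2 <= t ^+ 2.
Proof. by move=> xt; rewrite -(real_normK (num_real x)) -(real_normK (num_real t)) lerXn2r. Qed.

Lemma norm_sin_le t : `|sin t| <= `|t|.
Proof.
have := @norm_sub0_le_derive sin cos t 1; rewrite sin0 subr0 mul1r; apply.
  by move=> x _; exact: is_derive_sin.
by move=> x _; exact: cos_max.
Qed.

Lemma norm_cos_taylor0_le t : `|cos t - 1| <= t ^+ 2.
Proof.
have := @norm_sub0_le_derive cos (fun x => - sin x) t `|t|.
rewrite cos0 -expr2 real_normK ?num_real//; apply.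
  by move=> x _; exact: is_derive_cos.
by move=> x xt; rewrite normrN (le_trans (norm_sin_le x)).
Qed.

Lemma norm_sin_taylor1_le t : `|sin t - t| <= `|t| ^+ 3.
Proof.
have := @norm_sub0_le_derive (fun x => sin x - x) (fun x => cos x - 1) t (t ^+ 2).
rewrite sin0 !subr0 (exprSr _ 2) real_normK ?num_real//; apply.
  by move=> x _; derive_expr_eq; ring.
by move=> x xt; rewrite (le_trans (norm_cos_taylor0_le x))// sqr_le_norm.
Qed.

Lemma norm_cos_taylor2_le t : `|cos t - 1 + t ^+ 2 / 2| <= `|t| ^+ 4.
Proof.
have := @norm_sub0_le_derive (fun x => cos x - 1 + x ^+ 2 / 2) (fun x => - (sin x - x)) t (`|t| ^+ 3).
rewrite cos0 subrr expr0n/= mul0r addr0 subr0 -exprSr; apply.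
  by move=> x _; derive_expr_eq; field.
by move=> x xt; rewrite normrN (le_trans (norm_sin_taylor1_le x))// lerXn2r.
Qed.

Lemma norm_expR_taylor0_le t B : `|t| <= B -> `|expR t - 1| <= expR B * `|t|.
Proof.
move=> tB; have := @norm_sub0_le_derive expR expR t (expR B); rewrite expR0; apply.
  by move=> x _; exact: is_derive_expR.
move=> x xt; rewrite ger0_norm ?expR_ge0// ler_expR (le_trans (ler_norm _))//.
exact: le_trans xt tB.
Qed.

Lemma norm_expR_taylor1_le t B : `|t| <= B -> `|expR t - 1 - t| <= expR B * t ^+ 2.
Proof.
move=> tB.
have := @norm_sub0_le_derive (fun x => expR x - 1 - x) (fun x => expR x - 1) t (expR B * `|t|).
rewrite expR0 subrr !subr0 -mulrA -expr2 real_normK ?num_real//; apply.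
  by move=> x _; derive_expr_eq; ring.
move=> x xt; rewrite (le_trans (norm_expR_taylor0_le (le_trans xt tB)))//.
by rewrite ler_wpM2l ?expR_ge0.
Qed.

Lemma norm_expR_cos_taylor_le (a x t : R) : 0 <= a <= 1 -> `|x| <= 3 * a ^+ 2 -> `|t| <= a ->
  `|expR x * cos t - (1 + x - t ^+ 2 / 2)| <= (9 * expR 3 + 4) * a ^+ 3.
Proof.
move=> /andP[a0 a1] xa ta.
have a3 : a ^+ 3 * a <= a ^+ 3 by rewrite ler_piMr// exprn_ge0.
have x3 : `|x| <= 3 by apply: (le_trans xa); have := exprn_ile1 2 a0 a1; lra.
have -> : expR x * cos t - (1 + x - t ^+ 2 / 2) =
    (expR x - 1 - x) * cos t + x * (cos t - 1) + (cos t - 1 + t ^+ 2 / 2) by field.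
have exp_part : `|(expR x - 1 - x) * cos t| <= 9 * expR 3 * a ^+ 3.
  rewrite normrM (@le_trans _ _ `|expR x - 1 - x|) ?ler_piMr ?cos_max//.
  apply: (le_trans (norm_expR_taylor1_le x3)).
  have : x ^+ 2 <= 9 * a ^+ 3.
    rewrite -(real_normK (num_real x)).
    apply: (@le_trans _ _ ((3 * a ^+ 2) ^+ 2)); first by rewrite lerXn2r ?nnegrE// (le_trans _ xa).
    have -> : (3 * a ^+ 2) ^+ 2 = 9 * (a ^+ 3 * a) by ring.
    by rewrite ler_pM2l.
  have := expR_gt0 (3 : R); nra.
have mixed_part : `|x * (cos t - 1)| <= 3 * a ^+ 3.
  rewrite normrM (@le_trans _ _ (3 * a ^+ 2 * a ^+ 2))//.
    apply: ler_pM => //; apply: (le_trans (norm_cos_taylor0_le t)).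
    by rewrite -(real_normK (num_real t)) lerXn2r ?nnegrE.
  have -> : 3 * a ^+ 2 * a ^+ 2 = 3 * (a ^+ 3 * a) by ring.
  by rewrite ler_pM2l.
have cos_part : `|cos t - 1 + t ^+ 2 / 2| <= a ^+ 3.
  apply: (le_trans (norm_cos_taylor2_le t)); apply: le_trans a3.
  by rewrite -exprSr lerXn2r ?nnegrE.
have := ler_normD ((expR x - 1 - x) * cos t + x * (cos t - 1)) (cos t - 1 + t ^+ 2 / 2).
have := ler_normD ((expR x - 1 - x) * cos t) (x * (cos t - 1)).
lra.
Qed.

Lemma norm_expR_sin_taylor_le (a x t : R) : 0 <= a <= 1 -> `|x| <= 3 * a ^+ 2 -> `|t| <= a ->
  `|expR x * sin t - t| <= (3 * expR 3 + 1) * a ^+ 3.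
Proof.
move=> /andP[a0 a1] xa ta.
have x3 : `|x| <= 3 by apply: (le_trans xa); have := exprn_ile1 2 a0 a1; lra.
have -> : expR x * sin t - t = (expR x - 1) * sin t + (sin t - t) by ring.
have exp_part : `|(expR x - 1) * sin t| <= 3 * expR 3 * a ^+ 3.
  have -> : 3 * expR 3 * a ^+ 3 = expR 3 * (3 * a ^+ 2) * a by ring.
  rewrite normrM; apply: ler_pM => //; last exact: (le_trans (norm_sin_le t)).
  by apply: (le_trans (norm_expR_taylor0_le x3)); rewrite ler_wpM2l ?expR_ge0.
have sin_part : `|sin t - t| <= a ^+ 3.
  by apply: (le_trans (norm_sin_taylor1_le t)); rewrite lerXn2r ?nnegrE.
have := ler_normD ((expR x - 1) * sin t) (sin t - t).
lra.
Qed.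

Lemma expR_sub1_le t : expR t - 1 <= t * expR t.
Proof.
have := expR_ge1Dx (- t); rewrite expRN -[_^-1]div1r ler_pdivlMr ?expR_gt0//; lra.
Qed.
End taylor_bounds.

(** * The splitting equation to second order *)

Section second_order_expansion.
Variable R : realType.
Implicit Types s y w : R.
Local Notation unif01 := (unif01 R).

(* In the variable [s], the solution of the splitting equation is
   [1 + i s lin_coef + s ^ 2 quad_coef + O(s ^ 3)]; the value of [var_rate], which is half of
   the variance [16 ln 2 - 10], is the one for which [quad_coef] has integral 0. *)
Definition var_rate : R := 8 * ln 2 - 5.

Definition lin_coef w : R := if w <= 1 then 1 - 2 * w else 0.

Definition quad_coef_short w : R := var_rate * w / 2 - (1 - 2 * w) ^+ 2 / 2.

Definition quad_coef_mid w : R := 4 * w * (ln 2 - ln w) - 7 / 2 * w + 2 * w ^+ 2 - 1.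

Definition quad_coef w : R :=
  if w <= 1 then quad_coef_short w else if w <= 2 then quad_coef_mid w else 0.

Definition quad_primitive_short w : R :=
  var_rate * w ^+ 2 / 4 + (1 - 2 * w) ^+ 3 / 12 - 1 / 12.

Definition quad_primitive_mid w : R :=
  w ^+ 2 * (2 * (ln 2 - ln w) - 3 / 4) + 2 / 3 * w ^+ 3 - w - 1 / 3.

Lemma ln2_itv : 0 <= ln (2 : R) <= 1.
Proof.
apply/andP; split; first by rewrite ln_ge0// ler1n.
by have := @le_ln1Dx R 1; rewrite (_ : 1 + 1 = 2 :> R); [apply; lra | ring].
Qed.

Lemma ln2_gt58 : 5 / 8 < ln 2 :> R.
Proof.
rewrite -ltr_expR lnK ?posrE//.
pose a : R := expR (5 / 64); have a0 : 0 < a by exact: expR_gt0.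
have a1 : a <= 25 / 23.
  have := expR_ge1Dx (- (5 / 64) : R).
  by rewrite expRN -/a -[a^-1]div1r ler_pdivlMr//; lra.
have sqr_le (x b c : R) : 0 < x -> x <= b -> b ^+ 2 <= c -> x ^+ 2 <= c.
  by move=> x0 xb; apply: le_trans; rewrite lerXn2r ?nnegrE// ltW// (lt_le_trans x0).
have a2 : a ^+ 2 <= 13 / 11 by apply: (sqr_le _ _ _ a0 a1); lra.
have a4 : (a ^+ 2) ^+ 2 <= 7 / 5 by apply: (sqr_le _ _ _ _ a2); [rewrite exprn_gt0|lra].
have a8 : ((a ^+ 2) ^+ 2) ^+ 2 <= 49 / 25.
  by apply: (sqr_le _ _ _ _ a4); [rewrite !exprn_gt0|lra].
have -> : 5 / 8 = 8%:R * (5 / 64) :> R by field.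
by rewrite expRM_natl -/a; move: a8; rewrite -!exprM; lra.
Qed.

Lemma var_rate_gt0 : 0 < var_rate.
Proof. by have := ln2_gt58; rewrite /var_rate; lra. Qed.

Lemma var_rate_le3 : var_rate <= 3.
Proof. by have := ln2_itv; rewrite /var_rate; lra. Qed.

Lemma lin_coef_gt1 w : 1 < w -> lin_coef w = 0.
Proof. by rewrite /lin_coef leNgt => ->. Qed.

Lemma quad_coef_gt2 w : 2 < w -> quad_coef w = 0.
Proof. by move=> w2; rewrite /quad_coef !leNgt w2 (lt_trans _ w2)// ltr1n. Qed.

Lemma quad_coef_itv12 w : 1 < w <= 2 -> quad_coef w = quad_coef_mid w.
Proof. by move=> /andP[w1 w2]; rewrite /quad_coef leNgt w1 w2. Qed.

Lemma lin_coef_bound w : 0 <= w -> `|lin_coef w| <= 1.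
Proof. by rewrite /lin_coef => w0; case: ifP => h; rewrite ?normr0// ler_norml; lra. Qed.

Lemma quad_coef_bound w : 0 <= w -> `|quad_coef w| <= 24.
Proof.
rewrite /quad_coef => w0; have /andP[l0 l1] := ln2_itv.
case: ifPn => [w1|]; first by rewrite ler_norml /quad_coef_short /var_rate; nra.
rewrite -ltNge => w1; case: ifP => w2; last by rewrite normr0.
have lnw0 : 0 <= ln w by apply: ln_ge0; exact: ltW.
have lnw2 : ln w <= ln 2 by rewrite ler_ln ?posrE//; lra.
by rewrite ler_norml /quad_coef_mid; nra.
Qed.

Lemma measurable_lin_coef : measurable_fun setT lin_coef.
Proof.
apply: measurable_fun_ifT => //; first exact: measurable_fun_ler.
by solve_measurable.
Qed.

Lemma measurable_quad_coef : measurable_fun setT quad_coef.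
Proof.
apply: measurable_fun_ifT => //; first exact: measurable_fun_ler.
  by rewrite /quad_coef_short; solve_measurable.
apply: measurable_fun_ifT => //; first exact: measurable_fun_ler.
by rewrite /quad_coef_mid; solve_measurable; exact: measurable_ln.
Qed.

Lemma itv_integral_lin_coef y : 1 <= y -> itv_integral 0 y lin_coef = 0.
Proof.
move=> y1; rewrite (@itv_integral_cat _ 0 1); last 3 first.
- by rewrite ler01.
- exact: measurable_lin_coef.
- by exists 1 => x /andP[x0 _]; exact/lin_coef_bound/ltW.
rewrite (@itv_integral_primitive _ 0 1 (fun w => w - w ^+ 2) _ (fun w => 1 - 2 * w))//.
- rewrite (@eq_itv_integral _ _ _ _ (fun=> 0)) ?itv_integral0; first by ring.
  by move=> x /andP[x1 _]; exact: lin_coef_gt1.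
- by move=> x /andP[_ x1]; rewrite /lin_coef ltW.
- by move=> x _; derive_expr_eq; ring.
Qed.

Lemma has_derive_quad_primitive_mid w : 0 < w ->
  has_derive quad_primitive_mid w (quad_coef_mid w).
Proof.
move=> w0; rewrite /quad_primitive_mid; derive_expr_eq; first by [].
by rewrite /quad_coef_mid; field; rewrite gt_eqF.
Qed.

Lemma itv_integral_quad_coef_mid y : 1 <= y <= 2 ->
  itv_integral 1 y quad_coef = quad_primitive_mid y - quad_primitive_mid 1.
Proof.
move=> /andP[y1 y2].
apply: (@itv_integral_primitive _ 1 y quad_primitive_mid _ quad_coef_mid y1) => x /andP[x1 xy].
- by rewrite quad_coef_itv12// x1 (le_trans (ltW xy)).
- by apply: has_derive_quad_primitive_mid; exact: lt_le_trans ltr01 x1.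
- rewrite /quad_coef_mid; derivable_expr.
  exact: lt_le_trans ltr01 x1.
Qed.

Lemma itv_integral_quad_coef y : 1 <= y ->
  itv_integral 0 y quad_coef = if y <= 2 then quad_primitive_mid y else 0.
Proof.
have bnd a b : 0 <= a -> exists M, forall x, a < x < b -> `|quad_coef x| <= M.
  by move=> a0; exists 24 => x /andP[ax _]; apply/quad_coef_bound/ltW/(le_lt_trans a0).
move=> y1; rewrite (@itv_integral_cat _ 0 1); last 3 first.
- by rewrite ler01.
- exact: measurable_quad_coef.
- exact: bnd.
have -> : itv_integral 0 1 quad_coef = quad_primitive_mid 1.
  rewrite (@itv_integral_primitive _ 0 1 quad_primitive_short _ quad_coef_short)//.
  - by rewrite /quad_primitive_short /quad_primitive_mid ln1 /var_rate; field.
  - by move=> x /andP[_ x1]; rewrite /quad_coef ltW.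
  - move=> x _; rewrite /quad_primitive_short /quad_coef_short.
    by derive_expr_eq; field.
have [y2|y2] := leP y 2; first by rewrite itv_integral_quad_coef_mid ?y1// subrKC.
rewrite (@itv_integral_cat _ 1 2); last 3 first.
- by rewrite ler1n/= ltW.
- exact: measurable_quad_coef.
- exact: bnd.
rewrite (@eq_itv_integral _ 2 _ _ (fun=> 0)) ?itv_integral0; last first.
  by move=> x /andP[x2 _]; exact: quad_coef_gt2.
rewrite itv_integral_quad_coef_mid ?lexx ?ler1n// addr0 subrKC.
by rewrite /quad_primitive_mid subrr; field.
Qed.

Lemma itv_integral_lin_coef_convolution y : 1 < y ->
  itv_integral 0 y (fun w => lin_coef w * lin_coef (y - w)) =
  if y <= 2 then - (2 / 3) * y ^+ 3 + 2 * y ^+ 2 - y - 2 / 3 else 0.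
Proof.
move=> y1; have vanish w : 0 < w < y -> w < y - 1 \/ 1 < w -> lin_coef w * lin_coef (y - w) = 0.
  move=> _ [w1|w1]; last by rewrite lin_coef_gt1// mul0r.
  by rewrite [X in _ * X]lin_coef_gt1 ?mulr0//; lra.
have mconv : measurable_fun setT (fun w => lin_coef w * lin_coef (y - w)).
  apply: measurable_funM; first exact: measurable_lin_coef.
  by apply: (measurableT_comp measurable_lin_coef); exact: measurable_funB.
have bnd a b : 0 <= a -> b <= y ->
    exists M, forall w, a < w < b -> `|lin_coef w * lin_coef (y - w)| <= M.
  move=> a0 b0; exists 1 => w wab; rewrite normrM mulr_ile1//; apply: lin_coef_bound; lra.
have [y2|y2] := leP y 2; last first.
  rewrite (@eq_itv_integral _ _ _ _ (fun=> 0)) ?itv_integral0// => w w0y; apply: vanish => //.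
  by have [w1|w1] := leP w 1; [left; lra | right].
rewrite (@itv_integral_cat _ 0 (y - 1) y)//; last 2 first.
- lra.
- exact: bnd.
rewrite (@itv_integral_cat _ (y - 1) 1 y)//; last 2 first.
- lra.
- by apply: bnd => //; lra.
rewrite (@eq_itv_integral _ 0 _ _ (fun=> 0)); last by move=> w h; apply: vanish; [|left]; lra.
rewrite (@eq_itv_integral _ 1 _ _ (fun=> 0)); last by move=> w h; apply: vanish; [|right]; lra.
rewrite !itv_integral0 add0r addr0.
rewrite (@itv_integral_primitive _ _ _
  (fun w => (1 - 2 * y) * w + 4 * (y * w ^+ 2 / 2 - w ^+ 3 / 3)) _
  (fun w => (1 - 2 * w) * (1 - 2 * (y - w)))).
- by field.
- lra.
- by move=> w h; rewrite /lin_coef !ifT//; lra.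
- by move=> w _; derive_expr_eq; field.
- by move=> w _; derivable_expr.
Qed.

Lemma mean_lin_coef_pieces y : 1 < y ->
  mean unif01 (fun u => lin_coef (left_piece y u)) = 0 /\
  mean unif01 (fun u => lin_coef (right_piece y u)) = 0.
Proof.
move=> y1; have y0 : 0 < y by lra.
have bnd : exists M, forall w, 0 <= w <= y -> `|lin_coef w| <= M.
  by exists 1 => w /andP[w0 _]; exact: lin_coef_bound.
have m := measurable_lin_coef.
by rewrite mean_left_piece// mean_right_piece// itv_integral_lin_coef ?mulr0// ltW.
Qed.

Lemma mean_quad_coef_pieces y : 1 < y ->
  mean unif01 (fun u => quad_coef (left_piece y u)) =
    (if y <= 2 then y^-1 * quad_primitive_mid y else 0) /\
  mean unif01 (fun u => quad_coef (right_piece y u)) =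
    (if y <= 2 then y^-1 * quad_primitive_mid y else 0).
Proof.
move=> y1; have y0 : 0 < y by lra.
have bnd : exists M, forall w, 0 <= w <= y -> `|quad_coef w| <= M.
  by exists 24 => w /andP[w0 _]; exact: quad_coef_bound.
have m := measurable_quad_coef.
have quad_integral := itv_integral_quad_coef (ltW y1).
by split; rewrite (mean_left_piece, mean_right_piece)// quad_integral; case: (y <= 2); rewrite ?mulr0.
Qed.

Lemma mean_lin_coef_mul y : 1 < y ->
  mean unif01 (fun u => lin_coef (left_piece y u) * lin_coef (right_piece y u)) =
  if y <= 2 then y^-1 * (- (2 / 3) * y ^+ 3 + 2 * y ^+ 2 - y - 2 / 3) else 0.
Proof.
move=> y1; have y0 : 0 < y by lra.
have -> : (fun u => lin_coef (left_piece y u) * lin_coef (right_piece y u)) =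
    fun u => lin_coef (left_piece y u) * lin_coef (y - left_piece y u).
  by apply/funext => u; congr (_ * lin_coef _); have := left_pieceDright_piece y u; lra.
rewrite (@mean_left_piece _ (fun w => lin_coef w * lin_coef (y - w)))//; last 2 first.
- apply: measurable_funM; first exact: measurable_lin_coef.
  by apply: (measurableT_comp measurable_lin_coef); exact: measurable_funB.
- by exists 1 => w w0y; rewrite normrM mulr_ile1//; apply: lin_coef_bound; lra.
by rewrite itv_integral_lin_coef_convolution//; case: ifP; rewrite ?mulr0.
Qed.

Lemma quad_coef_splitting y : 1 < y ->
  mean unif01 (fun u => quad_coef (left_piece y u)) +
  mean unif01 (fun u => quad_coef (right_piece y u)) -
  mean unif01 (fun u => lin_coef (left_piece y u) * lin_coef (right_piece y u)) = quad_coef y.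
Proof.
move=> y1; have [-> ->] := mean_quad_coef_pieces y1; rewrite mean_lin_coef_mul//.
have [y2|y2] := leP y 2; last by rewrite quad_coef_gt2// addr0 subr0.
rewrite quad_coef_itv12 ?y1// /quad_coef_mid /quad_primitive_mid; field; rewrite gt_eqF//; lra.
Qed.

Definition quad_approx s y : R[i] := Complex (1 + s ^+ 2 * quad_coef y) (s * lin_coef y).

Lemma measurable_quad_approx s : measurable_cfun (quad_approx s).
Proof.
have ml := measurable_lin_coef; have mq := measurable_quad_coef.
by split => /=; solve_measurable.
Qed.

Lemma quad_approx_ge2 s w : 2 <= w -> quad_approx s w = 1.
Proof.
move=> w2; rewrite /quad_approx lin_coef_gt1; last by lra.
have [w2'|w2'] := ltP 2 w; first by rewrite quad_coef_gt2// !mulr0 addr0.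
have -> : w = 2 by lra.
rewrite quad_coef_itv12 ?ltr1n ?lexx// /quad_coef_mid subrr.
by apply: complex_eqP => /=; field.
Qed.

Lemma sqr_le_norm_le1 s : `|s| <= 1 -> s ^+ 2 <= `|s|.
Proof. by move=> s1; rewrite -(real_normK (num_real s)) expr2 ler_piMr. Qed.

Lemma quad_approx_sub1_bound s y : `|s| <= 1 -> 0 <= y -> normc (quad_approx s y - 1) <= 25 * `|s|.
Proof.
move=> s1 y0; apply: (le_trans (normc_le_Re_Im _)); rewrite ReD ReN ImD ImN/= subr0.
have -> : 1 + s ^+ 2 * quad_coef y - 1 = s ^+ 2 * quad_coef y by ring.
rewrite normrM [X in _ + X]normrM (ger0_norm (sqr_ge0 s)).
have := quad_coef_bound y0; have := lin_coef_bound y0; have := sqr_le_norm_le1 s1.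
have := normr_ge0 (quad_coef y); have := normr_ge0 (lin_coef y); nra.
Qed.

Lemma quad_approx_bound s y : `|s| <= 1 -> 0 <= y -> normc (quad_approx s y) <= 26.
Proof.
move=> s1 y0; have -> : quad_approx s y = (quad_approx s y - 1) + 1 by rewrite subrK.
apply: (le_trans (normc_leD _ _)); rewrite ComplexField.Normc.normc1.
by have := quad_approx_sub1_bound s1 y0; lra.
Qed.

(* Short intervals are never split; this is the exact solution there. *)
Definition unsplit s y : R[i] := (expR (var_rate * s ^+ 2 / 2 * y))%:C * cis (s * (1 - 2 * y)).

Lemma normc_unsplit s y : normc (unsplit s y) = expR (var_rate * s ^+ 2 / 2 * y).
Proof. by rewrite ComplexField.Normc.normcM normc_cis mulr1 normc_real ger0_norm ?expR_ge0. Qed.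

Lemma measurable_unsplit s : measurable_cfun (unsplit s).
Proof.
apply: measurable_cfunM; last by apply: measurable_cfun_cis; solve_measurable.
split => //=; apply: (measurableT_comp (@measurable_expR R)); solve_measurable.
Qed.

Lemma unsplit_quad_approx s y : `|s| <= 1 -> 0 <= y <= 1 ->
  normc (unsplit s y - quad_approx s y) <= (12 * expR 3 + 5) * `|s| ^+ 3.
Proof.
move=> s1 /andP[y0 y1]; have v0 := var_rate_gt0; have v3 := var_rate_le3.
set x := var_rate * s ^+ 2 / 2 * y; set t := s * (1 - 2 * y).
have x_le : `|x| <= 3 * `|s| ^+ 2.
  have -> : x = var_rate * y / 2 * `|s| ^+ 2 by rewrite /x real_normK ?num_real//; field.
  rewrite normrM normrX normr_id ler_wpM2r ?sqr_ge0// ler_norml; nra.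
have t_le : `|t| <= `|s| by rewrite /t normrM ler_piMr// ler_norml; lra.
have s01 : 0 <= `|s| <= 1 by rewrite normr_ge0 s1.
have ReE : Re (unsplit s y - quad_approx s y) = expR x * cos t - (1 + x - t ^+ 2 / 2).
  rewrite ReD ReN Re_realM/= -/x -/t /quad_coef y1 /quad_coef_short.
  by congr (_ - _); rewrite /x /t; field.
have ImE : Im (unsplit s y - quad_approx s y) = expR x * sin t - t.
  by rewrite ImD ImN Im_realM/= -/x -/t /lin_coef y1.
apply: (le_trans (normc_le_Re_Im _)); rewrite ReE ImE.
have := norm_expR_cos_taylor_le s01 x_le t_le; have := norm_expR_sin_taylor_le s01 x_le t_le.
lra.
Qed.

Lemma unsplit_pieces s y u :
  unsplit s (left_piece y u) * unsplit s (right_piece y u) = unsplit s y * cis s.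
Proof.
rewrite /unsplit /left_piece /right_piece [LHS]mulrACA -cisD -[RHS]mulrA -cisD -rmorphM/= -expRD.
by congr ((expR _)%:C * cis _); ring.
Qed.
End second_order_expansion.

(** * Picard iteration for the splitting equation *)

Section split_operator.
Variable R : realType.
Implicit Types (y w u h l B D M : R) (f g : R -> R[i]).
Local Notation unif01 := (unif01 R).

Definition split_op f y : R[i] :=
  cmean unif01 (fun u => f (left_piece y u) * f (right_piece y u)).

Lemma measurable_split_op f : measurable_cfun f -> measurable_cfun (split_op f).
Proof.
move=> mf; apply: (@measurable_cmean _ _ _ _ _ unif01
  (fun z => f (left_piece z.1 z.2) * f (right_piece z.1 z.2))).
apply: measurable_cfunM; apply: (measurable_cfun_comp mf); first by solve_measurable.
by solve_measurable.
Qed.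

Lemma bounded_cfun_split f y M : 0 <= y -> measurable_cfun f ->
  (forall w, 0 <= w <= y -> normc (f w) <= M) ->
  bounded_cfun (fun u => f (left_piece y u) * f (right_piece y u)).
Proof.
move=> y0 mf fM; apply: bounded_cfunM.
  exact: bounded_cfun_left_piece mf fM.
exact: bounded_cfun_right_piece mf fM.
Qed.

Lemma normc_mul_pieces_le f h y u : 0 <= y ->
  (forall w, 0 <= w <= y -> normc (f w) <= expR (h * w)) ->
  normc (f (left_piece y u) * f (right_piece y u)) <= expR (h * y).
Proof.
move=> y0 fh; rewrite ComplexField.Normc.normcM -[in leRHS](left_pieceDright_piece y u).
rewrite mulrDr expRD; apply: ler_pM; rewrite ?normc_ge0//; apply: fh.
  exact: left_piece_itv.
exact: right_piece_itv.
Qed.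

Lemma normc_split_op_le f h y : 0 <= h -> 0 <= y -> measurable_cfun f ->
  (forall w, 0 <= w <= y -> normc (f w) <= expR (h * w)) -> normc (split_op f y) <= expR (h * y).
Proof.
move=> h0 y0 mf fh; rewrite -[leRHS](mean_cst unif01); apply: normc_cmean_le.
- apply: (@bounded_cfun_split _ _ (expR (h * y))) => // w w0y; apply: (le_trans (fh w w0y)).
  by rewrite ler_expR ler_wpM2l//; case/andP: w0y.
- by solve_integrable.
- by move=> u; exact: normc_mul_pieces_le.
Qed.

Lemma measurable_expR_scale h : measurable_fun setT (fun w => expR (h * w)).
Proof. by apply: (measurableT_comp (@measurable_expR R)); exact: measurable_funM. Qed.

Lemma expR_scale_bound h y w : 0 <= h -> 0 <= w <= y -> `|expR (h * w)| <= expR (h * y).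
Proof.
by move=> h0 /andP[w0 wy]; rewrite ger0_norm ?expR_ge0// ler_expR ler_wpM2l.
Qed.

Lemma itv_integral_expR_le l y : 0 < l -> 0 < y ->
  y^-1 * itv_integral 0 y (fun w => expR (l * w)) <= expR (l * y) / (l * y).
Proof.
move=> l0 y0; rewrite (@itv_integral_primitive _ 0 y (fun w => l^-1 * expR (l * w)) _
  (fun w => expR (l * w)) (ltW y0))//.
- have -> : y^-1 * (l^-1 * expR (l * y) - l^-1 * expR (l * 0)) = (expR (l * y) - 1) / (l * y).
    by rewrite mulr0 expR0; field; rewrite !gt_eqF.
  by rewrite ler_pM2r ?invr_gt0 ?mulr_gt0// gerBl.
- by move=> w _; derive_expr_eq; field; rewrite gt_eqF.
Qed.

Lemma mean_expR_left_piece_le l y : 0 < l -> 0 < y ->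
  mean unif01 (fun u => expR (l * left_piece y u)) <= expR (l * y) / (l * y).
Proof.
move=> l0 y0; rewrite (@mean_left_piece _ (fun w => expR (l * w)))//.
- exact: itv_integral_expR_le.
- exact: measurable_expR_scale.
- by exists (expR (l * y)) => w; apply: expR_scale_bound; exact: ltW.
Qed.

Lemma mean_expR_right_piece_le l y : 0 < l -> 0 < y ->
  mean unif01 (fun u => expR (l * right_piece y u)) <= expR (l * y) / (l * y).
Proof.
move=> l0 y0; rewrite (@mean_right_piece _ (fun w => expR (l * w)))//.
- exact: itv_integral_expR_le.
- exact: measurable_expR_scale.
- by exists (expR (l * y)) => w; apply: expR_scale_bound; exact: ltW.
Qed.

Lemma bounded_mfun_expR_pieces h y : 0 <= h -> 0 <= y ->
  bounded_mfun (fun u => expR (h * left_piece y u) : R) /\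
  bounded_mfun (fun u => expR (h * right_piece y u) : R).
Proof.
move=> h0 y0; have mexp := measurable_expR_scale h; split.
  apply: (@bounded_mfun_left_piece _ (fun w => expR (h * w)) _ (expR (h * y))) => // w.
  exact: expR_scale_bound.
apply: (@bounded_mfun_right_piece _ (fun w => expR (h * w)) _ (expR (h * y))) => // w.
exact: expR_scale_bound.
Qed.

Lemma normc_mulB_le (a b c e : R[i]) :
  normc (a * b - c * e) <= normc (a - c) * normc b + normc c * normc (b - e).
Proof.
have -> : a * b - c * e = (a - c) * b + c * (b - e) by ring.
by rewrite (le_trans (normc_leD _ _))// !ComplexField.Normc.normcM.
Qed.

(* The weight [expR (l * y)] makes [split_op] a contraction once [l > 2 * B]. *)
Lemma split_op_contraction f g B h l D y :
  0 <= h -> 0 < l -> 1 <= y -> 0 <= B -> 0 <= D -> measurable_cfun f -> measurable_cfun g ->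
  (forall w, 0 <= w -> normc (f w) <= B * expR (h * w)) ->
  (forall w, 0 <= w -> normc (g w) <= B * expR (h * w)) ->
  (forall w, 0 <= w -> normc (f w - g w) <= D * expR ((h + l) * w)) ->
  normc (split_op f y - split_op g y) <= 2 * B * D / l * expR ((h + l) * y).
Proof.
move=> h0 l0 y1 B0 D0 mf mg fB gB fgD.
have y0 : 0 < y by lra.
have bounded k : measurable_cfun k -> (forall w, 0 <= w -> normc (k w) <= B * expR (h * w)) ->
    bounded_cfun (fun u => k (left_piece y u) * k (right_piece y u)).
  move=> mk kB; apply: (@bounded_cfun_split _ _ (B * expR (h * y))); rewrite ?ltW//.
  move=> w /andP[w0 wy]; apply: (le_trans (kB w w0)).
  by rewrite ler_wpM2l// ler_expR ler_wpM2l.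
have [bl br] := bounded_mfun_expR_pieces (ltW l0) (ltW y0).
set q := B * D * expR (h * y); have q0 : 0 <= q by rewrite !mulr_ge0 ?expR_ge0.
rewrite /split_op -cmeanB; [|exact: bounded..].
apply: (@le_trans _ _ (mean unif01
    (fun u => q * (expR (l * left_piece y u) + expR (l * right_piece y u))))).
  apply: normc_cmean_le => [||u].
  - by have := bounded f mf fB; have := bounded g mg gB => *; solve_cbounded.
  - by solve_integrable.
  have /andP[w0 _] := left_piece_itv u (ltW y0); have /andP[w0' _] := right_piece_itv u (ltW y0).
  have := left_pieceDright_piece y u.
  move: (left_piece y u) (right_piece y u) w0 w0' => w w' w0 w0' ww'.
  have qE : q = B * D * (expR (h * w) * expR (h * w')) by rewrite /q -ww' mulrDr expRD.
  rewrite (le_trans (normc_mulB_le _ _ _ _))// mulrDr lerD//.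
    rewrite (le_trans (ler_pM (normc_ge0 _) (normc_ge0 _) (fgD w w0) (fB w' w0')))//.
    by apply: eq_ler; rewrite qE mulrDl expRD; ring.
  rewrite (le_trans (ler_pM (normc_ge0 _) (normc_ge0 _) (gB w w0) (fgD w' w0')))//.
  by apply: eq_ler; rewrite qE mulrDl expRD; ring.
rewrite meanZl ?meanD; try by solve_integrable.
have drop_y : expR (l * y) / (l * y) <= expR (l * y) / l.
  by rewrite ler_pM2l ?expR_gt0// lef_pV2 ?posrE ?mulr_gt0// ler_peMr// ltW.
have ml := le_trans (mean_expR_left_piece_le l0 y0) drop_y.
have mr := le_trans (mean_expR_right_piece_le l0 y0) drop_y.
rewrite (le_trans (ler_wpM2l q0 (lerD ml mr)))//.
by rewrite /q (mulrDl h l y) expRD; apply: eq_ler; field; rewrite gt_eqF.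
Qed.
End split_operator.

Section quad_approx_residual.
Variable R : realType.
Implicit Types s y : R.
Local Notation unif01 := (unif01 R).

Lemma bounded_coef_pieces y : 0 <= y ->
  [/\ bounded_mfun (fun u : R => lin_coef (left_piece y u)),
      bounded_mfun (fun u : R => lin_coef (right_piece y u)),
      bounded_mfun (fun u : R => quad_coef (left_piece y u)) &
      bounded_mfun (fun u : R => quad_coef (right_piece y u))].
Proof.
have ml := @measurable_lin_coef R; have mq := @measurable_quad_coef R.
move=> y0; split.
- by apply: (@bounded_mfun_left_piece _ _ _ 1) => // w /andP[w0 _]; exact: lin_coef_bound.
- by apply: (@bounded_mfun_right_piece _ _ _ 1) => // w /andP[w0 _]; exact: lin_coef_bound.
- by apply: (@bounded_mfun_left_piece _ _ _ 24) => // w /andP[w0 _]; exact: quad_coef_bound.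
- by apply: (@bounded_mfun_right_piece _ _ _ 24) => // w /andP[w0 _]; exact: quad_coef_bound.
Qed.

Definition residual4 y : R :=
  mean unif01 (fun u => quad_coef (left_piece y u) * quad_coef (right_piece y u)).

Definition residual3 y : R :=
  mean unif01 (fun u => quad_coef (left_piece y u) * lin_coef (right_piece y u) +
                        lin_coef (left_piece y u) * quad_coef (right_piece y u)).

Lemma split_op_quad_approx s y : 1 < y ->
  split_op (quad_approx s) y - quad_approx s y =
  Complex (s ^+ 4 * residual4 y) (s ^+ 3 * residual3 y).
Proof.
move=> y1; have [bll blr bql bqr] := bounded_coef_pieces (ltW (lt_trans ltr01 y1)).
apply: complex_eqP; rewrite ?ReD ?ImD ?ReN ?ImN/=.
  rewrite -(quad_coef_splitting y1).
  rewrite (_ : (fun u => _) = (fun u => 1 + (s ^+ 2 *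
      (quad_coef (left_piece y u) + quad_coef (right_piece y u) -
       lin_coef (left_piece y u) * lin_coef (right_piece y u)) +
      s ^+ 4 * (quad_coef (left_piece y u) * quad_coef (right_piece y u))))); last first.
    by apply/funext => u; ring.
  rewrite meanD ?mean_cst ?meanD ?meanZl ?meanB ?meanD; try by solve_integrable.
  by rewrite /residual4; ring.
rewrite (_ : (fun u => _) = (fun u => s * (lin_coef (left_piece y u) + lin_coef (right_piece y u)) +
    s ^+ 3 * (quad_coef (left_piece y u) * lin_coef (right_piece y u) +
              lin_coef (left_piece y u) * quad_coef (right_piece y u)))); last first.
  by apply/funext => u; ring.
rewrite meanD ?meanZl ?[mean _ (fun u => lin_coef _ + _)]meanD; try by solve_integrable.
have [-> ->] := mean_lin_coef_pieces y1.
by rewrite lin_coef_gt1// /residual3; ring.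
Qed.

Lemma split_op_quad_approx_le s y : `|s| <= 1 -> 1 < y ->
  normc (split_op (quad_approx s) y - quad_approx s y) <= 624 * `|s| ^+ 3.
Proof.
move=> s1 y1; have y0 : 0 <= y by lra.
have [bll blr bql bqr] := bounded_coef_pieces y0.
rewrite split_op_quad_approx//; apply: (le_trans (normc_le_Re_Im _)) => /=.
have res4 : `|residual4 y| <= 576.
  apply: norm_mean_le => [|u]; first by solve_bounded.
  have /andP[l0 _] := left_piece_itv u y0; have /andP[r0 _] := right_piece_itv u y0.
  have -> : 576 = 24 * 24 :> R by ring.
  by rewrite normrM ler_pM// quad_coef_bound.
have res3 : `|residual3 y| <= 48.
  apply: norm_mean_le => [|u]; first by solve_bounded.
  have /andP[l0 _] := left_piece_itv u y0; have /andP[r0 _] := right_piece_itv u y0.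
  have -> : 48 = 24 * 1 + 1 * 24 :> R by ring.
  rewrite (le_trans (ler_normD _ _))// !normrM.
  by rewrite lerD// ler_pM// ?quad_coef_bound ?lin_coef_bound.
have s3 : 0 <= `|s| ^+ 3 by rewrite exprn_ge0.
have s4 : `|s| ^+ 4 <= `|s| ^+ 3 by rewrite exprS ler_piMl.
rewrite normrM [X in _ + X]normrM !normrX.
have := ler_pM (exprn_ge0 4 (normr_ge0 s)) (normr_ge0 _) s4 res4.
have := ler_wpM2l s3 res3; lra.
Qed.
End quad_approx_residual.

Section picard_iteration.
Variable R : realType.
Implicit Types (s y w : R) (n : nat).

Fixpoint picard s n y : R[i] :=
  if y <= 1 then unsplit s y else if n is m.+1 then split_op (picard s m) y else quad_approx s y.

Lemma picard_le1 s n y : y <= 1 -> picard s n y = unsplit s y.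
Proof. by case: n => [|n] /= ->. Qed.

Lemma picard0_gt1 s y : 1 < y -> picard s 0 y = quad_approx s y.
Proof. by rewrite /= leNgt => ->. Qed.

Lemma picardS_gt1 s n y : 1 < y -> picard s n.+1 y = split_op (picard s n) y.
Proof. by rewrite /= leNgt => ->. Qed.

Lemma measurable_picard s n : measurable_cfun (picard s n).
Proof.
have m_le1 : measurable_fun setT (fun y : R => y <= 1) by exact: measurable_fun_ler.
elim: n => [|n IH] /=; apply: measurable_cfun_if => //; try exact: measurable_unsplit.
  exact: measurable_quad_approx.
exact: measurable_split_op.
Qed.

Lemma picard_bound s n y : 0 <= y -> normc (picard s n y) <= expR (24 * s ^+ 2 * y).
Proof.
have s2 := sqr_ge0 s; have v3 := var_rate_le3 R.
have short m z : 0 <= z -> z <= 1 -> normc (picard s m z) <= expR (24 * s ^+ 2 * z).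
  by move=> z0 z1; rewrite picard_le1// normc_unsplit ler_expR ler_wpM2r//; nra.
elim: n y => [|n IH] y y0; have [y1|y1] := leP y 1; try exact: short.
  rewrite picard0_gt1//.
  have -> : quad_approx s y = (1 + s ^+ 2 * quad_coef y)%:C.
    by rewrite /quad_approx lin_coef_gt1// mulr0.
  rewrite normc_real (le_trans (ler_normD _ _))// normr1 normrM (ger0_norm s2).
  apply: (@le_trans _ _ (1 + 24 * s ^+ 2 * y)); last exact: expR_ge1Dx.
  by have := quad_coef_bound y0; have := normr_ge0 (quad_coef y); nra.
rewrite picardS_gt1//; apply: normc_split_op_le => //; first by rewrite mulr_ge0.
  exact: measurable_picard.
by move=> w /andP[w0 _]; exact: IH.
Qed.

Lemma picard_cauchy s n y : 0 <= y ->
  normc (picard s n.+1 y - picard s n y) <= 2 * expR ((24 * s ^+ 2 + 4) * y) / 2 ^+ n.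
Proof.
have s2 := sqr_ge0 s.
elim: n y => [|n IH] y y0.
  apply: (le_trans (normc_leB _ _)).
  have b1 := picard_bound s 1 y0; have b0 := picard_bound s 0 y0.
  have : expR (24 * s ^+ 2 * y) <= expR ((24 * s ^+ 2 + 4) * y) by rewrite ler_expR; nra.
  by rewrite expr0 divr1; lra.
have [y1|y1] := leP y 1.
  by rewrite !picard_le1// subrr ComplexField.Normc.normc0 divr_ge0 ?mulr_ge0 ?expR_ge0 ?exprn_ge0.
rewrite (picardS_gt1 _ n.+1)// (picardS_gt1 _ n)//.
apply: (le_trans (@split_op_contraction R _ _ 1 (24 * s ^+ 2) 4 (2 / 2 ^+ n) y
    _ _ _ _ _ (measurable_picard s n.+1) (measurable_picard s n) _ _ _)) => //.
- by rewrite mulr_ge0.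
- exact: ltW.
- by move=> w w0; rewrite mul1r; exact: picard_bound.
- by move=> w w0; rewrite mul1r; exact: picard_bound.
- by move=> w w0; rewrite mulrAC; exact: IH.
by apply: eq_ler; rewrite (exprS 2 n); field; rewrite expf_neq0.
Qed.

Definition approx_cst : R := 2 * (12 * expR 3 + 5 + 624).

Lemma approx_cst_gt0 : 0 < approx_cst.
Proof. by rewrite /approx_cst; have := expR_gt0 (3 : R); lra. Qed.

Lemma picard_quad_approx s n y : `|s| <= 1 -> 0 <= y ->
  normc (picard s n y - quad_approx s y) <=
  approx_cst * `|s| ^+ 3 * expR ((24 * s ^+ 2 + 104) * y).
Proof.
move=> s1; have s2 := sqr_ge0 s; have A0 := approx_cst_gt0.
have s3 : 0 <= `|s| ^+ 3 by rewrite exprn_ge0.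
have weight_ge1 z : 0 <= z -> 1 <= expR ((24 * s ^+ 2 + 104) * z).
  by move=> z0; rewrite -[leLHS]expR0 ler_expR; nra.
have e3 := expR_gt0 (3 : R).
have short m z : 0 <= z -> z <= 1 -> normc (picard s m z - quad_approx s z) <=
    approx_cst * `|s| ^+ 3 * expR ((24 * s ^+ 2 + 104) * z).
  move=> z0 z1; rewrite picard_le1//; apply: (@le_trans _ _ (approx_cst * `|s| ^+ 3)).
    apply: (le_trans (unsplit_quad_approx s1 _)); first by rewrite z0.
    by rewrite ler_wpM2r// /approx_cst; lra.
  by rewrite ler_peMr ?weight_ge1// mulr_ge0// ltW.
elim: n y => [|n IH] y y0; have [y1|y1] := leP y 1; try exact: short.
  rewrite picard0_gt1// subrr ComplexField.Normc.normc0.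
  by apply: mulr_ge0; [apply: mulr_ge0 => //; exact: ltW | exact: expR_ge0].
rewrite picardS_gt1//.
have -> : split_op (picard s n) y - quad_approx s y =
  (split_op (picard s n) y - split_op (quad_approx s) y) +
  (split_op (quad_approx s) y - quad_approx s y) by ring.
have contraction : normc (split_op (picard s n) y - split_op (quad_approx s) y) <=
   2 * 26 * (approx_cst * `|s| ^+ 3) / 104 * expR ((24 * s ^+ 2 + 104) * y).
  apply: split_op_contraction => //.
  - by rewrite mulr_ge0.
  - exact: ltW.
  - by rewrite mulr_ge0// ltW.
  - exact: measurable_picard.
  - exact: measurable_quad_approx.
  - move=> w w0; apply: (le_trans (picard_bound s n w0)).
    by rewrite ler_peMl ?expR_ge0// ler1n.
  - move=> w w0; apply: (le_trans (quad_approx_bound s1 w0)); rewrite ler_peMr//.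
    by rewrite -[leLHS]expR0 ler_expR mulr_ge0// mulr_ge0.
have residual := split_op_quad_approx_le s1 y1.
have residual_cst : 624 * `|s| ^+ 3 <= approx_cst / 2 * `|s| ^+ 3 * expR ((24 * s ^+ 2 + 104) * y).
  apply: (@le_trans _ _ (approx_cst / 2 * `|s| ^+ 3)).
    by rewrite ler_wpM2r// /approx_cst; lra.
  by rewrite ler_peMr ?weight_ge1// mulr_ge0// divr_ge0// ltW.
apply: (le_trans (normc_leD _ _)); lra.
Qed.
End picard_iteration.

(** * The fixed point for small frequencies *)

Section tail_estimate.
Variable R : realType.
Implicit Types (s y w a b q A X : R) (f : R -> R[i]).
Local Notation unif01 := (unif01 R).

Definition below2 w : R := if w < 2 then 1 else 0.

Lemma norm_below2_le1 w : `|below2 w| <= 1.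
Proof. by rewrite /below2; case: ifP => _; rewrite ?normr1 ?normr0. Qed.

Lemma measurable_below2 : measurable_fun setT below2.
Proof. by apply: measurable_fun_ifT => //; exact: measurable_fun_ltr. Qed.

Lemma itv_integral_below2 y : 2 <= y -> itv_integral 0 y below2 = 2.
Proof.
move=> y2; rewrite (@itv_integral_cat _ 0 2).
- rewrite (@itv_integral_primitive _ 0 2 id _ (fun=> 1))//.
  + rewrite (@eq_itv_integral _ 2 _ _ (fun=> 0)) ?itv_integral0; first by ring.
    by move=> w /andP[w2 _]; rewrite /below2 ltNge ltW.
  + by move=> w /andP[_ w2]; rewrite /below2 w2.
  + by move=> w _; exact: has_derive_id.
- by rewrite ler0n.
- exact: measurable_below2.
- by exists 1 => w _; exact: norm_below2_le1.
Qed.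

Lemma mean_below2_pieces y : 2 <= y ->
  mean unif01 (fun u => below2 (left_piece y u)) = 2 / y /\
  mean unif01 (fun u => below2 (right_piece y u)) = 2 / y.
Proof.
move=> y2; have y0 : 0 < y by lra.
have bnd : exists M, forall w, 0 <= w <= y -> `|below2 w| <= M.
  by exists 1 => w _; exact: norm_below2_le1.
have m := measurable_below2.
by split; rewrite (mean_left_piece, mean_right_piece)// itv_integral_below2// mulrC.
Qed.

Lemma bounded_mfun_below2_pieces y : 0 <= y ->
  bounded_mfun (fun u : R => below2 (left_piece y u)) /\
  bounded_mfun (fun u : R => below2 (right_piece y u)).
Proof.
have m := measurable_below2.
move=> y0; split; first by apply: (@bounded_mfun_left_piece _ _ _ 1) => // w _; exact: norm_below2_le1.
by apply: (@bounded_mfun_right_piece _ _ _ 1) => // w _; exact: norm_below2_le1.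
Qed.

Lemma bounded_cfun_quad_approx_pieces s y : `|s| <= 1 -> 0 <= y ->
  bounded_cfun (fun u : R => quad_approx s (left_piece y u)) /\
  bounded_cfun (fun u : R => quad_approx s (right_piece y u)).
Proof.
move=> s1 y0; have bnd w : 0 <= w <= y -> normc (quad_approx s w) <= 26.
  by move=> /andP[w0 _]; exact: quad_approx_bound.
by split; [exact: bounded_cfun_left_piece (measurable_quad_approx s) bnd |
           exact: bounded_cfun_right_piece (measurable_quad_approx s) bnd].
Qed.

Lemma cmean_quad_approx_sub1 s y : 2 < y ->
  cmean unif01 (fun u => quad_approx s (left_piece y u) - 1) = 0 /\
  cmean unif01 (fun u => quad_approx s (right_piece y u) - 1) = 0.
Proof.
move=> y2; have y1 : 1 < y by lra.
have [bll blr bql bqr] := bounded_coef_pieces (ltW (lt_trans ltr01 y1)).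
have [ml mr] := mean_lin_coef_pieces y1; have [ql qr] := mean_quad_coef_pieces y1.
have y2' : (y <= 2) = false by rewrite leNgt y2.
rewrite y2' in ql qr.
have ReE w : Re (quad_approx s w - 1) = s ^+ 2 * quad_coef w by rewrite ReD/=; ring.
have ImE w : Im (quad_approx s w - 1) = s * lin_coef w by rewrite ImD/= oppr0 addr0.
split; rewrite /cmean; under eq_fun do rewrite ReE;
  under [X in Complex _ (mean _ X)]eq_fun do rewrite ImE;
  rewrite !meanZl ?(ql, ml, qr, mr) ?mulr0//; solve_integrable.
Qed.

Lemma normc_mul_sub1_le (z w : R[i]) a b : normc (z - 1) <= a -> normc (w - 1) <= b ->
  normc (z * w - 1) <= (1 + a) * (1 + b) - 1.
Proof.
move=> za wb; have -> : z * w - 1 = (z - 1) + (w - 1) + (z - 1) * (w - 1) by ring.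
have := normc_leD (z - 1 + (w - 1)) ((z - 1) * (w - 1)).
have := normc_leD (z - 1) (w - 1); rewrite ComplexField.Normc.normcM.
have := ler_pM (normc_ge0 _) (normc_ge0 _) za wb; lra.
Qed.

Lemma normc_mul_sub_approx_le (z w r : R[i]) A q X :
  normc (z - r) <= A -> normc (z - 1) <= q -> normc (w - 1) <= X ->
  normc (z * w - 1 - (r - 1)) <= A + (1 + q) * X.
Proof.
move=> zr z1 w1; have -> : z * w - 1 - (r - 1) = (z - r) + ((z - 1) + 1) * (w - 1) by ring.
rewrite (le_trans (normc_leD _ _))// ComplexField.Normc.normcM lerD//.
rewrite ler_pM ?normc_ge0// (le_trans (normc_leD _ _))// ComplexField.Normc.normc1; lra.
Qed.

Lemma tail_step_inequality y a b A q (E : R) : 8 < y -> 0 <= b <= 2^-1 -> 0 <= A <= b / 4 ->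
  0 <= q -> 16 * q * a <= b / 2 -> 1 <= E -> E - 1 <= a * y * E ->
  (1 - b) ^+ 2 * E - 1 + (A + (1 + q) * ((1 - b) * E - 1) - ((1 - b) ^+ 2 * E - 1)) * (4 / y) <=
  (1 - b) * E - 1.
Proof.
move=> y8 /andP[b0 b2] /andP[A0 Ab] q0 qab E1 Egrowth.
set j := 4 / y; have jy : j * y = 4 by rewrite /j -mulrA mulVf ?mulr1// gt_eqF//; lra.
have j0 : 0 < j by rewrite /j divr_gt0//; lra.
have j2 : j <= 2^-1 by nra.
have gain : b * E / 4 <= (1 - j) * (b * (1 - b) * E).
  have p : 4^-1 <= (1 - j) * (1 - b) by nra.
  have := mulr_ge0 b0 (le_trans ler01 E1) => bE; nra.
have short_error : j * A <= b * E / 8.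
  have : j * A <= 2^-1 * (b / 4) by rewrite ler_pM// ltW.
  have : b <= b * E by rewrite ler_peMr.
  lra.
have short_product : j * (q * ((1 - b) * E - 1)) <= b * E / 8.
  have growth : (1 - b) * E - 1 <= a * y * E by nra.
  apply: (@le_trans _ _ (j * (q * (a * y * E)))).
    by rewrite ler_wpM2l ?(ltW j0)// ler_wpM2l.
  have -> : j * (q * (a * y * E)) = (j * y) * (q * a) * E by ring.
  have : 4 * (q * a) <= b / 8 by lra.
  move=> /(ler_wpM2r (le_trans ler01 E1)); rewrite jy; lra.
have -> : (1 - b) ^+ 2 * E - 1 +
    (A + (1 + q) * ((1 - b) * E - 1) - ((1 - b) ^+ 2 * E - 1)) * j =
  ((1 - b) * E - 1) - (1 - j) * (b * (1 - b) * E) + j * A + j * (q * ((1 - b) * E - 1)) by ring.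
lra.
Qed.

Lemma split_op_sub1E f s y : 2 < y -> `|s| <= 1 ->
  bounded_cfun (fun u : R => f (left_piece y u) * f (right_piece y u)) ->
  split_op f y - 1 = cmean unif01 (fun u => f (left_piece y u) * f (right_piece y u) - 1 -
    (quad_approx s (left_piece y u) - 1) - (quad_approx s (right_piece y u) - 1)).
Proof.
move=> y2 s1 bf; have [bl br] := bounded_cfun_quad_approx_pieces s1 (ltW (lt_trans (ltr0n _ 2) y2)).
have [cl cr] := cmean_quad_approx_sub1 s y2.
rewrite cmeanB; [|solve_cbounded..].
rewrite cr subr0 cmeanB; [|solve_cbounded..].
by rewrite cl subr0 cmeanB ?cmean_cst//; solve_cbounded.
Qed.

Section tail_step.
Variables (f : R -> R[i]) (s y a b A q M : R).
Hypotheses (y8 : 8 < y) (s1 : `|s| <= 1) (a0 : 0 <= a) (b01 : 0 <= b <= 2^-1)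
  (A0 : 0 <= A) (q0 : 0 <= q).
Hypotheses (mf : measurable_cfun f) (fM : forall w, 0 <= w <= y -> normc (f w) <= M).
Hypothesis f_near : forall w, 0 <= w <= 2 -> normc (f w - quad_approx s w) <= A.
Hypothesis f_short : forall w, 0 <= w <= 2 -> normc (f w - 1) <= q.
Hypothesis f_long : forall w, 2 <= w <= y -> normc (f w - 1) <= (1 - b) * expR (a * w) - 1.

Let E := expR (a * y).
Let short_bound := A + (1 + q) * ((1 - b) * E - 1).
Let long_bound := (1 - b) ^+ 2 * E - 1.

Lemma one_short_piece_bound w w' : w + w' = y -> 0 <= w < 2 ->
  normc (f w * f w' - 1 - (quad_approx s w - 1) - (quad_approx s w' - 1)) <= short_bound.
Proof.
move=> ww /andP[w0 w2]; have w'2 : 2 <= w' <= y by move: y8; lra.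
have /andP[w'2' _] := w'2.
rewrite (quad_approx_ge2 s w'2') subrr subr0.
have w02 : 0 <= w <= 2 by rewrite w0 ltW.
apply: le_trans (normc_mul_sub_approx_le (f_near w02) (f_short w02) (f_long w'2)) _.
rewrite lerD2l ler_wpM2l//; first by move: q0; lra.
by rewrite lerB// ler_wpM2l ?ler_expR ?ler_wpM2l//; move: b01 w'2; lra.
Qed.

Lemma two_long_pieces_bound w w' : w + w' = y -> 2 <= w -> 2 <= w' ->
  normc (f w * f w' - 1 - (quad_approx s w - 1) - (quad_approx s w' - 1)) <= long_bound.
Proof.
move=> ww w2 w'2; rewrite !quad_approx_ge2// subrr !subr0.
have wl : 2 <= w <= y by move: y8; lra.
have w'l : 2 <= w' <= y by move: y8; lra.
apply: le_trans (normc_mul_sub1_le (f_long wl) (f_long w'l)) _.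
by rewrite !subrKC mulrACA -expRD -mulrDr ww -expr2.
Qed.

(* For [y > 8] at most one of the two pieces is shorter than 2, and [quad_approx - 1] vanishes
   beyond 2 and has mean 0, so a short piece costs only O(|s|^3); without this cancellation
   the rate in the exponent would be of order |s|. *)
Lemma split_op_tail_step : A <= b / 4 -> 16 * q * a <= b / 2 ->
  normc (split_op f y - 1) <= (1 - b) * E - 1.
Proof.
move=> Ab qab; have y0 : 0 <= y by move: y8; lra.
have bf := bounded_cfun_split y0 mf fM.
have [bl br] := bounded_cfun_quad_approx_pieces s1 y0.
have [b2l b2r] := bounded_mfun_below2_pieces y0.
have y2 : 2 < y by move: y8; lra.
have A0b : 0 <= A <= b / 4 by rewrite A0.
rewrite (split_op_sub1E y2 s1 bf).
have E1 : 1 <= E by rewrite -[leLHS]expR0 ler_expR mulr_ge0.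
apply: le_trans (tail_step_inequality y8 b01 A0b q0 qab E1 (expR_sub1_le _)).
rewrite -/E -/long_bound -/short_bound.
apply: (@le_trans _ _ (mean unif01 (fun u => long_bound + (short_bound - long_bound) *
   (below2 (left_piece y u) + below2 (right_piece y u))))).
  apply: normc_cmean_le => [||u]; [by solve_cbounded | by solve_integrable |].
  have /andP[w0 _] := left_piece_itv u y0; have /andP[w'0 _] := right_piece_itv u y0.
  have := left_pieceDright_piece y u.
  move: (left_piece y u) (right_piece y u) w0 w'0 => w w' w0 w'0 ww.
  rewrite /below2; have [w2|w2] := ltP w 2; have [w'2|w'2] := ltP w' 2.
  - by exfalso; move: y8; lra.
  - by rewrite addr0 mulr1 subrKC; apply: one_short_piece_bound => //; rewrite w0.
  - rewrite add0r mulr1 subrKC mulrC addrAC.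
    by apply: one_short_piece_bound; [rewrite addrC | rewrite w'0].
  - by rewrite addr0 mulr0 addr0; exact: two_long_pieces_bound.
rewrite meanD ?mean_cst ?meanZl ?meanD; try by solve_integrable.
have [-> ->] := mean_below2_pieces (ltW y2).
by have -> : 2 / y + 2 / y = 4 / y by ring.
Qed.
End tail_step.

Section picard_tail.
Variables A s : R.
Hypotheses (A_ge : approx_cst R * expR (128 * 8) <= A) (s_le : `|s| <= (640 * (25 + A))^-1).

Lemma tail_cst_gt0 : 0 < A.
Proof. by apply: lt_le_trans A_ge; rewrite mulr_gt0 ?approx_cst_gt0 ?expR_gt0. Qed.

Lemma small_frequency : `|s| * (25 + A) <= 640^-1.
Proof.
have A0 := tail_cst_gt0; have C0 : 0 < 640 * (25 + A) by lra.
by move: s_le; rewrite -[X in _ <= X]div1r ler_pdivlMr//; lra.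
Qed.

Lemma small_frequency_le1 : `|s| <= 1.
Proof. have := small_frequency; have := tail_cst_gt0; have := normr_ge0 s; nra. Qed.

Lemma picard_near n w : 0 <= w <= 8 -> normc (picard s n w - quad_approx s w) <= A * `|s| ^+ 3.
Proof.
move=> /andP[w0 w8]; have s1 := small_frequency_le1.
apply: (le_trans (picard_quad_approx n s1 w0)); rewrite mulrAC ler_wpM2r ?exprn_ge0//.
apply: le_trans A_ge; rewrite ler_wpM2l//; first exact: ltW (approx_cst_gt0 R).
rewrite ler_expR.
have s2 : s ^+ 2 <= 1 by rewrite (le_trans (sqr_le_norm_le1 s1)).
by have := sqr_ge0 s; nra.
Qed.

Lemma picard_short n w : 0 <= w <= 2 -> normc (picard s n w - 1) <= (25 + A) * `|s|.
Proof.
move=> /andP[w0 w2]; have s1 := small_frequency_le1.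
have near : normc (picard s n w - quad_approx s w) <= A * `|s| ^+ 3.
  by apply: picard_near; lra.
have : A * `|s| ^+ 3 <= A * `|s|.
  by rewrite ler_wpM2l ?(ltW tail_cst_gt0)// exprS ler_piMr// exprn_ile1.
have -> : picard s n w - 1 = (picard s n w - quad_approx s w) + (quad_approx s w - 1) by ring.
have := quad_approx_sub1_bound s1 w0.
have := normc_leD (picard s n w - quad_approx s w) (quad_approx s w - 1); lra.
Qed.

Let a := 5 * A * `|s| ^+ 3.
Let b := 4 * A * `|s| ^+ 3.

Lemma tail_profile_ge y : b <= 2^-1 -> 2 <= y -> A * `|s| ^+ 3 <= (1 - b) * expR (a * y) - 1.
Proof.
move=> b2 y2; have As0 : 0 <= A * `|s| ^+ 3 by rewrite mulr_ge0 ?exprn_ge0// ltW// tail_cst_gt0.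
have a0 : 0 <= a by rewrite /a; lra.
have : (1 - b) * (1 + 2 * a) <= (1 - b) * expR (a * y).
  rewrite ler_wpM2l//; first by lra.
  by apply: le_trans (expR_ge1Dx _); rewrite lerD2l mulrC ler_wpM2l.
have : 2 * b * a <= a by rewrite ler_piMl//; lra.
rewrite /a /b; lra.
Qed.

Lemma picard_tail n y : 2 <= y -> normc (picard s n y - 1) <= (1 - b) * expR (a * y) - 1.
Proof.
have A0 := tail_cst_gt0; have s1 := small_frequency_le1; have sA := small_frequency.
have s0 := normr_ge0 s.
have s3 : 0 <= `|s| ^+ 3 <= `|s| by rewrite exprn_ge0//= exprS ler_piMr// exprn_ile1.
have As3 : 0 <= A * `|s| ^+ 3 <= 640^-1 by apply/andP; split; nra.
have b0 : 0 <= b by rewrite /b; lra.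
have b2 : b <= 2^-1 by rewrite /b; lra.
have moderate m z : 2 <= z <= 8 -> normc (picard s m z - 1) <= (1 - b) * expR (a * z) - 1.
  move=> /andP[z2 z8]; rewrite -(quad_approx_ge2 s z2); apply: le_trans (tail_profile_ge b2 z2).
  by apply: picard_near; lra.
elim: n y => [|n IH] y y2; have [y8|y8] := leP y 8; try by apply: moderate; rewrite y2.
  rewrite picard0_gt1 ?quad_approx_ge2// ?(lt_le_trans _ y2) ?ltr1n//.
  rewrite subrr ComplexField.Normc.normc0; apply: le_trans (tail_profile_ge b2 y2); lra.
rewrite picardS_gt1; last by lra.
apply: (@split_op_tail_step _ s y a b (A * `|s| ^+ 3) ((25 + A) * `|s|) (expR (24 * s ^+ 2 * y))) => //.
- by rewrite /a; lra.
- by rewrite b0.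
- by lra.
- by nra.
- exact: measurable_picard.
- move=> w /andP[w0 wy]; apply: (le_trans (picard_bound s n w0)).
  by rewrite ler_expR ler_wpM2l// mulr_ge0// sqr_ge0.
- by move=> w w02; apply: picard_near; lra.
- exact: picard_short.
- by move=> w /andP[w2 _]; exact: IH.
- by rewrite /b; lra.
rewrite /a /b.
have -> : 16 * ((25 + A) * `|s|) * (5 * A * `|s| ^+ 3) =
  (80 * (`|s| * (25 + A))) * (A * `|s| ^+ 3) by ring.
nra.
Qed.
End picard_tail.
End tail_estimate.

Section fixpoint.
Variable R : realType.
Implicit Types s y : R.

Definition fixpt s y : R[i] := clim (picard s ^~ y).

Lemma picard_seq_le1 s y : y <= 1 -> picard s ^~ y = fun=> unsplit s y.
Proof. by move=> y1; apply/funext => n; exact: picard_le1. Qed.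

Lemma fixpt_le1 s y : y <= 1 -> fixpt s y = unsplit s y.
Proof.
by move=> y1; rewrite /fixpt picard_seq_le1// /clim !lim_cst//; case: (unsplit s y).
Qed.

Lemma picard_cvg s y : ccvg (picard s ^~ y) (fixpt s y).
Proof.
have [y1|y1] := leP y 1; last first.
  have y0 : 0 <= y by rewrite (le_trans ler01)// ltW.
  exact: geometric_cauchy_ccvg (fun n => picard_cauchy s n y0).
rewrite (fixpt_le1 s y1) (picard_seq_le1 s y1); split; exact: cvg_cst.
Qed.

Lemma measurable_fixpt s : measurable_cfun (fixpt s).
Proof. exact: measurable_cfun_cvg (measurable_picard s) (picard_cvg s). Qed.

Lemma fixpt_bound s y : 0 <= y -> normc (fixpt s y) <= expR (24 * s ^+ 2 * y).
Proof. by move=> y0; apply: normc_lim_le (picard_cvg s y) _ => n; exact: picard_bound. Qed.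

Lemma fixptE s y : 1 < y -> fixpt s y = split_op (fixpt s) y.
Proof.
move=> y1; have y0 : 0 <= y by lra.
apply: ccvg_unique (picard_cvg s y) _; apply: ccvg_shiftS.
have -> : (fun n => picard s n.+1 y) = fun n => split_op (picard s n) y.
  by apply/funext => n; exact: picardS_gt1.
apply: (@cmean_cvg_bounded _ _ _ (unif01 R)
  (fun n u => picard s n (left_piece y u) * picard s n (right_piece y u))
  (fun u => fixpt s (left_piece y u) * fixpt s (right_piece y u)) (expR (24 * s ^+ 2 * y))) =>
  [n|n u|u].
- apply: measurable_cfunM; apply: (measurable_cfun_comp (measurable_picard s n)).
    exact: measurable_left_piece.
  exact: measurable_right_piece.
- by apply: normc_mul_pieces_le => // w /andP[w0 _]; exact: picard_bound.
- by apply: ccvgM; exact: picard_cvg.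
Qed.

Lemma fixpt_tail : exists s0 K : R, [/\ 0 < s0, 0 < K & forall s, `|s| <= s0 ->
  forall y, 2 <= y -> normc (fixpt s y - 1) <= expR (K * `|s| ^+ 3 * y) - 1].
Proof.
have [A A_ge] : exists A, approx_cst R * expR (128 * 8) <= A by exists (approx_cst R * expR (128 * 8)).
have A0 := tail_cst_gt0 A_ge.
exists (640 * (25 + A))^-1, (5 * A); split; [by rewrite invr_gt0; lra | by lra |].
move=> s s_le y y2; apply: normc_lim_le (ccvgBr 1 (picard_cvg s y)) _ => n.
apply: (le_trans (picard_tail A_ge s_le n y2)).
rewrite lerB// ler_piMl ?expR_ge0// lerBlDr lerDl mulr_ge0 ?exprn_ge0//.
by rewrite mulr_ge0// ltW.
Qed.
End fixpoint.

(** * Interval lengths *)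

Section lengths.
Variable R : realType.
Implicit Types (l : seq R) (v x M : R) (u : nat -> R) (n j : nat).

Definition lmax l : R := foldr Num.max 0 l.

Definition lmax_index l : nat := find (pred1 (lmax l)) l.

Definition lsplit v l : seq R :=
  take (lmax_index l) l ++ [:: v * lmax l; (1 - v) * lmax l] ++ drop (lmax_index l).+1 l.

Fixpoint lens u n : seq R :=
  if n is m.+1 then lsplit (u m) (lens u m) else [:: 1].

Lemma lmax_ge0 l : 0 <= lmax l.
Proof. by elim: l => [|x l IH] //=; rewrite le_max IH orbT. Qed.

Lemma le_lmax l x : x \in l -> x <= lmax l.
Proof.
elim: l => // y l IH; rewrite in_cons => /predU1P[->|/IH h] /=; rewrite le_max ?lexx//.
by rewrite h orbT.
Qed.

Lemma lmax_le l M : 0 <= M -> (forall x, x \in l -> x <= M) -> lmax l <= M.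
Proof.
move=> M0; elim: l => //= x l IH h; rewrite ge_max h ?mem_head//= IH// => y yl.
by apply: h; rewrite in_cons yl orbT.
Qed.

Lemma lmax_eq0_or_mem l : lmax l = 0 \/ lmax l \in l.
Proof.
elim: l => [|x l IH]; first by left.
rewrite /= in_cons; case: leP => _; last by right; rewrite eqxx.
by case: IH => [|->]; [left | right; rewrite orbT].
Qed.

Lemma lmax_mem l : (forall x, x \in l -> 0 <= x) -> l != [::] -> lmax l \in l.
Proof.
case: l => // x l l0 _; have [lmax0|//] := lmax_eq0_or_mem (x :: l).
have x0 : x = 0.
  by apply/eqP; rewrite eq_le l0 ?mem_head// andbT -lmax0 le_lmax// mem_head.
by rewrite lmax0 -x0 mem_head.
Qed.

(* When [lmax l] is not in [l] it is 0, the default value of [nth]. *)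
Lemma nth_lmax_index l : nth 0 l (lmax_index l) = lmax l.
Proof.
have [lmax_in|lmax_notin] := boolP (lmax l \in l).
  by have := @nth_find _ 0 (pred1 (lmax l)) l; rewrite has_pred1 lmax_in => /(_ isT)/eqP.
have [lmax0|] := lmax_eq0_or_mem l; last by rewrite (negbTE lmax_notin).
by rewrite nth_default// /lmax_index hasNfind// has_pred1.
Qed.

Lemma lmax_index_size l : (lmax_index l <= size l)%N.
Proof. exact: find_size. Qed.

Lemma lmax_index_ltn l j :
  (lmax_index l < j)%N = has (fun k => nth 0 l k == lmax l) (iota 0 j).
Proof.
apply/idP/hasP => [ij|[k]].
  by exists (lmax_index l); [rewrite mem_iota | rewrite nth_lmax_index].
rewrite mem_iota/= add0n => kj kmax; rewrite ltnNge; apply/negP => ji.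
by have := before_find 0 (leq_trans kj ji); rewrite /= kmax.
Qed.

Lemma map_ksplit v (s : seq (R * R)) : map (@ilen R) (ksplit v s) = lsplit v (map (@ilen R) s).
Proof.
rewrite /ksplit /lsplit.
have -> : find (fun p => ilen p == maxlen s) s = lmax_index (map (@ilen R) s).
  by rewrite /lmax_index find_map.
set i := lmax_index _.
have ilen_nth : lmax (map (@ilen R) s) = ilen (nth (0, 0) s i).
  rewrite -nth_lmax_index -/i; have [h|h] := ltnP i (size s); first by rewrite (nth_map (0, 0)).
  by rewrite !nth_default ?size_map// /ilen/= subrr.
rewrite !map_cat map_take map_drop ilen_nth/= /ilen/=.
by congr (_ ++ [:: _, _ & _]); ring.
Qed.

Lemma map_kakutani u n : map (@ilen R) (kakutani u n) = lens u n.
Proof.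
elim: n => [|n IH] /=; first by rewrite /ilen/= subr0.
by rewrite map_ksplit IH.
Qed.

Lemma MnE u n : Mn u n = lmax (lens u n).
Proof. by rewrite /Mn /maxlen map_kakutani. Qed.

Lemma perm_lsplit v l : lmax l \in l ->
  perm_eq (lsplit v l) (v * lmax l :: (1 - v) * lmax l :: rem (lmax l) l).
Proof.
move=> lmax_in; rewrite /lsplit; set i := lmax_index l.
have il : (i < size l)%N by rewrite -has_find has_pred1.
have perm_l : perm_eq l (lmax l :: (take i l ++ drop i.+1 l)).
  rewrite -[X in perm_eq X _](cat_take_drop i l) (drop_nth 0)// nth_lmax_index.
  by rewrite -cat1s perm_catCA.
have perm_rem : perm_eq (rem (lmax l) l) (take i l ++ drop i.+1 l).
  by rewrite -(perm_cons (lmax l)) -(permPl (perm_to_rem lmax_in)).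
rewrite -[X in perm_eq _ X]/([:: v * lmax l; (1 - v) * lmax l] ++ rem (lmax l) l).
by rewrite perm_catCA perm_cat2l perm_sym.
Qed.

Lemma nth_lsplit v l j :
  nth 0 (lsplit v l) j =
  if (j < lmax_index l)%N then nth 0 l j
  else if (j < (lmax_index l).+1)%N then v * lmax l
  else if (j < (lmax_index l).+2)%N then (1 - v) * lmax l else nth 0 l j.-1.
Proof.
rewrite /lsplit nth_cat size_take_min (minn_idPl (lmax_index_size l)).
move: (lmax_index l) => i.
case: ltnP => [ji|ij]; first by rewrite nth_take.
have [k ->] : exists k, j = (i + k)%N by exists (j - i)%N; rewrite subnKC.
rewrite addKn; case: k => [|[|k]] /=.
- by rewrite addn0 ltnSn.
- by rewrite addn1 ltnNge leqnn/= ltnSn.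
- rewrite nth_drop !addnS !ltnS !ltnNge -addSn !leq_addr/=.
  by rewrite (leq_trans (leqnSn i) (leq_addr _ _)).
Qed.

Lemma size_lsplit v l : lmax l \in l -> size (lsplit v l) = (size l).+1.
Proof.
move=> ml; rewrite (perm_size (perm_lsplit v ml))/= size_rem//.
by case: l ml.
Qed.

Lemma size_lsplit_le v l : (size (lsplit v l) <= (size l).+2)%N.
Proof.
by rewrite /lsplit !size_cat/= size_take_min size_drop; have := lmax_index_size l; lia.
Qed.

Lemma size_lens_le u n : (size (lens u n) <= n.*2.+1)%N.
Proof.
by elim: n => //= n IH; rewrite doubleS (leq_trans (size_lsplit_le _ _)).
Qed.

Lemma lens_ext u u' n : (forall k, (k < n)%N -> u k = u' k) -> lens u n = lens u' n.
Proof.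
elim: n => //= n IH uu'; rewrite IH ?uu'// => k kn; apply: uu'.
by rewrite ltnS ltnW.
Qed.

Section admissible.
Variable u : nat -> R.
Hypothesis u01 : forall k, 0 <= u k <= 1.

Lemma lens_ge0_mem n : (forall x, x \in lens u n -> 0 <= x) /\ lmax (lens u n) \in lens u n.
Proof.
elim: n => [|n [l0 ml]].
  by split; [move=> x; rewrite inE => /eqP -> | rewrite /= max_l// mem_head].
have /andP[v0 v1] := u01 n.
have nonneg x : x \in lens u n.+1 -> 0 <= x.
  rewrite (perm_mem (perm_lsplit _ ml)) !in_cons => /or3P[/eqP->|/eqP->|/mem_rem/l0//].
    by rewrite mulr_ge0// l0.
  by rewrite mulr_ge0 ?subr_ge0// l0.
split=> //; apply: lmax_mem => //.
by rewrite -size_eq0 size_lsplit.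
Qed.

Lemma lens_ge0 n x : x \in lens u n -> 0 <= x.
Proof. by have [+ _] := lens_ge0_mem n; apply. Qed.

Lemma lmax_lens_mem n : lmax (lens u n) \in lens u n.
Proof. by have [] := lens_ge0_mem n. Qed.

Lemma perm_lens n : perm_eq (lens u n) (lmax (lens u n) :: rem (lmax (lens u n)) (lens u n)).
Proof. exact/perm_to_rem/lmax_lens_mem. Qed.

Lemma perm_lsplit_lens v n : perm_eq (lsplit v (lens u n))
  (v * lmax (lens u n) :: (1 - v) * lmax (lens u n) :: rem (lmax (lens u n)) (lens u n)).
Proof. exact/perm_lsplit/lmax_lens_mem. Qed.

Lemma size_lens n : size (lens u n) = n.+1.
Proof. by elim: n => //= n IH; rewrite size_lsplit ?IH// lmax_lens_mem. Qed.

Lemma sum_lens n : \sum_(x <- lens u n) x = 1.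
Proof.
elim: n => [|n IH]; first by rewrite /= big_seq1.
rewrite /= (perm_big _ (perm_lsplit_lens (u n) n))/= !big_cons.
have sum_n := IH; rewrite (perm_big _ (perm_lens n))/= big_cons in sum_n.
by rewrite -[RHS]sum_n; ring.
Qed.

Lemma lens_le1 n x : x \in lens u n -> x <= 1.
Proof.
move=> xl; rewrite -(sum_lens n) (perm_big _ (perm_to_rem xl))/= big_cons lerDl.
by rewrite big_seq sumr_ge0// => z /mem_rem /lens_ge0.
Qed.

Lemma lmax_lens_nonincreasing : nonincreasing_seq (fun n => lmax (lens u n)).
Proof.
apply/nonincreasing_seqP => n; apply: lmax_le; first exact: lmax_ge0.
have m0 := lmax_ge0 (lens u n); have /andP[v0 v1] := u01 n.
move=> x; rewrite (perm_mem (perm_lsplit_lens (u n) n)) !in_cons.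
move=> /or3P[/eqP->|/eqP->|/mem_rem/le_lmax//]; first by rewrite ler_piMl.
by rewrite ler_piMl// lerBlDr lerDl.
Qed.
End admissible.
End lengths.

Section measurable_lengths.
Context d (T : measurableType d) (R : realType).

Lemma measurable_lmax_map (s : seq nat) (G : nat -> T -> R) :
  (forall i, measurable_fun setT (G i)) ->
  measurable_fun setT (fun w => lmax [seq G i w | i <- s]).
Proof.
move=> mG; elim: s => [|a s IH] /=; first exact: measurable_cst.
exact: measurable_maxr.
Qed.

Lemma measurable_has (s : seq nat) (G : nat -> T -> bool) :
  (forall i, measurable_fun setT (G i)) ->
  measurable_fun setT (fun w => has (fun i => G i w) s).
Proof.
move=> mG; elim: s => [|a s IH] /=; first exact: measurable_cst.
exact: measurable_or.
Qed.

Lemma lmax_nth (l : seq R) N : (size l <= N)%N -> lmax l = lmax [seq nth 0 l i | i <- iota 0 N].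
Proof.
move=> lN; apply/eqP; rewrite eq_le; apply/andP; split; apply: lmax_le; try exact: lmax_ge0.
  move=> x /(nthP 0)[i il <-]; apply: le_lmax; apply/mapP; exists i => //.
  by rewrite mem_iota add0n (leq_trans il).
move=> x /mapP[i _ ->]; have [il|li] := ltnP i (size l).
  by apply: le_lmax; exact: mem_nth.
by rewrite nth_default// lmax_ge0.
Qed.

Lemma measurable_lmax (l : T -> seq R) N : (forall w, (size (l w) <= N)%N) ->
  (forall j, measurable_fun setT (fun w => nth 0 (l w) j)) ->
  measurable_fun setT (fun w => lmax (l w)).
Proof.
move=> lN ml; under eq_fun => w.
  rewrite (lmax_nth (lN w)); over.
exact: (@measurable_lmax_map _ (fun i w => nth 0 (l w) i)).
Qed.

Lemma measurable_nth_lsplit (v : T -> R) (l : T -> seq R) N j : measurable_fun setT v ->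
  (forall w, (size (l w) <= N)%N) -> (forall j, measurable_fun setT (fun w => nth 0 (l w) j)) ->
  measurable_fun setT (fun w => nth 0 (lsplit (v w) (l w)) j).
Proof.
move=> mv lN ml; have mmax := measurable_lmax lN ml.
have mindex i : measurable_fun setT (fun w => (i < (lmax_index (l w)).+1)%N).
  under eq_fun do rewrite ltnS leqNgt lmax_index_ltn.
  apply: measurable_neg; apply: (measurable_has _ (G := fun k w => nth 0 (l w) k == lmax (l w))).
  by move=> k; exact: measurable_fun_eqr.
under eq_fun do rewrite nth_lsplit.
apply: measurable_fun_ifT => //; first exact: (mindex j.+1).
apply: measurable_fun_ifT => //; first exact: measurable_funM.
apply: measurable_fun_ifT => //; last by apply: measurable_funM => //; exact: measurable_funB.
by case: j => [|j]; [exact: measurable_cst | exact: mindex].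
Qed.

Section lens_of_functions.
Variable U : nat -> T -> R.
Hypothesis mU : forall k, measurable_fun setT (U k).

Lemma measurable_nth_lens n j : measurable_fun setT (fun w => nth 0 (lens (U ^~ w) n) j).
Proof.
elim: n j => [|n IH] j /=; first exact: measurable_cst.
exact: (@measurable_nth_lsplit (U n) (fun w => lens (U ^~ w) n) n.*2.+1 j (mU n)
  (fun w => size_lens_le (U ^~ w) n) IH).
Qed.

Lemma measurable_lmax_lens n : measurable_fun setT (fun w => lmax (lens (U ^~ w) n)).
Proof.
exact: (measurable_lmax (fun w => size_lens_le (U ^~ w) n) (measurable_nth_lens n)).
Qed.

Lemma measurable_lmax_lens_le n (t : R) : measurable [set w | lmax (lens (U ^~ w) n) <= t].
Proof.
rewrite -[X in measurable X]setTI.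
by apply: (measurable_fun_ler (measurable_lmax_lens n)) => //; exact: measurable_cst.
Qed.

Hypothesis U01 : forall k w, 0 <= U k w <= 1.

Lemma big_lens (V : Type) (idx : V) (op : V -> V -> V) (F : R -> V) n w :
  \big[op/idx]_(x <- lens (U ^~ w) n) F x =
  \big[op/idx]_(i <- iota 0 n.+1) F (nth 0 (lens (U ^~ w) n) i).
Proof. by rewrite (big_nth 0) size_lens. Qed.

Lemma measurable_cfun_prod_lens n (F : R -> R[i]) : measurable_cfun F ->
  measurable_cfun (fun w => \prod_(x <- lens (U ^~ w) n) F x).
Proof.
move=> mF; rewrite (funext (big_lens 1 *%R F n)).
apply: (@measurable_cfun_prod _ _ _ _ (fun i w => F (nth 0 (lens (U ^~ w) n) i))) => i.
exact: (measurable_cfun_comp mF (measurable_nth_lens n i)).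
Qed.

Lemma measurable_sum_lens n (F : R -> R) : measurable_fun setT F ->
  measurable_fun setT (fun w => \sum_(x <- lens (U ^~ w) n) F x).
Proof.
move=> mF; rewrite (funext (big_lens 0 +%R F n)).
by apply: measurable_sum => i; exact: (measurableT_comp mF (measurable_nth_lens n i)).
Qed.
End lens_of_functions.
End measurable_lengths.

(** * Conditioning on the last splitting variable *)

Lemma eq_probability_boxes (R : realType) n (m1 m2 : probability (n.-tuple R) R) :
  (forall B : nat -> set R, (forall i, measurable (B i)) ->
     m1 [set x | forall i : 'I_n, B i (tnth x i)] = m2 [set x | forall i : 'I_n, B i (tnth x i)]) ->
  forall A, measurable A -> m1 A = m2 A.
Proof.
move=> m12; pose box (B : nat -> set R) := [set x : n.-tuple R | forall i : 'I_n, B i (tnth x i)].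
pose boxes := [set A | exists2 B : nat -> set R, (forall i, measurable (B i)) & A = box B].
have mbox B : (forall i, measurable (B i)) -> measurable (box B).
  move=> mB.
  rewrite (_ : box B = \bigcap_(i in [set: 'I_n]) ((fun x : n.-tuple R => tnth x i) @^-1` B i)).
    apply: fin_bigcap_measurable => // i _; rewrite -[X in measurable X]setTI.
    exact: measurable_tnth.
  by apply/seteqP; split => x /= hx i; [move=> _; exact: hx|exact: hx].
apply: (@measure_unique _ _ _ boxes (fun=> setT)).
- apply/seteqP; split => [A|].
    move: A; apply: smallest_sub; first exact: smallest_sigma_algebra.
    apply: (big_ind (fun X => X `<=` <<s boxes >>)) => //.
      by move=> X Y hX hY A [/hX|/hY].
    move=> i _ A [B mB <-]; apply: sub_sigma_algebra.
    exists (fun k => if k == nat_of_ord i then B : set R else setT) => [k|]; first by case: ifP.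
    rewrite setTI; apply/seteqP; split => x /= hx.
      by move=> j; case: ifP => // /eqP/val_inj ->.
    by have := hx i; rewrite eqxx.
  apply: smallest_sub; first exact: sigma_algebra_measurable.
  by move=> A [B mB ->]; exact: mbox.
- move=> A B [A' mA' ->] [B' mB' ->]; exists (fun i => A' i `&` B' i) => [i|].
    exact: measurableI.
  apply/seteqP; split => x /=; first by move=> [h1 h2] i; split.
  by move=> h1; split => i; have [] := h1 i.
- by move=> _; exists (fun=> setT) => //; apply/seteqP; split.
- by rewrite bigcup_const//; exists 0%N.
- by move=> A [B mB ->]; exact: m12.
- by move=> _; rewrite -ge0_fin_numE ?fin_num_measure.
Qed.

Section path_functionals.
Variable R : realType.
Implicit Types (u : nat -> R) (v : R) (n k : nat).

Definition path_upd u n v : nat -> R := fun k => if (k < n)%N then u k else v.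

Definition depends_on_first (V : Type) n (F : (nat -> R) -> V) : Prop :=
  forall u u', (forall k, (k < n)%N -> u k = u' k) -> F u = F u'.

Definition bounded_functional (F : (nat -> R) -> R) : Prop :=
  forall d (T : measurableType d) (U : nat -> T -> R),
    (forall k, measurable_fun setT (U k)) -> (forall k w, 0 <= U k w <= 1) ->
    bounded_mfun (fun w => F (U ^~ w)).

Definition tuple_path n (x : n.-tuple R) : nat -> R := fun k => clamp (nth 0 x k).

Lemma measurable_tuple_path n k : measurable_fun setT (fun x : n.-tuple R => tuple_path x k).
Proof.
apply: measurable_fclamp; have [kn|nk] := ltnP k n.
  rewrite (_ : (fun x => _) = fun x : n.-tuple R => tnth x (Ordinal kn)).
    exact: measurable_tnth.
  by apply/funext => x; rewrite (tnth_nth 0).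
rewrite (_ : (fun x => _) = fun=> 0); first exact: measurable_cst.
by apply/funext => x; rewrite nth_default// size_tuple.
Qed.

Lemma bounded_functional_tuple n F : bounded_functional F ->
  bounded_mfun (fun x : n.-tuple R => F (tuple_path x)).
Proof.
move=> bF; have := bF _ _ (fun k (x : n.-tuple R) => tuple_path x k).
apply; first exact: measurable_tuple_path.
by move=> k x; exact: clamp01.
Qed.
End path_functionals.

Section iid_uniform.
Context d (T : measurableType d) (R : realType) (P : probability T R)
  (U : nat -> {RV P >-> R}).
Hypothesis indU : mutually_independent U.
Hypothesis lawU : forall k (A : set R), measurable A ->
     distribution P (U k) A = uniform_prob (@ltr01 R) A.
Local Notation unif01 := (unif01 R).

Definition first_coords n (w : T) : n.-tuple R := [tuple U i w | i < n].

Definition append_coord n (z : T * measurableTypeR R) : n.+1.-tuple R :=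
  [tuple if (i < n)%N then U i z.1 else z.2 | i < n.+1].

Lemma measurable_first_coords n : measurable_fun setT (first_coords n).
Proof.
apply/measurable_fun_tnthP => i.
rewrite (_ : _ \o _ = U i); last by apply/funext => w /=; rewrite tnth_mktuple.
exact: measurable_funP.
Qed.

Lemma measurable_append_coord n : measurable_fun setT (append_coord n).
Proof.
apply/measurable_fun_tnthP => i.
rewrite (_ : _ \o _ = fun z : T * measurableTypeR R => if (i < n)%N then U i z.1 else z.2).
  case: (i < n)%N; last exact: measurable_snd.
  apply: (@measurableT_comp _ _ _ _ _ _ (U i)); last exact: measurable_fst.
  exact: measurable_funP.
by apply/funext => w /=; rewrite tnth_mktuple.
Qed.

HB.instance Definition _ n :=
  isMeasurableFun.Build _ _ _ _ (first_coords n) (@measurable_first_coords n).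
HB.instance Definition _ n :=
  isMeasurableFun.Build _ _ _ _ (append_coord n) (@measurable_append_coord n).

Lemma mem_iota0 m i : [set` iota 0 m] i <-> (i < m)%N.
Proof. by rewrite /mkset/= mem_iota add0n. Qed.

Lemma probability_box n (B : nat -> set R) : (forall i, measurable (B i)) ->
  P (\bigcap_(i in [set` iota 0 n]) (U i @^-1` B i)) = (\prod_(i <- iota 0 n) unif01 (B i))%E.
Proof.
move=> mB; rewrite indU ?iota_uniq//; apply: eq_bigr => i _.
by rewrite -[RHS](lawU i (mB i)).
Qed.

(* Independence enters only through this equality of laws. *)
Lemma distribution_append_coord n A : measurable A ->
  distribution P (first_coords n.+1) A = distribution (P \x unif01)%E (append_coord n) A.
Proof.
apply: eq_probability_boxes => B mB; set I := \bigcap_(i in [set` iota 0 n]) (U i @^-1` B i).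
have first_box : first_coords n.+1 @^-1` [set x | forall i : 'I_n.+1, B i (tnth x i)] =
    \bigcap_(i in [set` iota 0 n.+1]) (U i @^-1` B i).
  apply/seteqP; split => w h i.
    by move=> /mem_iota0 ni; have := h (Ordinal ni); rewrite tnth_mktuple.
  by rewrite tnth_mktuple; apply: h; apply/mem_iota0.
have append_box : append_coord n @^-1` [set x | forall i : 'I_n.+1, B i (tnth x i)] = I `*` B n.
  apply/seteqP; split => [[w v] h|[w v] [h1 h2] i].
    split; last by have := h ord_max; rewrite tnth_mktuple/= ltnn.
    by move=> i /mem_iota0 ni; have := h (Ordinal (ltnW ni : (i < n.+1)%N)); rewrite tnth_mktuple/= ni.
  rewrite tnth_mktuple/=; case: ifPn => ni; first by apply: h1; apply/mem_iota0.
  suff -> : nat_of_ord i = n by [].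
  by apply/eqP; rewrite eqn_leq -ltnS ltn_ord/= leqNgt.
have mI : measurable I.
  apply: fin_bigcap_measurable => // i _; rewrite -[X in measurable X]setTI.
  exact: measurable_funP.
transitivity (P (\bigcap_(i in [set` iota 0 n.+1]) (U i @^-1` B i))); first by rewrite -first_box.
transitivity ((P \x unif01)%E (I `*` B n)); last by rewrite -append_box.
rewrite (@probability_box n.+1 B mB).
transitivity ((\prod_(i <- iota 0 n) unif01 (B i)) * unif01 (B n))%E; last first.
  rewrite -(@probability_box n B mB); exact/esym/(product_measure1E P unif01 mI (mB n)).
by rewrite -[in LHS]addn1 iotaD big_cat/= big_seq1 add0n.
Qed.

Lemma mean_distribution d' (S : measurableType d') d1 (T1 : measurableType d1)
    (Q : probability T1 R) (X : {mfun T1 >-> S}) (H : S -> R) : bounded_mfun H ->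
  mean Q (H \o X) = mean (distribution Q X) H.
Proof.
move=> bH; have [mH _] := bH; rewrite /mean /Rintegral; congr fine.
apply/esym/(@integral_distribution _ _ _ _ _ Q X (EFin \o H)); first exact/measurable_EFinP.
apply: bounded_mfun_integrable; apply: bounded_mfun_comp bH; exact: measurable_funP.
Qed.

Lemma mean_first_coords n (H : n.+1.-tuple R -> R) : bounded_mfun H ->
  mean P (fun w => H (first_coords n.+1 w)) =
  mean P (fun w => mean unif01 (fun v => H (append_coord n (w, v)))).
Proof.
move=> bH; rewrite -(@mean_prod _ _ _ _ _ P unif01 (H \o append_coord n)); last first.
  exact: bounded_mfun_comp (@measurable_append_coord n) bH.
rewrite -[LHS]/(mean P (H \o first_coords n.+1)) !mean_distribution//.
rewrite /mean /Rintegral; congr fine; apply: eq_measure_integral => A mA _.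
exact: distribution_append_coord.
Qed.

Definition clampU (k : nat) (w : T) : R := clamp (U k w).

Lemma measurable_clampU k : measurable_fun setT (clampU k).
Proof. by apply: measurable_fclamp; exact: measurable_funP. Qed.

Lemma clampU01 k w : 0 <= clampU k w <= 1.
Proof. exact: clamp01. Qed.

Lemma mean_path_upd n (F : (nat -> R) -> R) :
  depends_on_first n.+1 F -> bounded_functional F ->
  mean P (fun w => F (clampU ^~ w)) =
  mean P (fun w => mean unif01 (fun v => F (path_upd (clampU ^~ w) n (clamp v)))).
Proof.
move=> depF bF; pose H (x : n.+1.-tuple R) := F (tuple_path x).
have firstE w : F (clampU ^~ w) = H (first_coords n.+1 w).
  apply: depF => k kn; rewrite /tuple_path.
  by rewrite -[k in RHS]/(nat_of_ord (Ordinal kn)) -tnth_nth tnth_mktuple.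
have appendE w v : F (path_upd (clampU ^~ w) n (clamp v)) = H (append_coord n (w, v)).
  apply: depF => k kn; rewrite /tuple_path.
  rewrite -[X in nth _ _ X]/(nat_of_ord (Ordinal kn)) -tnth_nth tnth_mktuple/= /path_upd.
  by case: ifP.
under eq_fun do rewrite firstE.
under [in RHS]eq_fun do under eq_fun do rewrite appendE.
exact/mean_first_coords/bounded_functional_tuple.
Qed.

Lemma mean_martingale (F : nat -> (nat -> R) -> R) (u0 : nat -> R) :
  (forall n, depends_on_first n (F n)) -> (forall n, bounded_functional (F n)) ->
  (forall n u, (forall k, 0 <= u k <= 1) ->
    mean unif01 (fun v => F n.+1 (path_upd u n (clamp v))) = F n u) ->
  forall n, mean P (fun w => F n (clampU ^~ w)) = F 0%N u0.
Proof.
move=> depF bF stepF; elim=> [|n IH].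
  by rewrite -[RHS](mean_cst P); congr (mean P _); apply/funext => w; exact: depF.
rewrite (mean_path_upd (depF n.+1) (bF n.+1)) -IH; congr (mean P _); apply/funext => w.
by apply: stepF => k; exact: clampU01.
Qed.

Lemma cmean_martingale (F : nat -> (nat -> R) -> R[i]) (u0 : nat -> R) :
  (forall n, depends_on_first n (F n)) ->
  (forall n, bounded_functional (fun u => Re (F n u))) ->
  (forall n, bounded_functional (fun u => Im (F n u))) ->
  (forall n u, (forall k, 0 <= u k <= 1) ->
    cmean unif01 (fun v => F n.+1 (path_upd u n (clamp v))) = F n u) ->
  forall n, cmean P (fun w => F n (clampU ^~ w)) = F 0%N u0.
Proof.
move=> depF bRe bIm stepF n; apply: complex_eqP => /=.
  apply: (@mean_martingale (fun n u => Re (F n u))) => // {}n.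
    by move=> u u' uu'; rewrite (depF n u u' uu').
  by move=> u u01; rewrite -[in RHS](stepF n u u01).
apply: (@mean_martingale (fun n u => Im (F n u))) => // {}n.
  by move=> u u' uu'; rewrite (depF n u u' uu').
by move=> u u01; rewrite -[in RHS](stepF n u u01).
Qed.
End iid_uniform.

(** * Counting the splits of long intervals *)

Section splitting_counts.
Variables (R : realType) (t : R).
Implicit Types (u : nat -> R) (s v x y : R) (n k : nat).

Definition nsplits u n : R := \sum_(k < n) (if lmax (lens u k) <= t then 0 else 1).

Definition characteristic_martingale s n u : R[i] :=
  (\prod_(x <- lens u n) fixpt s (x / t)) * cis (s * (nsplits u n - n%:R)).

(* The function [depth] solves [depth y = 1 + 2 * E (depth (y * V))] for [y > 1], so that
   [depth_martingale] is a martingale; it bounds the mean number of splits of intervals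
   longer than [t]. *)
Definition depth y : R := if y <= 1 then 0 else 2 * y - 1.

Definition depth_martingale n u : R := \sum_(x <- lens u n) depth (x / t) + nsplits u n.

(* The default 0 matters only if some interval longer than [t] survives forever. *)
Definition stopped_nsplits u n : R := if lmax (lens u n) <= t then nsplits u n else 0.

Definition splitting_time u : R := limn (stopped_nsplits u).

Lemma nsplits0 u : nsplits u 0 = 0. Proof. by rewrite /nsplits big_ord0. Qed.

Lemma nsplitsS u n :
  nsplits u n.+1 = nsplits u n + (if lmax (lens u n) <= t then 0 else 1).
Proof. by rewrite /nsplits big_ord_recr. Qed.

Lemma nsplits_ge0 u n : 0 <= nsplits u n.
Proof. by apply: sumr_ge0 => k _; case: ifP. Qed.

Lemma nsplits_le u n : nsplits u n <= n%:R.
Proof.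
rewrite -[n in leRHS]card_ord -sumr_const; apply: ler_sum => k _; case: ifP => //.
Qed.

Lemma depends_on_first_nsplits n : depends_on_first n (nsplits ^~ n).
Proof.
move=> u u' uu'; apply: eq_bigr => k _; rewrite (@lens_ext _ u u')// => j jk.
by apply: uu'; exact: ltn_trans (ltn_ord k).
Qed.

Lemma depends_on_first_characteristic_martingale s n :
  depends_on_first n (characteristic_martingale s n).
Proof.
move=> u u' uu'; rewrite /characteristic_martingale (lens_ext uu').
by rewrite (depends_on_first_nsplits uu').
Qed.

Lemma depends_on_first_depth_martingale n : depends_on_first n (depth_martingale n).
Proof.
by move=> u u' uu'; rewrite /depth_martingale (lens_ext uu') (depends_on_first_nsplits uu').
Qed.

Lemma path_upd_lt u n v k : (k < n)%N -> path_upd u n v k = u k.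
Proof. by rewrite /path_upd => ->. Qed.

Lemma lens_path_upd u n v : lens (path_upd u n v) n.+1 = lsplit v (lens u n).
Proof.
rewrite /= (@lens_ext _ _ u); first by rewrite /path_upd ltnn.
by move=> k; exact: path_upd_lt.
Qed.

Lemma nsplits_path_upd u n v :
  nsplits (path_upd u n v) n.+1 = nsplits u n + (if lmax (lens u n) <= t then 0 else 1).
Proof.
have agree k : (k < n)%N -> path_upd u n v k = u k by exact: path_upd_lt.
by rewrite nsplitsS (lens_ext agree) (depends_on_first_nsplits agree).
Qed.

Lemma depth_itv w y : 0 <= w <= y -> 0 <= depth w <= 2 * y.
Proof. by rewrite /depth; case: (leP w 1); lra. Qed.

Lemma norm_depth_le w y : 0 <= w <= y -> `|depth w| <= 2 * y.
Proof. by move=> /depth_itv /andP[d0 d1]; rewrite ger0_norm. Qed.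

Lemma measurable_depth : measurable_fun setT depth.
Proof.
apply: measurable_fun_ifT => //; first exact: measurable_fun_ler.
by apply: measurable_funB => //; exact: measurable_funM.
Qed.

Lemma itv_integral_depth y : 1 <= y -> itv_integral 0 y depth = y * (y - 1).
Proof.
move=> y1; rewrite (@itv_integral_cat _ 0 1); last 3 first.
- by rewrite ler01.
- exact: measurable_depth.
- by exists (2 * y) => w /andP[w0 wy]; apply: norm_depth_le; rewrite !ltW.
rewrite (@eq_itv_integral _ 0 _ _ (fun=> 0)) ?itv_integral0; last first.
  by move=> w /andP[_ w1]; rewrite /depth ltW.
rewrite (@itv_integral_primitive _ 1 y (fun w => w ^+ 2 - w) _ (fun w => 2 * w - 1))//.
- by ring.
- by move=> w /andP[w1 _]; rewrite /depth leNgt w1.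
- by move=> w _; derive_expr_eq; ring.
Qed.

Lemma mean_depth_pieces y : 1 < y ->
  mean (unif01 R) (fun v => depth (left_piece y v)) = y - 1 /\
  mean (unif01 R) (fun v => depth (right_piece y v)) = y - 1.
Proof.
move=> y1; have y0 : 0 < y by lra.
have bnd : exists M, forall w, 0 <= w <= y -> `|depth w| <= M.
  by exists (2 * y) => w; exact: norm_depth_le.
have m := measurable_depth.
by split; rewrite (mean_left_piece, mean_right_piece)// itv_integral_depth ?mulKf ?gt_eqF// ltW.
Qed.

Lemma bounded_mfun_depth_pieces y : 0 <= y ->
  bounded_mfun (fun v => depth (left_piece y v)) /\
  bounded_mfun (fun v => depth (right_piece y v)).
Proof.
move=> y0; have m := measurable_depth; split.
  by apply: (@bounded_mfun_left_piece _ _ _ (2 * y)) => // w; exact: norm_depth_le.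
by apply: (@bounded_mfun_right_piece _ _ _ (2 * y)) => // w; exact: norm_depth_le.
Qed.

Lemma normc_prod_le_expR (l : seq R) (F : R -> R[i]) (c : R) :
  (forall x, x \in l -> normc (F x) <= expR (c * x)) ->
  normc (\prod_(x <- l) F x) <= expR (c * \sum_(x <- l) x).
Proof.
elim: l => [|a l IH] h; first by rewrite !big_nil ComplexField.Normc.normc1 mulr0 expR0.
rewrite !big_cons ComplexField.Normc.normcM mulrDr expRD ler_pM ?normc_ge0//.
  by apply: h; rewrite mem_head.
by apply: IH => x xl; apply: h; rewrite in_cons xl orbT.
Qed.

Hypothesis t0 : 0 < t.

Lemma prod_unsplit (l : seq R) s : \prod_(x <- l) unsplit s (x / t) =
  (expR (var_rate R * s ^+ 2 / 2 * (\sum_(x <- l) x / t)))%:C *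
  cis (s * ((size l)%:R - 2 * (\sum_(x <- l) x / t))).
Proof.
elim: l => [|a l IH].
  by rewrite !big_nil !mulr0 subr0 mulr0 expR0 cis0 mulr1.
rewrite !big_cons IH /unsplit [LHS]mulrACA -cisD -rmorphM/= -expRD -(natr1 (size l)).
by congr ((expR _)%:C * cis _); ring.
Qed.

Section admissible.
Variable u : nat -> R.
Hypothesis u01 : forall k, 0 <= u k <= 1.

Lemma characteristic_martingale_bound s n :
  normc (characteristic_martingale s n u) <= expR (24 * s ^+ 2 / t).
Proof.
rewrite ComplexField.Normc.normcM normc_cis mulr1.
have -> : expR (24 * s ^+ 2 / t) = expR (24 * s ^+ 2 / t * \sum_(x <- lens u n) x).
  by rewrite sum_lens// mulr1.
apply: normc_prod_le_expR => x xl; rewrite mulrAC -mulrA.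
by apply: fixpt_bound; rewrite divr_ge0 ?(ltW t0)// (lens_ge0 u01 xl).
Qed.

Lemma depth_martingale_bounds n :
  nsplits u n <= depth_martingale n u <= 2 / t * n.+1%:R + n%:R.
Proof.
have depth_len x : x \in lens u n -> 0 <= depth (x / t) <= 2 / t.
  move=> xl; apply: depth_itv; rewrite divr_ge0 ?(ltW t0) ?(lens_ge0 u01 xl)//=.
  by rewrite ler_pdivrMr// mulVf ?gt_eqF// (lens_le1 u01 xl).
rewrite /depth_martingale lerDr big_seq sumr_ge0/=; last by move=> x /depth_len /andP[].
rewrite lerD ?nsplits_le//.
have : \sum_(x <- lens u n) depth (x / t) <= \sum_(x <- lens u n) (2 / t).
  by rewrite big_seq [leRHS]big_seq; apply: ler_sum => x /depth_len /andP[].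
by rewrite -big_seq big_const_seq count_predT size_lens// iter_addr_0 mulr_natr.
Qed.

Lemma depth_step n :
  mean (unif01 R) (fun v => depth_martingale n.+1 (path_upd u n (clamp v))) = depth_martingale n u.
Proof.
set m := lmax (lens u n); set y := m / t.
have y0 : 0 <= y by rewrite divr_ge0 ?lmax_ge0 ?ltW.
set rest := \sum_(x <- rem m (lens u n)) depth (x / t).
have nextE v : depth_martingale n.+1 (path_upd u n (clamp v)) =
    (rest + nsplits u n + (if m <= t then 0 else 1)) +
    (depth (left_piece y v) + depth (right_piece y v)).
  rewrite /depth_martingale lens_path_upd nsplits_path_upd.
  rewrite (perm_big _ (perm_lsplit_lens u01 (clamp v) n))/= !big_cons -/m -/rest.
  have -> : clamp v * m / t = left_piece y v by rewrite /left_piece /y; ring.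
  have -> : (1 - clamp v) * m / t = right_piece y v by rewrite /right_piece /y; ring.
  by ring.
have nowE : depth_martingale n u = rest + nsplits u n + depth y.
  by rewrite /depth_martingale (perm_big _ (perm_lens u01 n))/= big_cons -/m -/rest -/y; ring.
have [bl br] := bounded_mfun_depth_pieces y0.
under eq_fun do rewrite nextE.
rewrite nowE meanD ?mean_cst ?meanD; try by solve_integrable.
have [mt|mt] := leP m t.
  have y1 : y <= 1 by rewrite ler_pdivrMr// mul1r.
  have depth0 w : 0 <= w <= y -> depth w = 0.
    by move=> /andP[_ wy]; rewrite /depth (le_trans wy y1).
  under eq_fun do rewrite depth0 ?left_piece_itv//.
  under [X in _ + (_ + mean _ X)]eq_fun do rewrite depth0 ?right_piece_itv//.
  by rewrite mean_cst depth0 ?lexx ?y0//; ring.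
have y1 : 1 < y by rewrite ltr_pdivlMr// mul1r.
by have [-> ->] := mean_depth_pieces y1; rewrite /depth leNgt y1/=; ring.
Qed.

Lemma characteristic_step s n :
  cmean (unif01 R) (fun v => characteristic_martingale s n.+1 (path_upd u n (clamp v))) =
  characteristic_martingale s n u.
Proof.
set m := lmax (lens u n); set y := m / t.
have y0 : 0 <= y by rewrite divr_ge0 ?lmax_ge0 ?ltW.
set rest := \prod_(x <- rem m (lens u n)) fixpt s (x / t).
set phase := s * (nsplits u n + (if m <= t then 0 else 1) - n.+1%:R).
have nextE v : characteristic_martingale s n.+1 (path_upd u n (clamp v)) =
    (rest * cis phase) * (fixpt s (left_piece y v) * fixpt s (right_piece y v)).
  rewrite /characteristic_martingale lens_path_upd nsplits_path_upd.
  rewrite (perm_big _ (perm_lsplit_lens u01 (clamp v) n))/= !big_cons -/m -/rest -/phase.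
  have -> : clamp v * m / t = left_piece y v by rewrite /left_piece /y; ring.
  have -> : (1 - clamp v) * m / t = right_piece y v by rewrite /right_piece /y; ring.
  by ring.
have nowE : characteristic_martingale s n u =
    rest * cis (s * (nsplits u n - n%:R)) * fixpt s y.
  rewrite /characteristic_martingale (perm_big _ (perm_lens u01 n))/= big_cons -/m -/rest -/y.
  by ring.
under eq_fun do rewrite nextE.
rewrite nowE; have [mt|mt] := leP m t.
  have y1 : y <= 1 by rewrite ler_pdivrMr// mul1r.
  under eq_fun => v.
    rewrite fixpt_le1; last by rewrite (le_trans _ y1)//; case/andP: (left_piece_itv v y0).
    rewrite fixpt_le1; last by rewrite (le_trans _ y1)//; case/andP: (right_piece_itv v y0).
    rewrite unsplit_pieces; over.
  have -> : s * (nsplits u n - n%:R) = phase + s by rewrite /phase mt -(natr1 n); ring.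
  by rewrite cmean_cst fixpt_le1// cisD; ring.
have y1 : 1 < y by rewrite ltr_pdivlMr// mul1r.
rewrite cmeanZl -/(split_op (fixpt s) y); last first.
  apply: (@bounded_cfun_split _ _ _ (expR (24 * s ^+ 2 * y)) y0 (measurable_fixpt s)) => w.
  move=> /andP[w0 wy]; apply: (le_trans (fixpt_bound s w0)).
  by rewrite ler_expR ler_wpM2l// mulr_ge0// sqr_ge0.
rewrite -fixptE//; congr (_ * cis _ * _).
by rewrite /phase leNgt mt/= -(natr1 n); ring.
Qed.

Lemma characteristic_martingale_all_short s n : lmax (lens u n) <= t ->
  characteristic_martingale s n u =
  (expR (var_rate R * s ^+ 2 / 2 / t))%:C * cis (s * (nsplits u n + 1 - 2 / t)).
Proof.
move=> short; rewrite /characteristic_martingale.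
have -> : \prod_(x <- lens u n) fixpt s (x / t) = \prod_(x <- lens u n) unsplit s (x / t).
  rewrite big_seq [RHS]big_seq; apply: eq_bigr => x xl; apply: fixpt_le1.
  by rewrite ler_pdivrMr// mul1r (le_trans (le_lmax xl)).
rewrite prod_unsplit -mulr_suml (sum_lens u01) size_lens// mul1r -mulrA -cisD.
by congr (_ * cis _); rewrite -(natr1 n); ring.
Qed.

Lemma nsplits_stable m n : lmax (lens u m) <= t -> (m <= n)%N ->
  lmax (lens u n) <= t /\ nsplits u n = nsplits u m.
Proof.
move=> short mn.
have short_after k : (m <= k)%N -> lmax (lens u k) <= t.
  by move=> mk; apply: le_trans short; exact: lmax_lens_nonincreasing.
split; first exact: short_after.
elim: n mn => [|n IH]; first by rewrite leqn0 => /eqP ->.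
rewrite leq_eqVlt => /predU1P[->//|]; rewrite ltnS => mn.
by rewrite nsplitsS short_after// addr0 IH.
Qed.

Lemma nsplits_all_long n : t < lmax (lens u n) -> nsplits u n.+1 = n.+1%:R.
Proof.
move=> long.
have long_before k : (k <= n)%N -> (lmax (lens u k) <= t) = false.
  move=> kn; apply/negbTE; rewrite -ltNge; apply: lt_le_trans long _.
  exact: lmax_lens_nonincreasing.
suff : forall k, (k <= n.+1)%N -> nsplits u k = k%:R by apply.
elim=> [|k IH] kn; first exact: nsplits0.
by rewrite nsplitsS long_before// IH ?natr1// ltnW.
Qed.

Lemma nsplits_nondecreasing : nondecreasing_seq (nsplits u).
Proof.
by apply/nondecreasing_seqP => n; rewrite nsplitsS lerDl; case: ifP.
Qed.

Lemma stopped_nsplits_cst m n : lmax (lens u m) <= t -> (m <= n)%N ->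
  stopped_nsplits u n = nsplits u m.
Proof. by move=> short /(nsplits_stable short)[short_n nE]; rewrite /stopped_nsplits short_n. Qed.

Lemma stopped_nsplits_ge0 n : 0 <= stopped_nsplits u n.
Proof. by rewrite /stopped_nsplits; case: ifP => // _; exact: nsplits_ge0. Qed.

Lemma stopped_nsplits_le n : stopped_nsplits u n <= nsplits u n.
Proof. by rewrite /stopped_nsplits; case: ifP => // _; exact: nsplits_ge0. Qed.

Lemma stopped_nsplits_nondecreasing : nondecreasing_seq (stopped_nsplits u).
Proof.
move=> m n mn; rewrite {1}/stopped_nsplits; case: ifP => [short|_]; last exact: stopped_nsplits_ge0.
by rewrite (stopped_nsplits_cst short mn).
Qed.

Lemma splitting_timeE n : lmax (lens u n) <= t -> splitting_time u = nsplits u n.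
Proof.
move=> short; apply: (cvg_lim (@Rhausdorff R)); apply: cvg_near_cst.
by exists n => // k /= nk; exact: stopped_nsplits_cst.
Qed.

Lemma stopped_nsplits_cvg : stopped_nsplits u n @[n --> \oo] --> splitting_time u.
Proof.
suff : cvgn (stopped_nsplits u) by [].
have [[n short]|never] := pselect (exists n, lmax (lens u n) <= t).
  apply/cvg_ex; exists (nsplits u n); apply: cvg_near_cst.
  by exists n => // k /= nk; exact: stopped_nsplits_cst.
rewrite (_ : stopped_nsplits u = fun=> 0); first exact: is_cvg_cst.
apply/funext => n; rewrite /stopped_nsplits ifF//.
by apply/negP => short; apply: never; exists n.
Qed.

Lemma splitting_time_le n : (exists m, lmax (lens u m) <= t) ->
  (splitting_time u <= n%:R) = (lmax (lens u n) <= t).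
Proof.
move=> [m short_m]; apply/idP/idP => [|short].
  apply: contraTT; rewrite -!ltNge => long.
  have nm : (n.+1 <= m)%N.
    rewrite ltnNge; apply/negP => mn.
    by have [] := nsplits_stable short_m mn; rewrite leNgt long.
  have := nsplits_nondecreasing nm; rewrite nsplits_all_long// (splitting_timeE short_m).
  by apply: lt_le_trans; rewrite ltr_nat.
by rewrite (splitting_timeE short); exact: nsplits_le.
Qed.
End admissible.

Section measurability.
Context d (T : measurableType d).
Variable U : nat -> T -> R.
Hypothesis mU : forall k, measurable_fun setT (U k).

Lemma measurable_nsplits n : measurable_fun setT (fun w => nsplits (U ^~ w) n).
Proof.
apply: measurable_sum => k; apply: measurable_fun_ifT => //.
by apply: measurable_fun_ler => //; exact: measurable_lmax_lens.
Qed.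

Lemma bounded_mfun_nsplits n : bounded_mfun (fun w => nsplits (U ^~ w) n).
Proof.
split; first exact: measurable_nsplits.
by exists n%:R => w; rewrite ger0_norm ?nsplits_ge0// nsplits_le.
Qed.

Lemma bounded_mfun_stopped_nsplits n : bounded_mfun (fun w => stopped_nsplits (U ^~ w) n).
Proof.
split.
  apply: measurable_fun_ifT => //; last exact: measurable_nsplits.
  by apply: measurable_fun_ler => //; exact: measurable_lmax_lens.
exists n%:R => w; rewrite ger0_norm ?stopped_nsplits_ge0//.
exact: le_trans (stopped_nsplits_le _ _) (nsplits_le _ _).
Qed.
End measurability.

Lemma bounded_functional_depth_martingale n : bounded_functional (depth_martingale n).
Proof.
move=> d T U mU U01; split.
  apply: measurable_funD; last exact: measurable_nsplits.
  apply: (measurable_sum_lens mU U01 n (F := fun x => depth (x / t))).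
  by apply: (measurableT_comp measurable_depth); exact: measurable_funM.
exists (2 / t * n.+1%:R + n%:R) => w.
have /andP[lb ub] := depth_martingale_bounds (U01 ^~ w) n.
by rewrite ger0_norm// (le_trans _ lb)// nsplits_ge0.
Qed.

Lemma bounded_cfun_characteristic_martingale s n d (T : measurableType d) (U : nat -> T -> R) :
  (forall k, measurable_fun setT (U k)) -> (forall k w, 0 <= U k w <= 1) ->
  bounded_cfun (fun w => characteristic_martingale s n (U ^~ w)).
Proof.
move=> mU U01; apply: (@measurable_cfun_bounded _ _ _ _ (expR (24 * s ^+ 2 / t))); last first.
  by move=> w; exact: characteristic_martingale_bound (U01 ^~ w) s n.
apply: measurable_cfunM.
  apply: (measurable_cfun_prod_lens mU U01 n (F := fun x => fixpt s (x / t))).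
  by apply: (measurable_cfun_comp (measurable_fixpt s)); exact: measurable_funM.
apply: measurable_cfun_cis; apply: measurable_funM => //.
by apply: measurable_funB => //; exact: measurable_nsplits.
Qed.
End splitting_counts.

Lemma eq_measure_mod_null d (T : measurableType d) (R : realType)
    (mu : {measure set T -> \bar R}) (A B N : set T) :
  measurable A -> measurable B -> measurable N -> mu N = 0%E ->
  A `<=` B `|` N -> B `<=` A `|` N -> mu A = mu B.
Proof.
move=> mA mB mN N0.
have le_mod_null (C D : set T) : measurable C -> measurable D -> C `<=` D `|` N -> (mu C <= mu D)%E.
  move=> mC mD CD; apply: (@le_trans _ _ (mu (D `|` N))).
    by apply: le_measure; rewrite ?inE//; exact: measurableU.
  have : (mu (D `|` N) <= mu D + mu N)%E by exact: measureU2.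
  by rewrite N0 adde0.
by move=> AB BA; apply/eqP; rewrite eq_le !le_mod_null.
Qed.

Section splitting_time_law.
Context d (T : measurableType d) (R : realType) (P : probability T R)
  (U : nat -> {RV P >-> R}).
Hypothesis indU : mutually_independent U.
Hypothesis lawU : forall k (A : set R), measurable A ->
     distribution P (U k) A = uniform_prob (@ltr01 R) A.
Variable t : R.
Hypothesis t0 : 0 < t.
Implicit Types (n : nat) (w : T) (s : R).

Local Notation path w := (clampU U ^~ w).

Definition tau w : R := splitting_time t (path w).

Lemma path01 w k : 0 <= path w k <= 1. Proof. exact: clampU01. Qed.

Lemma cmean_characteristic_martingale s n :
  cmean P (fun w => characteristic_martingale t s n (path w)) = fixpt s (1 / t).
Proof.
rewrite (cmean_martingale indU lawU (F := characteristic_martingale t s) (fun=> 0)).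
- by rewrite /characteristic_martingale /= big_seq1 nsplits0 subr0 mulr0 cis0 mulr1.
- exact: depends_on_first_characteristic_martingale.
- by move=> {}n d' T' V mV V01; have [] := bounded_cfun_characteristic_martingale t0 s n mV V01.
- by move=> {}n d' T' V mV V01; have [] := bounded_cfun_characteristic_martingale t0 s n mV V01.
- by move=> {}n u u01; exact: characteristic_step.
Qed.

Lemma mean_depth_martingale n :
  mean P (fun w => depth_martingale t n (path w)) = depth (1 / t).
Proof.
rewrite (mean_martingale indU lawU (F := depth_martingale t) (fun=> 0)).
- by rewrite /depth_martingale /= big_seq1 nsplits0 addr0.
- exact: depends_on_first_depth_martingale.
- exact: bounded_functional_depth_martingale.
- by move=> {}n u u01; exact: depth_step.
Qed.

Lemma mean_nsplits_le n : mean P (fun w => nsplits t (path w) n) <= 2 / t.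
Proof.
apply: (@le_trans _ _ (mean P (fun w => depth_martingale t n (path w)))).
  apply: le_mean => [||w].
  - exact/bounded_mfun_integrable/bounded_mfun_nsplits/measurable_clampU.
  - apply: bounded_mfun_integrable; apply: bounded_functional_depth_martingale => //.
      exact: measurable_clampU.
    by move=> k w; exact: path01.
  by have /andP[] := depth_martingale_bounds t0 (path01 w) n.
rewrite mean_depth_martingale; have ti : 0 < t^-1 by rewrite invr_gt0.
by rewrite /depth; case: ifP => _; lra.
Qed.

Lemma measurable_lmax_path_gt n : measurable [set w | t < lmax (lens (path w) n)].
Proof.
rewrite -[X in measurable X]setTI.
by apply: (measurable_fun_ltr _ (measurable_lmax_lens (measurable_clampU U) n)).
Qed.

Lemma prob_lmax_path_gt_le n :
  fine (P [set w | t < lmax (lens (path w) n)]) <= 2 / t / n.+1%:R.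
Proof.
have mlong := measurable_lmax_path_gt n.
rewrite -(mean_indic P mlong) ler_pdivlMr ?ltr0n// mulrC -meanZl; last first.
  exact/bounded_mfun_integrable/bounded_mfun_indic.
apply: le_trans (mean_nsplits_le n.+1); apply: le_mean => [||w].
- by apply: bounded_mfun_integrable; solve_bounded; exact: bounded_mfun_indic.
- exact/bounded_mfun_integrable/bounded_mfun_nsplits/measurable_clampU.
rewrite indicE; case: (boolP (w \in _)) => [|_]; last by rewrite mulr0 nsplits_ge0.
by rewrite inE/= => /(nsplits_all_long (path01 w)) ->; rewrite mulr1.
Qed.

Lemma stopped_nsplits_path_cvg w : stopped_nsplits t (path w) n @[n --> \oo] --> tau w.
Proof. exact: stopped_nsplits_cvg (path01 w). Qed.

Lemma measurable_tau : measurable_fun setT tau.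
Proof.
apply: (measurable_fun_cvg (h := fun n w => stopped_nsplits t (path w) n)) => [n|w _].
  by have [] := bounded_mfun_stopped_nsplits t (measurable_clampU U) n.
exact: stopped_nsplits_path_cvg.
Qed.

Lemma integrable_tau : Rintegrable P tau.
Proof.
apply: (@integrable_nondecreasing_lim _ _ _ P (fun n w => stopped_nsplits t (path w) n) _ (2 / t)).
- by move=> n; exact/bounded_mfun_stopped_nsplits/measurable_clampU.
- by move=> n w; exact: stopped_nsplits_ge0.
- by move=> w; exact: stopped_nsplits_nondecreasing (path01 w).
- move=> n; apply: le_trans (mean_nsplits_le n); apply: le_mean => [||w].
  + exact/bounded_mfun_integrable/bounded_mfun_stopped_nsplits/measurable_clampU.
  + exact/bounded_mfun_integrable/bounded_mfun_nsplits/measurable_clampU.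
  + exact: stopped_nsplits_le.
- exact: stopped_nsplits_path_cvg.
Qed.

Definition centered_tau w : R := tau w + 1 - 2 / t.

Lemma measurable_centered_tau : measurable_fun setT centered_tau.
Proof. by have := measurable_tau => *; rewrite /centered_tau; solve_measurable. Qed.

Lemma integrable_centered_tau : Rintegrable P centered_tau.
Proof.
have icst (a : R) : Rintegrable P (fun=> a) by exact/bounded_mfun_integrable/bounded_mfun_cst.
have itau1 := integrableD measurableT integrable_tau (icst 1).
exact: (integrableB measurableT itau1 (icst (2 / t))).
Qed.

Lemma bounded_cfun_cis_tau s : bounded_cfun (fun w => cis (s * centered_tau w)).
Proof.
apply: (@measurable_cfun_bounded _ _ _ _ 1); last by move=> w; rewrite normc_cis.
by apply: measurable_cfun_cis; apply: measurable_funM => //; exact: measurable_centered_tau.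
Qed.

Let scale s : R[i] := (expR (var_rate R * s ^+ 2 / 2 / t))%:C.

Lemma normc_cmean_cis_tau_sub_le s n :
  normc (scale s * cmean P (fun w => cis (s * centered_tau w)) - fixpt s (1 / t)) <=
  4 * expR (24 * s ^+ 2 / t) / t / n.+1%:R.
Proof.
set B := expR (24 * s ^+ 2 / t); have B0 : 0 < B by exact: expR_gt0.
have scale_le : normc (scale s) <= B.
  rewrite normc_real ger0_norm ?expR_ge0// ler_expR ler_pM2r ?invr_gt0//.
  have := ler_wpM2r (sqr_ge0 s) (var_rate_le3 R); have := sqr_ge0 s; lra.
have bcis : bounded_cfun (fun w => scale s * cis (s * centered_tau w)).
  by have := bounded_cfun_cis_tau s => *; solve_cbounded.
have bmart : bounded_cfun (fun w => characteristic_martingale t s n (path w)).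
  apply: bounded_cfun_characteristic_martingale => //; first exact: measurable_clampU.
  by move=> k w; exact: path01.
rewrite -(cmean_characteristic_martingale s n) -cmeanZl; last exact: bounded_cfun_cis_tau.
rewrite -cmeanB//; have mlong := measurable_lmax_path_gt n.
have ilong : bounded_mfun (\1_[set w | t < lmax (lens (path w) n)] : T -> R).
  exact: bounded_mfun_indic.
apply: (@le_trans _ _ (mean P (fun w => 2 * B * \1_[set w | t < lmax (lens (path w) n)] w))).
  apply: normc_cmean_le => [||w]; [by solve_cbounded | by solve_integrable |].
  have [short|long] := leP (lmax (lens (path w) n)) t.
    rewrite (characteristic_martingale_all_short t0 (path01 w) s short).
    rewrite /centered_tau /tau (splitting_timeE (path01 w) short) subrr ComplexField.Normc.normc0.
    by rewrite !mulr_ge0// ltW.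
  rewrite indicE mem_set//= mulr1 (le_trans (normc_leB _ _))//.
  rewrite ComplexField.Normc.normcM normc_cis mulr1.
  by have := characteristic_martingale_bound t0 (path01 w) s n; rewrite -/B; lra.
rewrite meanZl ?mean_indic//; last by solve_integrable.
have -> : 4 * B / t / n.+1%:R = 2 * B * (2 / t / n.+1%:R) by ring.
by rewrite ler_wpM2l ?prob_lmax_path_gt_le// mulr_ge0// ltW.
Qed.

Lemma cmean_cis_centered_tau s : cmean P (fun w => cis (s * centered_tau w)) =
  (expR (- (var_rate R * s ^+ 2 / 2 / t)))%:C * fixpt s (1 / t).
Proof.
suff <- : scale s * cmean P (fun w => cis (s * centered_tau w)) = fixpt s (1 / t).
  by rewrite mulrA -rmorphM/= -expRD addNr expR0 mul1r.
apply/eqP; rewrite -subr_eq0; apply/eqP/ComplexField.Normc.eq0_normc.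
apply/eqP; rewrite eq_le normc_ge0 andbT; apply: ler0_archimedean => n.
exact: normc_cmean_cis_tau_sub_le.
Qed.

Lemma prob_never_short : P (\bigcap_n [set w | t < lmax (lens (path w) n)]) = 0%E.
Proof.
set never := \bigcap_n _; have mnever : measurable never.
  by apply: bigcapT_measurable => n; exact: measurable_lmax_path_gt.
rewrite -(fineK (fin_num_measure P _ mnever)); congr EFin; apply/eqP.
rewrite eq_le fine_ge0 ?measure_ge0// andbT; apply: ler0_archimedean => n.
apply: le_trans (prob_lmax_path_gt_le n); apply: fine_le.
- exact: fin_num_measure.
- by apply: fin_num_measure; exact: measurable_lmax_path_gt.
- apply: le_measure; rewrite ?inE//; first exact: measurable_lmax_path_gt.
  by move=> w; apply.
Qed.

Lemma clampU_ae : exists2 N : set T, measurable N /\ P N = 0%E &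
  forall w, ~ N w -> forall k, U k w = clampU U k w.
Proof.
have m01 : measurable (~` `[0, 1]%classic : set R) by exact: measurableC.
have outside0 k : P (U k @^-1` (~` `[0, 1]%classic)) = 0%E.
  rewrite -[LHS]/(distribution P (U k) (~` `[0, 1]%classic)) lawU//.
  by rewrite /uniform_prob integral_uniform_pdf setICl integral_set0.
have : P.-negligible (\bigcup_k (U k @^-1` (~` `[0, 1]%classic))).
  apply: negligible_bigcup => k; exists (U k @^-1` (~` `[0, 1]%classic)); split; last by [].
    by rewrite -[X in measurable X]setTI; apply: measurable_funP.
  exact: outside0.
move=> [N [mN N0 sN]]; exists N => // w Nw k; rewrite /clampU clamp_id//.
by apply: contrapT => Uk; apply: Nw; apply: sN; exists k.
Qed.

Lemma measurable_Mn_le n (x : R) : measurable [set w | Mn (fun k => U k w) n <= x].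
Proof.
under eq_set do rewrite MnE.
by apply: measurable_lmax_lens_le => k; exact: measurable_funP.
Qed.

Lemma prob_Mn_le n : P [set w | Mn (fun k => U k w) n <= t] = P [set w | tau w <= n%:R].
Proof.
have [N [mN N0] clampN] := clampU_ae.
set never := \bigcap_n [set w | t < lmax (lens (path w) n)].
have mnever : measurable never by apply: bigcapT_measurable => k; exact: measurable_lmax_path_gt.
have agree w : ~ (N `|` never) w -> (Mn (fun k => U k w) n <= t) = (tau w <= n%:R).
  move=> /not_orP[Nw never_w]; rewrite /tau splitting_time_le; last 2 first.
  - exact: path01.
  - apply: contrapT => all_long; apply: never_w => k _ /=; rewrite ltNge.
    by apply/negP => short; apply: all_long; exists k.
  by rewrite MnE; congr (lmax _ <= _); apply: lens_ext => k _; exact: clampN.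
apply: (@eq_measure_mod_null _ _ _ P _ _ (N `|` never)).
- exact: measurable_Mn_le.
- rewrite -[X in measurable X]setTI.
  by apply: (measurable_fun_ler measurable_tau) => //; exact: measurable_cst.
- exact: measurableU.
- have : (P (N `|` never) <= P N + P never)%E by exact: measureU2.
  by rewrite N0 prob_never_short adde0 => null; apply/eqP; rewrite eq_le measure_ge0 null.
- by move=> w Mw; have [|Nw] := pselect ((N `|` never) w); [right | left; rewrite /= -agree].
- by move=> w tw; have [|Nw] := pselect ((N `|` never) w); [right | left; rewrite /= agree].
Qed.
End splitting_time_law.

(** * A smoothing inequality *)

Lemma measurable_invr_fun d (T : measurableType d) (R : realType) (f : T -> R) :
  measurable_fun setT f -> (forall x, 0 < f x) -> measurable_fun setT (fun x => (f x)^-1).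
Proof.
move=> mf f0; have -> : (fun x => (f x)^-1) = (fun x => expR (- ln (f x))).
  by apply/funext => x; rewrite expRN lnK// posrE.
apply: (measurableT_comp (f := expR)) => //; apply: measurable_funN.
exact: measurableT_comp (@measurable_ln R) mf.
Qed.

Lemma bounded_mfun_fcos d (T : measurableType d) (R : realType) (f : T -> R) :
  measurable_fun setT f -> bounded_mfun (fun x => cos (f x)).
Proof. by move=> mf; split; [exact: measurable_fcos | exists 1 => x; exact: cos_max]. Qed.

Section sinc.
Variable R : realType.
Implicit Types s z a b : R.
Local Notation unif01 := (unif01 R).

Lemma mean_cos_affine s a b : s != 0 ->
  (b - a) * mean unif01 (fun u => cos (s * (a + (b - a) * clamp u))) =
  (sin (s * b) - sin (s * a)) / s.
Proof.
move=> s0; have mclamp := @measurable_clamp R.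
rewrite -meanZl; last by apply/bounded_mfun_integrable/bounded_mfun_fcos; solve_measurable.
rewrite (@mean_unif01_clamp _ (fun u => (b - a) * cos (s * (a + (b - a) * u)))); last 2 first.
- by solve_measurable.
- by exists `|b - a| => x _; rewrite normrM ler_piMr//; exact: cos_max.
rewrite (@itv_integral_primitive _ 0 1 (fun u => sin (s * (a + (b - a) * u)) / s) _
  (fun u => (b - a) * cos (s * (a + (b - a) * u))) ler01)//.
- by rewrite mulr0 addr0 mulr1 subrKC mulrBl.
- by move=> x _; derive_expr_eq; field.
Qed.

(* [sinc s z] is [sin (s * z) / s], extended by continuity to [s = 0]. *)
Definition sinc s z : R := z * mean unif01 (fun u => cos (s * (z * clamp u))).

Lemma sincE s z : s != 0 -> sinc s z = sin (s * z) / s.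
Proof.
move=> s0; have := mean_cos_affine 0 z s0; rewrite mulr0 sin0 !subr0 => <-.
by rewrite /sinc; congr (_ * mean _ _); apply/funext => u; rewrite add0r.
Qed.

Lemma norm_sinc_le s z : `|sinc s z| <= `|z|.
Proof.
rewrite /sinc normrM ler_piMr//; apply: norm_mean_le => [|x]; last exact: cos_max.
by apply: bounded_mfun_fcos; solve_measurable.
Qed.

Lemma sincN s z : sinc s (- z) = - sinc s z.
Proof.
rewrite /sinc mulNr; congr (- (_ * mean _ _)); apply/funext => u.
by rewrite mulNr mulrN cosN.
Qed.

Lemma sincB s a b : sinc s b - sinc s a =
  (b - a) * mean unif01 (fun u => cos (s * (a + (b - a) * clamp u))).
Proof.
have [->|s0] := eqVneq s 0; last by rewrite !sincE// mean_cos_affine// mulrBl.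
have mean_cos0 (f : R -> R) : mean unif01 (fun u => cos (0 * f u)) = 1.
  by rewrite -[RHS](mean_cst unif01); congr (mean _ _); apply/funext => u; rewrite mul0r cos0.
rewrite /sinc (mean_cos0 (fun u => b * clamp u)) (mean_cos0 (fun u => a * clamp u)).
by rewrite (mean_cos0 (fun u => a + (b - a) * clamp u)) !mulr1.
Qed.

Lemma measurable_sinc d (T : measurableType d) (f g : T -> R) : measurable_fun setT f ->
  measurable_fun setT g -> measurable_fun setT (fun x => sinc (f x) (g x)).
Proof.
move=> mf mg; apply: measurable_funM => //.
apply: (@measurable_mean _ _ _ _ _ unif01 (fun xu : T * measurableTypeR R =>
  cos (f xu.1 * (g xu.1 * clamp xu.2)))).
have mf1 := measurableT_comp mf (@measurable_fst _ _ T (measurableTypeR R)).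
have mg1 := measurableT_comp mg (@measurable_fst _ _ T (measurableTypeR R)).
by solve_measurable.
Qed.
End sinc.

Section weighted_transforms.
Variables (R : realType) (wt : R -> R).
Hypothesis mwt : measurable_fun setT wt.
Hypothesis wt01 : forall s, 0 <= s <= 1 -> 0 <= wt s <= 1.
Implicit Types (s z a b : R) (A D : R -> R).
Local Notation unif01 := (unif01 R).

Definition cosine_transform z : R := mean unif01 (fun u => wt (clamp u) * cos (clamp u * z)).

Definition sine_transform z : R := mean unif01 (fun u => wt (clamp u) * sinc (clamp u) z).

Lemma measurable_weight d (T : measurableType d) (f : T -> R) :
  measurable_fun setT f -> measurable_fun setT (fun x => wt (clamp (f x))).
Proof. by move=> mf; apply: (measurableT_comp mwt); exact: measurable_fclamp. Qed.

Lemma norm_weight_mul_le (u r : R) : `|wt (clamp u) * r| <= `|r|.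
Proof.
rewrite normrM ler_piMl//; have /andP[w0 w1] := wt01 (clamp01 u).
by rewrite ger0_norm.
Qed.

Lemma norm_weight_cos_le1 (u z : R) : `|wt (clamp u) * cos z| <= 1.
Proof. exact: le_trans (norm_weight_mul_le _ _) (cos_max _). Qed.

Lemma bounded_mfun_weight_cos d (T : measurableType d) (f g : T -> R) :
  measurable_fun setT f -> measurable_fun setT g ->
  bounded_mfun (fun x => wt (clamp (f x)) * cos (g x)).
Proof.
move=> mf mg; split; last by exists 1 => x; exact: norm_weight_cos_le1.
by apply: measurable_funM; [exact: measurable_weight | exact: measurable_fcos].
Qed.

Lemma bounded_mfun_weight_sinc z :
  bounded_mfun (fun u : measurableTypeR R => wt (clamp u) * sinc (clamp u) z).
Proof.
split; last first.
  by exists `|z| => u; exact: le_trans (norm_weight_mul_le _ _) (norm_sinc_le _ _).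
by apply: measurable_funM; [apply: measurable_weight | apply: measurable_sinc]; solve_measurable.
Qed.

Lemma measurable_cosine_transform : measurable_fun setT cosine_transform.
Proof.
have bwt : bounded_mfun (fun zu : R * measurableTypeR R => wt (clamp zu.2) * cos (clamp zu.2 * zu.1)).
  by apply: bounded_mfun_weight_cos; solve_measurable.
by have [+ _] := bwt; exact: measurable_mean.
Qed.

Lemma measurable_sine_transform : measurable_fun setT sine_transform.
Proof.
apply: (@measurable_mean _ _ _ _ _ unif01 (fun zu : R * measurableTypeR R =>
  wt (clamp zu.2) * sinc (clamp zu.2) zu.1)).
by apply: measurable_funM; [apply: measurable_weight | apply: measurable_sinc]; solve_measurable.
Qed.

Lemma norm_cosine_transform_le1 z : `|cosine_transform z| <= 1.
Proof.
apply: norm_mean_le => [|u]; last exact: norm_weight_cos_le1.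
by apply: bounded_mfun_weight_cos; solve_measurable.
Qed.

Lemma sine_transformN z : sine_transform (- z) = - sine_transform z.
Proof.
rewrite /sine_transform -meanN; last exact/bounded_mfun_integrable/bounded_mfun_weight_sinc.
by congr (mean _ _); apply/funext => u; rewrite sincN mulrN.
Qed.

Lemma bounded_mfun_cosine_transform d (T : measurableType d) (f : T -> R) :
  measurable_fun setT f -> bounded_mfun (fun x => cosine_transform (f x)).
Proof.
move=> mf; split; first exact: measurableT_comp measurable_cosine_transform mf.
by exists 1 => x; exact: norm_cosine_transform_le1.
Qed.

Lemma sine_transformB a b : sine_transform b - sine_transform a =
  (b - a) * mean unif01 (fun v => cosine_transform (a + (b - a) * clamp v)).
Proof.
pose F (uv : measurableTypeR R * measurableTypeR R) : R :=
  wt (clamp uv.1) * cos (clamp uv.1 * (a + (b - a) * clamp uv.2)).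
have bF : bounded_mfun F by apply: bounded_mfun_weight_cos; solve_measurable.
rewrite -meanB; [|exact/bounded_mfun_integrable/bounded_mfun_weight_sinc..].
transitivity (mean unif01 (fun u => (b - a) * mean unif01 (fun v => F (u, v)))).
  congr (mean _ _); apply/funext => u; rewrite -mulrBr sincB mulrCA; congr (_ * _).
  by rewrite -meanZl//; apply/bounded_mfun_integrable/bounded_mfun_fcos; solve_measurable.
rewrite meanZl; last exact/bounded_mfun_integrable/bounded_mfun_mean.
by rewrite (mean_fubini unif01 unif01 bF).
Qed.

Section expectations.
Context d (T : measurableType d) (P : probability T R) (X : T -> R).
Hypothesis mX : measurable_fun setT X.
Variable x : R.

Let mxX : measurable_fun setT (fun w => x - X w).
Proof. exact: measurable_funB. Qed.

Let mxX1 : measurable_fun setT (fun wu : T * measurableTypeR R => x - X wu.1).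
Proof. exact: measurableT_comp mxX measurable_fst. Qed.

Lemma mean_cosine_transform : mean P (fun w => cosine_transform (x - X w)) =
  mean unif01 (fun u => wt (clamp u) * mean P (fun w => cos (clamp u * X w + - (clamp u * x)))).
Proof.
have bF : bounded_mfun (fun wu : T * measurableTypeR R =>
    wt (clamp wu.2) * cos (clamp wu.2 * (x - X wu.1))).
  apply: bounded_mfun_weight_cos; first exact: measurable_snd.
  by apply: measurable_funM => //; apply: measurable_fclamp; exact: measurable_snd.
rewrite (_ : mean P _ = mean P (fun w => mean unif01 (fun u =>
  wt (clamp u) * cos (clamp u * (x - X w)))))// (mean_fubini P unif01 bF).
congr (mean _ _); apply/funext => u /=; rewrite -meanZl; last first.
  by apply/bounded_mfun_integrable/bounded_mfun_fcos; solve_measurable.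
congr (mean _ _); apply/funext => w; congr (_ * _); rewrite -cosN; congr cos; ring.
Qed.

Lemma mean_cosine_transform_le A : bounded_mfun (fun u : measurableTypeR R => A (clamp u)) ->
  (forall s (th : R), 0 <= s <= 1 -> `|mean P (fun w => cos (s * X w + th))| <= A s) ->
  mean P (fun w => cosine_transform (x - X w)) <= mean unif01 (fun u => A (clamp u)).
Proof.
move=> bA cf_le; rewrite mean_cosine_transform; apply: le_mean => [||u].
- have mX2 := measurableT_comp mX (@measurable_snd _ _ (measurableTypeR R) T).
  apply: bounded_mfun_integrable; split.
    apply: measurable_funM; first by apply: measurable_weight; exact: measurable_id.
    apply: (@measurable_mean _ _ _ _ _ P (fun uw : measurableTypeR R * T =>
      cos (clamp uw.1 * X uw.2 + - (clamp uw.1 * x)))).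
    by solve_measurable.
  exists 1 => u; apply: le_trans (norm_weight_mul_le _ _) _.
  apply: norm_mean_le => [|w]; last exact: cos_max.
  by apply: bounded_mfun_fcos; solve_measurable.
- exact: bounded_mfun_integrable.
- by rewrite (le_trans (ler_norm _))// (le_trans (norm_weight_mul_le _ _))// cf_le// clamp01.
Qed.

Hypothesis iX : Rintegrable P X.

Let ixX : Rintegrable P (fun w => x - X w).
Proof.
have ix : Rintegrable P (fun _ : T => x) by exact/bounded_mfun_integrable/bounded_mfun_cst.
exact: (integrableB measurableT ix iX).
Qed.

Lemma integrable_sinc s : Rintegrable P (fun w => sinc s (x - X w)).
Proof.
apply: (@le_integrable _ _ _ P setT _ _ (EFin \o (fun w => x - X w))) => //.
- by apply/measurable_EFinP; apply: measurable_sinc => //; exact: measurable_cst.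
- by move=> w _; rewrite /= lee_fin norm_sinc_le.
Qed.

Lemma integrable_weight_sinc :
  Rintegrable (P \x unif01)%E (fun wu => wt (clamp wu.2) * sinc (clamp wu.2) (x - X wu.1)).
Proof.
set F := fun wu : T * measurableTypeR R => _.
have mF : measurable_fun setT F.
  apply: measurable_funM; first by apply: measurable_weight; exact: measurable_snd.
  by apply: measurable_sinc => //; apply: measurable_fclamp; exact: measurable_snd.
apply/integrable12ltyP; first exact/measurable_EFinP.
have /integrableP[_ ixX_fin] := ixX.
apply: (le_lt_trans _ ixX_fin); apply: ge0_le_integral => //.
- by move=> w _; apply: integral_ge0.
- apply: (measurable_fun_fubini_tonelli_F (m2 := unif01) (fun wu => (`|F wu|)%:E)) => //.
  by apply/measurable_EFinP; exact: measurableT_comp.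
- by apply/measurable_EFinP; exact: measurableT_comp.
move=> w _; rewrite -[leRHS]mule1 -(probability_setT unif01) -integral_cst//.
apply: ge0_le_integral => //.
- apply/measurable_EFinP; apply: measurableT_comp => //.
  by apply: (measurableT_comp mF); exact: pair1_measurable.
- by move=> u _; rewrite lee_fin (le_trans (norm_weight_mul_le _ _))// norm_sinc_le.
Qed.

Lemma mean_sine_transform : mean P (fun w => sine_transform (x - X w)) =
  mean unif01 (fun u => wt (clamp u) * mean P (fun w => sinc (clamp u) (x - X w))).
Proof.
have fubini := mean_fubini_integrable integrable_weight_sinc.
rewrite (_ : mean P _ = mean P (fun w => mean unif01 (fun u =>
  wt (clamp u) * sinc (clamp u) (x - X w))))// fubini /=.
- by congr (mean _ _); apply/funext => u; rewrite -meanZl//; exact: integrable_sinc.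
- by move=> w; exact/bounded_mfun_integrable/bounded_mfun_weight_sinc.
- move=> u; have [k kE] : exists k : R, k = wt (clamp u) by exists (wt (clamp u)).
  by rewrite /= -kE; exact: (integrableZl measurableT k (integrable_sinc (clamp u))).
Qed.

Lemma bounded_mfun_weight_mean_sinc :
  bounded_mfun (fun u : measurableTypeR R =>
    wt (clamp u) * mean P (fun w => sinc (clamp u) (x - X w))).
Proof.
split.
  apply: measurable_funM; first by apply: measurable_weight; exact: measurable_id.
  apply: (@measurable_mean _ _ _ _ _ P (fun uw : measurableTypeR R * T =>
    sinc (clamp uw.1) (x - X uw.2))).
  apply: measurable_sinc; first by solve_measurable.
  exact: measurableT_comp mxX measurable_snd.
exists (mean P (fun w => `|x - X w|)) => u.
apply: le_trans (norm_weight_mul_le _ _) _; apply: le_norm_mean => [||w].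
- exact: integrable_sinc.
- exact: integrable_norm_fun.
- exact: norm_sinc_le.
Qed.

Lemma mean_sinc s : s != 0 -> mean P (fun w => sinc s (x - X w)) =
  mean P (fun w => cos (s * X w + (pi / 2 - s * x))) / s.
Proof.
move=> s0; rewrite mulrC -meanZl; last first.
  by apply/bounded_mfun_integrable/bounded_mfun_fcos; solve_measurable.
congr (mean _ _); apply/funext => w; rewrite sincE// mulrC; congr (_ * _).
by rewrite -cosBpihalf -cosN; congr cos; ring.
Qed.
End expectations.

Lemma mean_sine_transform_sub_le d1 (T1 : measurableType d1) (P1 : probability T1 R) (X1 : T1 -> R)
    d2 (T2 : measurableType d2) (P2 : probability T2 R) (X2 : T2 -> R) D (x : R) :
  measurable_fun setT X1 -> Rintegrable P1 X1 -> measurable_fun setT X2 -> Rintegrable P2 X2 ->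
  bounded_mfun (fun u : measurableTypeR R => D (clamp u)) ->
  (forall s (th : R), 0 < s <= 1 -> `|mean P1 (fun w => cos (s * X1 w + th)) -
     mean P2 (fun w => cos (s * X2 w + th))| <= s * D s) ->
  `|mean P1 (fun w => sine_transform (x - X1 w)) - mean P2 (fun w => sine_transform (x - X2 w))| <=
  mean unif01 (fun u => D (clamp u)).
Proof.
move=> m1 i1 m2 i2 bD cfD.
have b1 := bounded_mfun_weight_mean_sinc m1 x i1; have b2 := bounded_mfun_weight_mean_sinc m2 x i2.
have bdiff := bounded_mfunD b1 (bounded_mfunN b2).
rewrite !mean_sine_transform// -meanB; [|exact: bounded_mfun_integrable..].
apply: le_trans (le_normr_Rintegral measurableT (bounded_mfun_integrable unif01 bdiff)) _.
apply: le_mean_unif01 => // [|u u01]; first exact: bounded_mfun_norm.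
have up : 0 < u by move: u01; lra.
rewrite (@clamp_id _ u); last by move: u01; lra.
have := norm_weight_mul_le u
  (mean P1 (fun w => sinc u (x - X1 w)) - mean P2 (fun w => sinc u (x - X2 w))).
rewrite clamp_id; last by move: u01; lra.
rewrite mulrBr => /le_trans; apply.
rewrite !mean_sinc ?gt_eqF// -mulrBl normrM normfV (gtr0_norm up) ler_pdivrMr// [leRHS]mulrC.
by apply: cfD; move: u01; lra.
Qed.
End weighted_transforms.

Section jackson_kernel.
Variable R : realType.
Implicit Types s z a b : R.
Local Notation unif01 := (unif01 R).

Lemma truncated_cube_itv a s : a <= 1 -> 0 <= s -> 0 <= Num.max (a - s) 0 ^+ 3 <= 1.
Proof.
move=> a1 s0; have m0 : 0 <= Num.max (a - s) 0 by rewrite le_max lexx orbT.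
by rewrite exprn_ge0//= exprn_ile1// ge_max ler01 andbT; lra.
Qed.

Lemma norm_truncated_cube_cos_le1 a s z : a <= 1 -> 0 <= s ->
  `|Num.max (a - s) 0 ^+ 3 * cos (s * z)| <= 1.
Proof.
move=> a1 s0; have /andP[c0 c1] := truncated_cube_itv a1 s0.
by rewrite normrM mulr_ile1 ?cos_max// ger0_norm.
Qed.

Lemma itv_integral_cube_cos a z : 0 <= a -> z != 0 ->
  itv_integral 0 a (fun s => (a - s) ^+ 3 * cos (s * z)) =
  6 * (cos (a * z) - 1 + (a * z) ^+ 2 / 2) / z ^+ 4.
Proof.
move=> a0 z0.
rewrite (@itv_integral_primitive _ 0 a (fun s => (a - s) ^+ 3 * sin (s * z) / z
   - 3 * (a - s) ^+ 2 * cos (s * z) / z ^+ 2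
   - 6 / z ^+ 2 * ((a - s) * sin (s * z) / z - cos (s * z) / z ^+ 2)) _
  (fun s => (a - s) ^+ 3 * cos (s * z)))//.
- by rewrite subrr !mul0r cos0 sin0; field.
- by move=> x _; derive_expr_eq; field.
Qed.

Lemma mean_truncated_cube_cos a z : 0 <= a <= 1 -> z != 0 ->
  mean unif01 (fun u => Num.max (a - clamp u) 0 ^+ 3 * cos (clamp u * z)) =
  6 * (cos (a * z) - 1 + (a * z) ^+ 2 / 2) / z ^+ 4.
Proof.
move=> /andP[a0 a1] z0; set f := fun s => Num.max (a - s) 0 ^+ 3 * cos (s * z).
have mf : measurable_fun setT f by solve_measurable.
have f_le1 s : 0 <= s -> `|f s| <= 1 by exact: norm_truncated_cube_cos_le1.
rewrite (@mean_unif01_clamp _ f)//; last by exists 1 => s /andP[s0 _]; exact: f_le1.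
rewrite (@itv_integral_cat _ 0 a 1)//; last 2 first.
- by rewrite a0.
- by exists 1 => s /andP[s0 _]; exact/f_le1/ltW.
rewrite (@eq_itv_integral _ 0 a _ (fun s => (a - s) ^+ 3 * cos (s * z))); last first.
  by move=> s s_itv; rewrite /f max_l//; lra.
rewrite (@eq_itv_integral _ a 1 _ (fun=> 0)); last first.
  by move=> s s_itv; rewrite /f max_r ?expr0n ?mul0r//; lra.
by rewrite itv_integral0 addr0 itv_integral_cube_cos.
Qed.

Lemma affine_interpolation_ge a b u : 0 <= u <= 1 -> Num.min a b <= a + (b - a) * u.
Proof.
by rewrite ge_min; have [?|?] := leP a b; move=> /andP[u0 u1]; apply/orP; [left | right]; nra.
Qed.

Lemma affine_interpolation_gt0 a b u : 0 < a -> 0 < b -> 0 <= u <= 1 -> 0 < a + (b - a) * u.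
Proof. by move=> a0 b0 u01; rewrite (lt_le_trans _ (affine_interpolation_ge a b u01))// lt_min a0. Qed.

Lemma bounded_mfun_inv_pow_affine n a b : 0 < a -> 0 < b ->
  bounded_mfun (fun u : measurableTypeR R => (a + (b - a) * clamp u) ^- n).
Proof.
move=> a0 b0; have interp_gt0 u := affine_interpolation_gt0 a0 b0 (clamp01 u).
have min_gt0 : 0 < Num.min a b by rewrite lt_min a0.
split; first by apply: measurable_invr_fun => [|u]; [solve_measurable | exact: exprn_gt0].
exists (Num.min a b ^- n) => u; rewrite ger0_norm ?invr_ge0 ?exprn_ge0 ?(ltW (interp_gt0 u))//.
rewrite lef_pV2 ?posrE ?exprn_gt0// lerXn2r ?nnegrE ?(ltW min_gt0) ?(ltW (interp_gt0 u))//.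
exact/affine_interpolation_ge/clamp01.
Qed.

Lemma mean_inv_pow_affine n a b : 0 < a -> 0 < b ->
  (b - a) * mean unif01 (fun u => (a + (b - a) * clamp u) ^- n.+2) =
  (a ^- n.+1 - b ^- n.+1) / n.+1%:R.
Proof.
move=> a0 b0; have bounded_inv := bounded_mfun_inv_pow_affine n.+2 a0 b0.
have interp_neq0 u : 0 <= u <= 1 -> a + (b - a) * u != 0.
  by move=> u01; rewrite gt_eqF// affine_interpolation_gt0.
rewrite -meanZl ?mean_unif01E; [|solve_bounded|solve_integrable].
rewrite (@itv_integral_primitive _ 0 1 (fun u => - (a + (b - a) * u) ^- n.+1 / n.+1%:R) _
  (fun u => (b - a) * (a + (b - a) * u) ^- n.+2) ler01).
- by rewrite mulr0 addr0 mulr1 subrKC; ring.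
- by move=> u u01; rewrite clamp_id//; move: u01; lra.
- move=> u /interp_neq0 l0; derive_expr_eq; first by rewrite expf_neq0.
  rewrite !exprS; have ln0 := expf_neq0 n l0; set q := _ ^+ n; rewrite -/q in ln0 *.
  by field; rewrite l0 ln0 nat1r pnatr_eq0.
- by move=> u /interp_neq0 l0; derivable_expr; rewrite expf_neq0.
Qed.

(* This weight makes [jackson] a multiple of the square of a Fejer kernel. *)
Definition jackson_weight s : R := Num.max (1 - s) 0 ^+ 3 - 4 * Num.max (1 / 2 - s) 0 ^+ 3.

Lemma jackson_weight01 s : 0 <= s <= 1 -> 0 <= jackson_weight s <= 1.
Proof.
move=> /andP[s0 s1].
have /andP[_ cube_le1] := truncated_cube_itv (lexx 1) s0.
have half_ge0 : 0 <= Num.max (1 / 2 - s) 0 by rewrite le_max lexx orbT.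
have : (2 * Num.max (1 / 2 - s) 0) ^+ 3 <= Num.max (1 - s) 0 ^+ 3.
  rewrite lerXn2r ?nnegrE ?mulr_ge0 ?le_max ?lexx ?orbT//.
  by case: (leP (1 / 2 - s) 0) => ?; rewrite ?mulr0 ?le_max ?lexx ?orbT//; apply/orP; left; lra.
rewrite exprMn /jackson_weight; have := exprn_ge0 3 half_ge0; lra.
Qed.

Lemma measurable_jackson_weight : measurable_fun setT jackson_weight.
Proof. by rewrite /jackson_weight; solve_measurable. Qed.

Let mwt := measurable_jackson_weight.
Let wt01 := jackson_weight01.

Definition jackson := cosine_transform jackson_weight.
Definition jackson_step := sine_transform jackson_weight.

Lemma jacksonE z : z != 0 -> jackson z = 12 * (1 - cos (z / 2)) ^+ 2 / z ^+ 4.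
Proof.
move=> z0.
have integrable_truncated a : a <= 1 -> Rintegrable unif01
    (fun u => Num.max (a - clamp u) 0 ^+ 3 * cos (clamp u * z)).
  move=> a1; apply: bounded_mfun_integrable; split; first by solve_measurable.
  by exists 1 => u; apply: norm_truncated_cube_cos_le1; rewrite ?clamp_ge0.
have half1 : 1 / 2 <= 1 :> R by lra.
transitivity (mean unif01 (fun u => Num.max (1 - clamp u) 0 ^+ 3 * cos (clamp u * z)) -
    4 * mean unif01 (fun u => Num.max (1 / 2 - clamp u) 0 ^+ 3 * cos (clamp u * z))).
  rewrite -meanZl; last exact: integrable_truncated.
  rewrite -meanB; last 2 first.
  - exact: integrable_truncated.
  - exact: (integrableZl _ _ (integrable_truncated _ half1)).
  by congr (mean _ _); apply/funext => u; rewrite /jackson_weight; ring.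
rewrite !mean_truncated_cube_cos//; last 2 first.
- by lra.
- by lra.
have -> : cos (1 * z) = 2 * cos (z / 2) ^+ 2 - 1.
  by rewrite mul1r [in LHS](splitr z) cosD -!expr2 sin2cos2; ring.
have -> : 1 / 2 * z = z / 2 by ring.
by field.
Qed.

Lemma jackson_ge0 z : 0 <= jackson z.
Proof.
have [->|z0] := eqVneq z 0; last first.
  by rewrite jacksonE// divr_ge0 ?exprn_even_ge0// mulr_ge0 ?sqr_ge0.
apply: mean_ge0 => u; rewrite mulr0 cos0 mulr1.
by have /andP[] := jackson_weight01 (clamp01 u).
Qed.

Lemma jackson_le z : 0 < z -> jackson z <= 48 / z ^+ 4.
Proof.
move=> z0; rewrite jacksonE ?gt_eqF// ler_pM2r ?invr_gt0 ?exprn_gt0//.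
by have := cos_geN1 (z / 2); have := cos_le1 (z / 2); nra.
Qed.

Lemma jackson_ge z : 0 < z <= 1 -> 3 / 64 <= jackson z.
Proof.
move=> /andP[z0 z1]; rewrite jacksonE ?gt_eqF// ler_pdivlMr ?exprn_gt0//.
have onem_cos_ge : z ^+ 2 / 16 <= 1 - cos (z / 2).
  have := norm_cos_taylor2_le (z / 2); rewrite ler_norml => /andP[_].
  have : z ^+ 4 <= z ^+ 2 by rewrite ler_wiXn2l// ltW.
  rewrite (ger0_norm (_ : 0 <= z / 2)) ?divr_ge0 ?(ltW z0)//.
  rewrite !expr_div_n. lra.
have : (z ^+ 2 / 16) ^+ 2 <= (1 - cos (z / 2)) ^+ 2.
  by rewrite lerXn2r// ?nnegrE ?(le_trans _ onem_cos_ge) ?divr_ge0 ?sqr_ge0.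
by rewrite expr_div_n -exprM; lra.
Qed.

Let bounded_jackson_affine a b :
  bounded_mfun (fun u : measurableTypeR R => jackson (a + b * clamp u)).
Proof. by apply: bounded_mfun_cosine_transform => //; solve_measurable. Qed.

Lemma jackson_step_nondecreasing : {homo jackson_step : a b / a <= b}.
Proof.
move=> a b ab; rewrite -subr_ge0 sine_transformB// mulr_ge0 ?subr_ge0//.
by apply: mean_ge0 => u; exact: jackson_ge0.
Qed.

Lemma jackson_stepN z : jackson_step (- z) = - jackson_step z.
Proof. exact: sine_transformN. Qed.

Lemma jackson_step0 : jackson_step 0 = 0.
Proof. by have := jackson_stepN 0; rewrite oppr0; lra. Qed.

Lemma jackson_step_ge0 z : 0 <= z -> 0 <= jackson_step z.
Proof. by move=> /jackson_step_nondecreasing; rewrite jackson_step0. Qed.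

Lemma jackson_stepB_le a b : 0 < a -> a <= b -> jackson_step b - jackson_step a <= 16 / a ^+ 3.
Proof.
move=> a0 ab; have b0 := lt_le_trans a0 ab; rewrite sine_transformB//.
have bounded_inv := bounded_mfun_inv_pow_affine 4 a0 b0.
apply: (@le_trans _ _ ((b - a) * (48 * mean unif01 (fun u => (a + (b - a) * clamp u) ^- 4)))).
  rewrite ler_wpM2l ?subr_ge0// -meanZl; last by solve_integrable.
  apply: le_mean => [||u]; last exact/jackson_le/affine_interpolation_gt0/clamp01.
  - exact/bounded_mfun_integrable/bounded_jackson_affine.
  - by solve_integrable.
rewrite mulrCA mean_inv_pow_affine//; have := exprn_gt0 3 b0; rewrite -invr_gt0; lra.
Qed.

Definition jackson_mass : R := limn (fun n => jackson_step n%:R).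

Lemma jackson_step_bounded z : jackson_step z <= jackson_step 1 + 16.
Proof.
have [z1|z1] := leP z 1; first by rewrite (le_trans (jackson_step_nondecreasing z1))// lerDl.
by rewrite -lerBlDl; have := jackson_stepB_le ltr01 (ltW z1); rewrite expr1n divr1.
Qed.

Lemma jackson_step_cvg : jackson_step n%:R @[n --> \oo] --> jackson_mass.
Proof.
apply: nondecreasing_is_cvgn => [m n mn|].
  by apply: jackson_step_nondecreasing; rewrite ler_nat.
by exists (jackson_step 1 + 16) => _ [n _ <-]; exact: jackson_step_bounded.
Qed.

Lemma jackson_step_le_mass z : jackson_step z <= jackson_mass.
Proof.
apply: limr_ge; first exact: cvgP jackson_step_cvg.
exists (Num.truncn z).+1; [by [] | move=> n /= zn]; apply: jackson_step_nondecreasing; apply: ltW.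
by rewrite (lt_le_trans (truncnS_gt z))// ler_nat.
Qed.

Lemma jackson_mass_le z : 0 < z -> jackson_mass <= jackson_step z + 16 / z ^+ 3.
Proof.
move=> z0; apply: limr_le; first exact: cvgP jackson_step_cvg.
exists (Num.truncn z).+1 => // n /= zn; rewrite -lerBlDl jackson_stepB_le//; apply: ltW.
by rewrite (lt_le_trans (truncnS_gt z))// ler_nat.
Qed.

Lemma jackson_mass_gt0 : 0 < jackson_mass.
Proof.
apply: (lt_le_trans _ (jackson_step_le_mass 1)).
have half_ge0 : 0 <= jackson_step (1 / 2) by apply: jackson_step_ge0; lra.
apply: (le_lt_trans half_ge0); rewrite -subr_gt0 sine_transformB//.
suff : 3 / 64 <= mean unif01 (fun u => jackson (1 / 2 + (1 - 1 / 2) * clamp u)).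
  by rewrite -/jackson; lra.
rewrite -[leLHS](mean_cst unif01); apply: le_mean => [||u].
- exact/bounded_mfun_integrable/bounded_mfun_cst.
- exact/bounded_mfun_integrable/bounded_jackson_affine.
- by apply: jackson_ge; have := clamp01 u; lra.
Qed.
End jackson_kernel.

Section fejer_kernel.
Variable R : realType.
Implicit Types s z : R.
Local Notation unif01 := (unif01 R).

Definition fejer_weight s : R := 1 - s.

Lemma fejer_weight01 s : 0 <= s <= 1 -> 0 <= fejer_weight s <= 1.
Proof. by rewrite /fejer_weight; lra. Qed.

Lemma measurable_fejer_weight : measurable_fun setT fejer_weight.
Proof. by rewrite /fejer_weight; solve_measurable. Qed.

Definition fejer := cosine_transform fejer_weight.

Lemma fejer_itv_integral z : fejer z = itv_integral 0 1 (fun s => (1 - s) * cos (s * z)).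
Proof.
rewrite -mean_unif01_clamp//; first by solve_measurable.
by exists 1 => s s01; rewrite normrM mulr_ile1 ?cos_max//; rewrite ger0_norm; lra.
Qed.

Lemma fejer0 : fejer 0 = 1 / 2.
Proof.
rewrite fejer_itv_integral.
rewrite (@itv_integral_primitive _ 0 1 (fun s => s - s ^+ 2 / 2) _ (fun s => 1 - s))//.
- by rewrite expr1n expr0n/=; field.
- by move=> s _; rewrite mulr0 cos0 mulr1.
- by move=> s _; derive_expr_eq; field.
Qed.

Lemma fejerE z : z != 0 -> fejer z = (1 - cos z) / z ^+ 2.
Proof.
move=> z0; rewrite fejer_itv_integral.
rewrite (@itv_integral_primitive _ 0 1 (fun s => (1 - s) * sin (s * z) / z - cos (s * z) / z ^+ 2)
  _ (fun s => (1 - s) * cos (s * z)))//.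
- by rewrite !mul0r !mul1r cos0 sin0; field.
- by move=> s _; derive_expr_eq; field.
Qed.

Lemma fejer_ge0 z : 0 <= fejer z.
Proof.
have [->|z0] := eqVneq z 0; first by rewrite fejer0; lra.
by rewrite fejerE// divr_ge0 ?sqr_ge0// subr_ge0 cos_le1.
Qed.

Lemma fejer_ge z : `|z| <= 1 / 2 -> 1 / 4 <= fejer z.
Proof.
have [->|z0] := eqVneq z 0; first by rewrite fejer0; lra.
move=> z_half; have z2 : 0 < z ^+ 2 by rewrite exprn_even_gt0.
have norm_z4 : `|z| ^+ 4 = (z ^+ 2) ^+ 2 by rewrite -normrX -exprM ger0_norm// exprn_even_ge0.
rewrite fejerE// ler_pdivlMr//; have := norm_cos_taylor2_le z.
rewrite ler_norml norm_z4 => /andP[_].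
have : z ^+ 2 <= 1 / 4.
  rewrite -(real_normK (num_real z)) (_ : 1 / 4 = (1 / 2) ^+ 2); last by field.
  by rewrite lerXn2r ?nnegrE//; lra.
by nra.
Qed.

(* The translate by pi compensates the zeros of fejer. *)
Lemma fejerD_shift_pi_ge z : 1 / 2 <= `|z| -> 2 / (81 * z ^+ 2) <= fejer z + fejer (z - pi).
Proof.
move=> z_half; have z0 : z != 0 by rewrite -normr_gt0; lra.
have z2 : 0 < z ^+ 2 by rewrite exprn_even_gt0.
have pi0 := pi_gt0 R; have pi4 : pi <= 4 :> R by have := pihalf_lt2 R; lra.
have [z_pi|z_pi] := eqVneq z pi.
  rewrite (le_trans _ (_ : fejer z <= _))//; last by rewrite lerDl fejer_ge0.
  by rewrite fejerE// [in cos z]z_pi cospi invfM mulrA ler_pM2r ?invr_gt0//; lra.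
rewrite fejerE// fejerE ?subr_eq0// cosB cospi sinpi mulr0 addr0 mulrN1 opprK.
have shift_le : (z - pi) ^+ 2 <= 81 * z ^+ 2.
  rewrite -(real_normK (num_real (z - pi))) -(real_normK (num_real z)).
  rewrite (_ : 81 * `|z| ^+ 2 = (9 * `|z|) ^+ 2); last by ring.
  by rewrite lerXn2r ?nnegrE ?mulr_ge0// (le_trans (ler_normB _ _))// (ger0_norm (ltW pi0)); lra.
have shift_gt0 : 0 < (z - pi) ^+ 2 by rewrite exprn_even_gt0//= subr_eq0.
have cos_itv : -1 <= cos z <= 1 by rewrite cos_geN1 cos_le1.
have z81 : 0 < 81 * z ^+ 2 by lra.
have -> : 2 / (81 * z ^+ 2) = (1 - cos z) / (81 * z ^+ 2) + (1 + cos z) / (81 * z ^+ 2) by ring.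
by apply: lerD; (apply: ler_wpM2l; first lra); rewrite lef_pV2 ?posrE//; lra.
Qed.
End fejer_kernel.

Section smoothing_inequality.
Variable R : realType.
Implicit Types (x z : R) (A D : R -> R).
Local Notation unif01 := (unif01 R).
Local Notation mass := (jackson_mass R).

Definition step_sign z : R := if 0 <= z then 1 else -1.

Definition step_sign_const : R := 4 * mass + 1296.

Lemma step_sign_const_gt0 : 0 < step_sign_const.
Proof. by have := jackson_mass_gt0 R; rewrite /step_sign_const; lra. Qed.

Lemma norm_step_sign_sub_jackson_step z :
  `|mass * step_sign z - jackson_step z| = mass - jackson_step `|z|.
Proof.
have mass_sub_ge0 y : 0 <= mass - jackson_step y by rewrite subr_ge0 jackson_step_le_mass.
rewrite /step_sign; case: leP => z0.
  by rewrite mulr1 (ger0_norm z0) (ger0_norm (mass_sub_ge0 _)).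
by rewrite mulrN1 (ltr0_norm z0) -(ger0_norm (mass_sub_ge0 _)) jackson_stepN opprK -opprD normrN.
Qed.

Lemma step_sign_approx z :
  `|mass * step_sign z - jackson_step z| <= step_sign_const * (fejer z + fejer (z - pi)).
Proof.
rewrite norm_step_sign_sub_jackson_step /step_sign_const.
have mass0 := jackson_mass_gt0 R; have f0 := fejer_ge0 z; have f1 := fejer_ge0 (z - pi).
have [z_small|z_large] := leP `|z| (1 / 2).
  have := fejer_ge z_small; have := jackson_step_ge0 (normr_ge0 z); nra.
have z0 : 0 < `|z| by lra.
have := fejerD_shift_pi_ge (ltW z_large); have := jackson_mass_le z0.
suff : 16 / `|z| ^+ 3 <= 1296 * (2 / (81 * z ^+ 2)) by nra.
have -> : 1296 * (2 / (81 * z ^+ 2)) = 32 * `|z| / `|z| ^+ 3.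
  by rewrite -(real_normK (num_real z)); field; rewrite gt_eqF.
by rewrite ler_pM2r ?invr_gt0 ?exprn_gt0//; lra.
Qed.

Section one_variable.
Context d (T : measurableType d) (P : probability T R) (X : T -> R).
Hypothesis mX : measurable_fun setT X.
Variable x : R.

Lemma measurable_le_cst : measurable [set w | X w <= x].
Proof.
by rewrite -[X in measurable X]setTI; apply: measurable_fun_ler => //; exact: measurable_cst.
Qed.

Lemma step_sign_indic : (fun w => step_sign (x - X w)) = (fun w => 2 * \1_[set w | X w <= x] w - 1).
Proof.
apply/funext => w; rewrite /step_sign subr_ge0 indicE; case: leP => h.
  by rewrite mem_set//= mulr1; lra.
by rewrite memNset ?mulr0 ?add0r//= leNgt h.
Qed.

Let bounded_indic : bounded_mfun (\1_[set w | X w <= x] : T -> R).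
Proof. exact/bounded_mfun_indic/measurable_le_cst. Qed.

Lemma mean_step_sign :
  mean P (fun w => step_sign (x - X w)) = 2 * fine (P [set w | X w <= x]) - 1.
Proof.
rewrite step_sign_indic meanB ?mean_cst ?meanZl ?mean_indic//; try by solve_integrable.
exact: measurable_le_cst.
Qed.

Lemma bounded_mfun_step_sign : bounded_mfun (fun w => step_sign (x - X w)).
Proof. by rewrite step_sign_indic; solve_bounded. Qed.

Lemma bounded_mfun_jackson_step : bounded_mfun (fun w => jackson_step (x - X w)).
Proof.
split.
  apply: (measurableT_comp (measurable_sine_transform (@measurable_jackson_weight R))).
  exact: measurable_funB.
exists mass => w; rewrite ler_norml jackson_step_le_mass andbT lerNl -jackson_stepN.
exact: jackson_step_le_mass.
Qed.
End one_variable.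

Lemma jackson_step_smoothing d (T : measurableType d) (P : probability T R) (X : T -> R) A x :
  measurable_fun setT X -> bounded_mfun (fun u : measurableTypeR R => A (clamp u)) ->
  (forall s (th : R), 0 <= s <= 1 -> `|mean P (fun w => cos (s * X w + th))| <= A s) ->
  `|mass * (2 * fine (P [set w | X w <= x]) - 1) - mean P (fun w => jackson_step (x - X w))| <=
  step_sign_const * 2 * mean unif01 (fun u => A (clamp u)).
Proof.
move=> mX bA cfA.
have bsign := bounded_mfun_step_sign mX x; have bstep := bounded_mfun_jackson_step mX x.
have bfejer y : bounded_mfun (fun w => fejer (y - X w)).
  apply: bounded_mfun_cosine_transform; [exact: measurable_fejer_weight | | exact: measurable_funB].
  exact: fejer_weight01.
have mean_fejer_le y : mean P (fun w => fejer (y - X w)) <= mean unif01 (fun u => A (clamp u)).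
  by apply: mean_cosine_transform_le => //; [exact: measurable_fejer_weight | exact: fejer_weight01].
have bfejer0 := bfejer x; have bfejer_pi := bfejer (x - pi).
rewrite -mean_step_sign// -meanZl; last by solve_integrable.
rewrite -meanB; [|solve_integrable..].
apply: (@le_trans _ _ (mean P (fun w =>
    step_sign_const * (fejer (x - X w) + fejer (x - pi - X w))))).
  apply: le_norm_mean => [||w]; [solve_integrable..|].
  by rewrite (addrAC x) step_sign_approx.
rewrite meanZl ?meanD; [|solve_integrable..].
rewrite -mulrA ler_wpM2l ?(ltW step_sign_const_gt0)// mulr_natl mulr2n.
by apply: lerD; exact: mean_fejer_le.
Qed.

(* Only s in [0, 1] matters, since both kernels have their Fourier transforms supported there. *)
Lemma smoothing d1 (T1 : measurableType d1) (P1 : probability T1 R) (X1 : T1 -> R)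
    d2 (T2 : measurableType d2) (P2 : probability T2 R) (X2 : T2 -> R) A D x :
  measurable_fun setT X1 -> Rintegrable P1 X1 -> measurable_fun setT X2 -> Rintegrable P2 X2 ->
  bounded_mfun (fun u : measurableTypeR R => A (clamp u)) ->
  bounded_mfun (fun u : measurableTypeR R => D (clamp u)) ->
  (forall s (th : R), 0 <= s <= 1 -> `|mean P1 (fun w => cos (s * X1 w + th))| <= A s) ->
  (forall s (th : R), 0 <= s <= 1 -> `|mean P2 (fun w => cos (s * X2 w + th))| <= A s) ->
  (forall s (th : R), 0 < s <= 1 -> `|mean P1 (fun w => cos (s * X1 w + th)) -
     mean P2 (fun w => cos (s * X2 w + th))| <= s * D s) ->
  2 * mass * `|fine (P1 [set w | X1 w <= x]) - fine (P2 [set w | X2 w <= x])| <=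
  step_sign_const * 4 * mean unif01 (fun u => A (clamp u)) + mean unif01 (fun u => D (clamp u)).
Proof.
move=> m1 i1 m2 i2 bA bD cf1 cf2 cfD; have mass0 := jackson_mass_gt0 R.
have := jackson_step_smoothing x m1 bA cf1; have := jackson_step_smoothing x m2 bA cf2.
have := mean_sine_transform_sub_le (@measurable_jackson_weight R) (@jackson_weight01 R) x
  m1 i1 m2 i2 bD cfD.
rewrite -/jackson_step; set p1 := fine (P1 _); set p2 := fine (P2 _).
set e1 := mean P1 _; set e2 := mean P2 _ => smooth_close close2 close1.
have -> : 2 * mass * `|p1 - p2| = `|2 * mass * (p1 - p2)|.
  by rewrite normrM (@ger0_norm _ (2 * mass))//; lra.
have -> : 2 * mass * (p1 - p2) = (mass * (2 * p1 - 1) - e1) - (mass * (2 * p2 - 1) - e2) + (e1 - e2).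
  by ring.
apply: le_trans (ler_normD _ _) _.
have := ler_normB (mass * (2 * p1 - 1) - e1) (mass * (2 * p2 - 1) - e2).
lra.
Qed.
End smoothing_inequality.

(** * The standard normal law *)

Section normal_integrals.
Variables (R : realType) (m s : R).
Implicit Types (A : set R) (f : R -> \bar R).
Local Notation leb := (@lebesgue_measure R).
Local Notation normal := (normal_prob m s : probability (measurableTypeR R) R).

Lemma ge0_integral_normal_prob A f : measurable A -> measurable_fun A f ->
  (forall x, 0 <= f x)%E ->
  (\int[normal]_(x in A) f x = \int[leb]_(x in A) (f x * (normal_pdf m s x)%:E))%E.
Proof.
move=> mA mf f0.
have dom : (normal : set (measurableTypeR R) -> \bar R) `<< leb by exact: normal_prob_dominates.
rewrite -(Radon_Nikodym_SigmaFinite.change_of_variables dom)//=.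
have iRN := Radon_Nikodym_SigmaFinite.f_integrable dom.
have mpdf : measurable_fun setT (normal_pdf m s) by exact: measurable_normal_pdf.
apply: ae_eq_integral => //.
- apply: emeasurable_funM => //; apply: (measurable_int leb).
  by apply: (integrableS _ _ (@subsetT _ _)) => //=.
- by apply: emeasurable_funM => //; apply/measurable_EFinP; exact/measurable_funTS.
- apply: ae_eqe_mul2l; apply: integral_ae_eq => //=.
  + exact: integrableS iRN.
  + by apply/measurable_EFinP; exact/measurable_funTS.
  + by move=> E E01 mE; rewrite -Radon_Nikodym_SigmaFinite.f_integral.
Qed.

Lemma maxe0_mul (x y : \bar R) : (0 <= y)%E -> (maxe x 0 * y = maxe (x * y) 0)%E.
Proof.
move=> y0; have [x0|x0] := leP x 0%E; first by rewrite mul0e max_r// mule_le0_ge0.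
by rewrite max_l// mule_ge0// ltW.
Qed.

Lemma integral_normal_prob A f : measurable A -> normal.-integrable A f ->
  (\int[normal]_(x in A) f x = \int[leb]_(x in A) (f x * (normal_pdf m s x)%:E))%E.
Proof.
move=> mA /integrableP[mf _]; rewrite integralE [RHS]integralE.
rewrite !ge0_integral_normal_prob//.
- congr (_ - _)%E; apply: eq_integral => x _.
    by rewrite !funeposE/= maxe0_mul// lee_fin normal_pdf_ge0.
  by rewrite !funenegE/= -mulNe maxe0_mul// lee_fin normal_pdf_ge0.
- exact: measurable_funeneg.
- exact: measurable_funepos.
Qed.

Lemma mean_normal_itv a b (f : R -> R) : measurable_fun setT f -> Rintegrable normal f ->
  mean normal (fun x => f x * \1_`]a, b[ x) = itv_integral a b (fun x => f x * normal_pdf m s x).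
Proof.
move=> mf iF; rewrite /mean /itv_integral /Rintegral; congr fine.
transitivity (\int[normal]_(x in `]a, b[) (f x)%:E)%E.
  rewrite [RHS]integral_mkcond; apply: eq_integral => x _.
  by rewrite patchE indicE; case: ifP => _; rewrite ?mulr1 ?mulr0.
have ifab : normal.-integrable `]a, b[ (EFin \o f) by exact: integrableS iF.
by have := @integral_normal_prob `]a, b[%classic (EFin \o f) _ ifab; move=> ->.
Qed.
End normal_integrals.

Lemma cvg_mul_indic_itv (R : realType) (f : R -> R) (b x : R) : 0 < b ->
  f x * \1_`]- (b * n%:R), (b * n%:R)[ x @[n --> \oo] --> f x.
Proof.
move=> b0; apply: cvg_near_cst; exists (Num.truncn (`|x| / b)).+1 => // n /= xn.
have : `|x| < b * n%:R.
  by rewrite mulrC -ltr_pdivrMr// (lt_le_trans (truncnS_gt _))// ler_nat.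
by rewrite ltr_norml => x_itv; rewrite indicE mem_set/= ?in_itv ?mulr1.
Qed.

Section standard_normal.
Variable R : realType.
Implicit Types (a b th x M : R) (F f : R -> R).
Local Notation leb := (@lebesgue_measure R).
Local Notation pdf := (normal_pdf (0 : R) 1).

Definition std_normal : probability (measurableTypeR R) R := normal_prob 0 1.

Lemma std_normal_pdfE x : pdf x = normal_peak 1 * expR (- (x ^+ 2 / 2)).
Proof. by rewrite normal_pdfE ?oner_neq0// /normal_fun subr0 expr1n mulNr. Qed.

Lemma std_normal_pdf_le x : pdf x <= expR (- (x ^+ 2 / 2)).
Proof.
rewrite std_normal_pdfE ler_piMl ?expR_ge0// /normal_peak invf_le1.
  by rewrite -[leLHS]sqrtr1 ler_wsqrtr// expr1n mul1r mulr2n; have := pi_ge2 R; lra.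
by rewrite sqrtr_gt0 expr1n mul1r mulrn_wgt0// pi_gt0.
Qed.

Lemma std_normal_pdf_le1 x : pdf x <= 1.
Proof.
rewrite (le_trans (std_normal_pdf_le x))// -[leRHS]expR0 ler_expR oppr_le0.
by rewrite divr_ge0 ?sqr_ge0.
Qed.

Lemma norm_mul_std_normal_pdf_le x :
  `|x| * pdf x <= normal_peak 1 / normal_peak (Num.sqrt 2) * normal_pdf 0 (Num.sqrt 2) x.
Proof.
have sqrt2_neq0 : Num.sqrt 2 != 0 :> R by rewrite gt_eqF// sqrtr_gt0.
have peak0 : 0 < normal_peak (Num.sqrt 2) :> R by exact: normal_peak_gt0.
rewrite std_normal_pdfE normal_pdfE// mulrA divfK ?gt_eqF// mulrCA.
rewrite ler_wpM2l ?normal_peak_ge0// /normal_fun subr0 sqr_sqrtr//.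
have -> : expR (- (x ^+ 2 / 2)) = expR (- x ^+ 2 / (2 *+ 2)) / expR (x ^+ 2 / 4) :> R.
  by rewrite -expRN -expRD; congr expR; field.
rewrite mulrA ler_pdivrMr ?expR_gt0// mulrC ler_pM2l ?expR_gt0//.
apply: le_trans (expR_ge1Dx _).
by have := sqr_ge0 (`|x| / 2 - 1); rewrite sqrrB expr_div_n real_normK ?num_real// expr1n; lra.
Qed.

Lemma integrable_std_normal_id : Rintegrable std_normal (fun x : R => x).
Proof.
have mpdf s : measurable_fun setT (normal_pdf (0 : R) s) by exact: measurable_normal_pdf.
apply/integrableP; split; first by apply/measurable_EFinP; exact: measurable_id.
rewrite ge0_integral_normal_prob//; last first.
  by apply: measurableT_comp => //; apply/measurable_EFinP; exact: measurable_id.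
pose c : R := normal_peak 1 / normal_peak (Num.sqrt 2).
have : (leb.-integrable setT (fun x => c%:E * (normal_pdf 0 (Num.sqrt 2) x)%:E))%E.
  by apply: integrableZl => //; exact: integrable_normal_pdf.
move=> /integrableP[_]; apply: le_lt_trans; apply: ge0_le_integral => //.
- by move=> x _; rewrite mule_ge0 ?lee_fin ?normal_pdf_ge0.
- by apply/measurable_EFinP; apply: measurable_funM; [exact: normr_measurable | exact: mpdf].
- by apply: measurableT_comp => //; apply/measurable_EFinP; apply: measurable_funM => //; exact: mpdf.
- move=> x _ /=; rewrite -!EFinM lee_fin (le_trans _ (ler_norm _))//.
  exact: norm_mul_std_normal_pdf_le.
Qed.

Lemma integrable_std_normal_id_mul f : bounded_mfun (f : measurableTypeR R -> R) ->
  Rintegrable std_normal (fun x => x * f x).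
Proof.
move=> [mf [M fM]]; have iM := integrableZl measurableT M integrable_std_normal_id.
apply: (le_integrable _ _ _ iM) => //.
  by apply/measurable_EFinP; apply: measurable_funM => //; exact: measurable_id.
move=> x _; rewrite /= lee_fin !normrM mulrC ler_wpM2r//.
exact: le_trans (fM x) (ler_norm _).
Qed.

(* [- F * pdf] is a primitive of [fun x => (x * F x - f x) * pdf x]. *)
Lemma norm_itv_integral_stein_le F f (f' : R -> R) b M : 0 <= b ->
  (forall x, has_derive F x (f x)) -> (forall x, has_derive f x (f' x)) ->
  (forall x, `|F x| <= M) ->
  `|itv_integral (- b) b (fun x => (x * F x - f x) * pdf x)| <=
  normal_peak 1 * (2 * M * expR (- (b ^+ 2 / 2))).
Proof.
move=> b0 dF df FM; have le_b : - b <= b by lra.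
rewrite (@itv_integral_primitive _ _ _ (fun x => normal_peak 1 * (- F x * expR (- (x ^+ 2 / 2)))) _
  (fun x => normal_peak 1 * ((x * F x - f x) * expR (- (x ^+ 2 / 2)))) le_b).
- rewrite sqrrN -mulrBr -mulrBl normrM (ger0_norm (normal_peak_ge0 _)).
  rewrite ler_wpM2l ?normal_peak_ge0// normrM (ger0_norm (expR_ge0 _)) ler_wpM2r ?expR_ge0//.
  by have := ler_normB (- F b) (- F (- b)); have := FM b; have := FM (- b); rewrite !normrN; lra.
- by move=> x _; rewrite std_normal_pdfE mulrCA.
- by move=> x _; derive_expr_eq; [exact: dF | field].
- by move=> x _; derivable_expr; [exact: dF | exact: df].
Qed.

Lemma mean_std_normal_stein F f (f' : R -> R) :
  (forall x, has_derive F x (f x)) -> (forall x, has_derive f x (f' x)) ->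
  bounded_mfun (F : measurableTypeR R -> R) -> bounded_mfun (f : measurableTypeR R -> R) ->
  mean std_normal (fun x => x * F x) = mean std_normal f.
Proof.
move=> dF df bF bf; pose h x := x * F x - f x.
have ixF := integrable_std_normal_id_mul bF; have i_f := bounded_mfun_integrable std_normal bf.
have ih : Rintegrable std_normal h by exact: (integrableB measurableT ixF i_f).
have mh : measurable_fun setT h by move: bF bf => [mF _] [mf _]; solve_measurable.
apply: subr0_eq; rewrite -meanB//; pose r : R := Num.sqrt 2; have r0 : 0 < r by rewrite sqrtr_gt0.
pose hn n x : R := h x * \1_`]- (r * n%:R), (r * n%:R)[ x.
have hn_cvg : mean std_normal (hn n) @[n --> \oo] --> mean std_normal h.
  apply: (@mean_cvg_dominated _ _ _ std_normal hn h (fun x => `|h x|)).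
  - by move=> n; apply: measurable_funM => //; exact: measurable_indic.
  - exact: integrable_norm_fun.
  - by move=> n x; rewrite normrM ler_piMr// indicE; case: (_ \in _); rewrite ?normr1 ?normr0.
  - by move=> x; exact: cvg_mul_indic_itv.
have [_ [M FM]] := bF; pose bound n : R := normal_peak 1 * (2 * M * expR (- n%:R ^+ 2)).
have bound_cvg : bound n @[n --> \oo] --> (0 : R).
  rewrite (_ : 0 = normal_peak 1 * (2 * M * 0) :> R); last by rewrite !mulr0.
  apply: cvgZr => //; apply: cvgZr => //; exact: (cvg_comp _ _ (@cvgr_idn R) (@cvg_gauss_fun R)).
suff hn_cvg0 : mean std_normal (hn n) @[n --> \oo] --> (0 : R) by exact: (cvg_unique _ hn_cvg).
apply/norm_cvg0P; apply: (squeeze_cvgr _ _ bound_cvg); last exact: cvg_cst.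
apply: nearW => n; rewrite normr_ge0/= /hn mean_normal_itv//.
have rn0 : 0 <= r * n%:R by rewrite mulr_ge0 ?(ltW r0).
apply: le_trans (norm_itv_integral_stein_le rn0 dF df FM) _.
by rewrite (_ : (r * n%:R) ^+ 2 / 2 = n%:R ^+ 2)// exprMn sqr_sqrtr//; field.
Qed.

Lemma mean_std_normal_sin a th :
  mean std_normal (fun x => x * sin (a * x + th)) = a * mean std_normal (fun x => cos (a * x + th)).
Proof.
have bsin : bounded_mfun (fun x : measurableTypeR R => sin (a * x + th)).
  by split; [solve_measurable | exists 1 => x; exact: sin_max].
have bcos : bounded_mfun (fun x : measurableTypeR R => cos (a * x + th)).
  by apply: bounded_mfun_fcos; solve_measurable.
rewrite -meanZl; last by solve_integrable.
apply: (@mean_std_normal_stein _ _ (fun x => - (a ^+ 2 * sin (a * x + th)))) => //.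
- by move=> x; derive_expr_eq; ring.
- by move=> x; derive_expr_eq; ring.
- by solve_bounded.
Qed.

Lemma has_derive_mean_std_normal_cos a th :
  has_derive (fun b => mean std_normal (fun x => cos (b * x + th))) a
    (- (a * mean std_normal (fun x => cos (a * x + th)))).
Proof.
have derive_cos b x : ((fun b => cos (b * x + th))^`() b = - (x * sin (b * x + th)))%classic.
  by rewrite derive1E; apply: derive_val; derive_expr_eq; ring.
have a_itv : `]a - 1, a + 1[%classic a by rewrite /= in_itv/=; lra.
have icos b : Rintegrable std_normal (fun x : R => cos (b * x + th)).
  by apply/bounded_mfun_integrable/bounded_mfun_fcos; solve_measurable.
have dcos b (x : R) : derivable (fun b : R => cos (b * x + th) : R) b 1 by derivable_expr.
have inorm : Rintegrable std_normal (fun x : R => `|x|).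
  exact/integrable_norm_fun/integrable_std_normal_id.
have derive_le b (x : R) : `|partial1of2 (fun b x => cos (b * x + th)) b x| <= `|x|.
  by rewrite /partial1of2 derive_cos normrN normrM ler_piMr// sin_max.
have D := @derivable_under_integral R _ _ std_normal _ setT measurableT a _ _ a_itv
  (fun b _ => icos b) (fun b x _ _ => dcos b x) _ (fun x => normr_ge0 x) inorm
  (fun b x _ _ => derive_le b x).
have E := @differentiation_under_integral R _ _ std_normal _ setT measurableT a _ _ a_itv
  (fun b _ => icos b) (fun b x _ _ => dcos b x) _ (fun x => normr_ge0 x) inorm
  (fun b x _ _ => derive_le b x).
apply: (@DeriveDef _ _ _ _ _ _ _ D); rewrite -derive1E E -mean_std_normal_sin -meanN.
  by congr (mean _ _); apply/funext => x; rewrite /partial1of2 derive_cos.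
apply: integrable_std_normal_id_mul; split; first by solve_measurable.
by exists 1 => x; exact: sin_max.
Qed.

Lemma mean_std_normal_cos a th :
  mean std_normal (fun x => cos (a * x + th)) = cos th * expR (- (a ^+ 2 / 2)).
Proof.
pose F b := mean std_normal (fun x => cos (b * x + th)) * expR (b ^+ 2 / 2).
have : `|F a - F 0| <= 0 * `|a|.
  apply: (norm_sub0_le_derive (f' := fun=> 0)) => [b _|b _]; last by rewrite normr0.
  apply: eq_has_derive.
    by apply: has_deriveM; [exact: has_derive_mean_std_normal_cos | derive_expr].
  by rewrite /=; field.
rewrite mul0r normr_le0 subr_eq0 => /eqP; rewrite /F expr0n/= mul0r expR0 mulr1.
have -> : mean std_normal (fun x => cos (0 * x + th)) = cos th.
  by rewrite -[RHS](mean_cst std_normal); congr (mean _ _); apply/funext => x; rewrite mul0r add0r.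
by move=> <-; rewrite -mulrA -expRD subrr expR0 mulr1.
Qed.
End standard_normal.

(** * Normal approximation of the splitting time *)

Section gaussian_means.
Variable R : realType.
Implicit Types (u c L : R) (f : R -> R).
Local Notation unif01 := (unif01 R).

Lemma gauss_le_inv_sqr u : 0 <= u -> expR (- u ^+ 2) <= 2 * (1 + u) ^- 2.
Proof.
move=> u0; rewrite expRN -[_ ^- 2]/((_ ^+ 2)^-1) ler_pdivlMr ?exprn_gt0//; last lra.
rewrite mulrC ler_pdivrMr ?expR_gt0//.
by have := expR_ge1Dx (u ^+ 2); have := sqr_ge0 (u - 1); rewrite sqrrB sqrrD !expr1n; lra.
Qed.

Lemma sqr_gauss_le_inv_sqr u : 0 <= u -> u ^+ 2 * expR (- u ^+ 2) <= 6 * (1 + u) ^- 2.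
Proof.
move=> u0; rewrite expRN -[_ ^- 2]/((_ ^+ 2)^-1) ler_pdivlMr ?exprn_gt0//; last lra.
rewrite mulrAC ler_pdivrMr ?expR_gt0//.
have expR_ge_sqr : (u ^+ 2) ^+ 2 / 2 <= expR (u ^+ 2).
  by have := @expR_ge1Dxn R _ 1 (sqr_ge0 u); rewrite (_ : 2`!%:R = 2 :> R)//; lra.
have : u ^+ 2 * (1 + u) ^+ 2 <= u ^+ 2 * (2 + 2 * u ^+ 2).
  by rewrite ler_wpM2l ?sqr_ge0//; have := sqr_ge0 (u - 1); rewrite sqrrB sqrrD !expr1n; lra.
by have := expR_ge1Dx (u ^+ 2); have := sqr_ge0 u; lra.
Qed.

Lemma bounded_mfun_mul_gauss L k :
  bounded_mfun (fun u : measurableTypeR R => (L * clamp u) ^+ k * expR (- (L * clamp u) ^+ 2)).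
Proof.
split.
  apply: measurable_funM; first by solve_measurable.
  by apply: (measurableT_comp (f := expR)) => //; solve_measurable.
exists (`|L| ^+ k) => u; rewrite normrM -[leRHS]mulr1 ler_pM//.
  by rewrite normrX lerXn2r ?nnegrE// normrM ler_piMr// ger0_norm ?clamp_ge0 ?clamp_le1.
by rewrite ger0_norm ?expR_ge0// -[leRHS]expR0 ler_expR oppr_le0 sqr_ge0.
Qed.

Lemma bounded_mfun_gauss L :
  bounded_mfun (fun u : measurableTypeR R => expR (- (L * clamp u) ^+ 2)).
Proof. by have := bounded_mfun_mul_gauss L 0; under eq_fun do rewrite expr0 mul1r. Qed.

Lemma mean_dilation_le f c L : 0 <= c -> 0 < L ->
  bounded_mfun (fun u : measurableTypeR R => f (L * clamp u)) ->
  (forall u, 0 <= u -> f u <= c * (1 + u) ^- 2) ->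
  mean unif01 (fun u => f (L * clamp u)) <= c / L.
Proof.
move=> c0 L0 bf f_le; have L1 : 0 < 1 + L by lra.
have := mean_inv_pow_affine 0 ltr01 L1; have := bounded_mfun_inv_pow_affine 2 ltr01 L1.
rewrite (_ : 1 + L - 1 = L) => [bsqr|]; last by ring.
rewrite !expr1 invr1 mulr1 => mean_sqr.
apply: (@le_trans _ _ (mean unif01 (fun u => c * (1 + L * clamp u) ^- 2))).
  apply: le_mean => [||u]; [by solve_integrable..|].
  by apply: f_le; rewrite mulr_ge0 ?clamp_ge0// ltW.
rewrite meanZl; last by solve_integrable.
rewrite ler_wpM2l// -[leRHS]mul1r ler_pdivlMr// mulrC mean_sqr gerBl.
by rewrite invr_ge0 ltW.
Qed.

Lemma mean_gauss_le L : 0 < L -> mean unif01 (fun u => expR (- (L * clamp u) ^+ 2)) <= 2 / L.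
Proof.
by move=> L0; apply: (mean_dilation_le (f := fun u => expR (- u ^+ 2))) => //;
  [exact: bounded_mfun_gauss | exact: gauss_le_inv_sqr].
Qed.

Lemma mean_sqr_gauss_le L : 0 < L ->
  mean unif01 (fun u => (L * clamp u) ^+ 2 * expR (- (L * clamp u) ^+ 2)) <= 6 / L.
Proof.
by move=> L0; apply: (mean_dilation_le (f := fun u => u ^+ 2 * expR (- u ^+ 2))) => //;
  [exact: bounded_mfun_mul_gauss | exact: sqr_gauss_le_inv_sqr].
Qed.
End gaussian_means.

Section normal_approximation.
Context d (T : measurableType d) (R : realType) (P : probability T R) (X : T -> R).
Hypothesis mX : measurable_fun setT X.
Hypothesis iX : Rintegrable P X.
Variables b s1 M : R.
Hypotheses (b0 : 0 < b) (s10 : 0 < s1).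
Hypothesis cf_le : forall s th, 0 <= s <= s1 ->
  `|mean P (fun w => cos (s * X w + th))| <= expR (- ((b * s) ^+ 2 / 4)).
Hypothesis cf_approx : forall s th, 0 <= s <= s1 ->
  `|mean P (fun w => cos (s * X w + th)) - cos th * expR (- ((b * s) ^+ 2 / 2))| <=
  M * s ^+ 3 * expR (- ((b * s) ^+ 2 / 4)).
Local Notation mass := (jackson_mass R).
Local Notation unif01 := (unif01 R).

(* The smoothing inequality only sees frequencies at most 1, hence the dilation by [s1]. *)
Let L := s1 * b / 2.
Let A s := expR (- (L * s) ^+ 2).
Let D s := 4 * M * s1 / b ^+ 2 * ((L * s) ^+ 2 * expR (- (L * s) ^+ 2)).

Let L0 : 0 < L. Proof. by rewrite divr_gt0 ?mulr_gt0. Qed.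

Let sqrL s : (b * (s * s1)) ^+ 2 / 4 = (L * s) ^+ 2.
Proof. by rewrite /L; field. Qed.

Let dilate_itv s : 0 <= s <= 1 -> 0 <= s * s1 <= s1.
Proof. by move=> /andP[? ?]; rewrite mulr_ge0 ?ler_piMl// ltW. Qed.

Let mean_cos_dilated s th :
  mean P (fun w => cos (s * (s1 * X w) + th)) = mean P (fun w => cos (s * s1 * X w + th)).
Proof. by congr (mean _ _); apply/funext => w; rewrite mulrA. Qed.

Let mean_cos_normal_dilated s th : mean (std_normal R) (fun g => cos (s * (s1 * b * g) + th)) =
  cos th * expR (- ((b * (s * s1)) ^+ 2 / 2)).
Proof.
under [in LHS]eq_fun do rewrite !mulrA.
by rewrite mean_std_normal_cos [b * _]mulrC.
Qed.

Lemma normal_approximation_dilated x :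
  2 * mass * `|fine (P [set w | s1 * X w <= s1 * x]) -
               fine (std_normal R [set g | s1 * b * g <= s1 * x])| <=
  step_sign_const R * 4 * mean unif01 (fun u => A (clamp u)) + mean unif01 (fun u => D (clamp u)).
Proof.
apply: (@smoothing R _ T P (fun w => s1 * X w) _ _ (std_normal R) (fun g => s1 * b * g)) => //.
- exact: measurable_funM.
- exact: (integrableZl measurableT s1 iX).
- exact: measurable_funM.
- exact: (integrableZl measurableT (s1 * b) (integrable_std_normal_id R)).
- exact: bounded_mfun_gauss.
- by apply: bounded_mfunM; [exact: bounded_mfun_cst | exact: bounded_mfun_mul_gauss].
- by move=> s th s01; rewrite mean_cos_dilated /A -sqrL cf_le// dilate_itv.
- move=> s th s01; rewrite mean_cos_normal_dilated normrM (ger0_norm (expR_ge0 _)).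
  rewrite (@le_trans _ _ (expR (- ((b * (s * s1)) ^+ 2 / 2))))//.
    by rewrite ler_piMl ?expR_ge0 ?cos_max.
  by rewrite /A -sqrL ler_expR; have := sqr_ge0 (b * (s * s1)); lra.
- move=> s th /andP[s0 s_le1]; rewrite mean_cos_dilated mean_cos_normal_dilated.
  apply: le_trans (cf_approx _ (dilate_itv _)) _; first by rewrite ltW.
  rewrite /D sqrL !mulrA ler_wpM2r ?expR_ge0// /L eq_ler//.
  by field; rewrite gt_eqF.
Qed.

Lemma normal_approximation x :
  `|fine (P [set w | X w <= x]) - fine (std_normal R [set g | b * g <= x])| <=
  (8 * step_sign_const R / (s1 * b) + 24 * M / b ^+ 3) / mass.
Proof.
have mass0 := jackson_mass_gt0 R; have const0 := step_sign_const_gt0 R.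
have -> : [set w | X w <= x] = [set w | s1 * X w <= s1 * x].
  by apply/seteqP; split => w /=; rewrite ler_pM2l.
have -> : [set g : R | b * g <= x] = [set g | s1 * b * g <= s1 * x].
  by apply/seteqP; split => g /=; rewrite -mulrA ler_pM2l.
rewrite ler_pdivlMr// mulrC -(ler_pM2l (ltr0n R 2)) mulrA.
apply: le_trans (normal_approximation_dilated x) _.
have M0 : 0 <= M.
  have s1_itv : 0 <= s1 <= s1 by rewrite lexx ltW.
  have := le_trans (normr_ge0 _) (cf_approx 0 s1_itv).
  by rewrite pmulr_lge0 ?expR_gt0// pmulr_lge0// exprn_gt0.
rewrite meanZl; last exact/bounded_mfun_integrable/bounded_mfun_mul_gauss.
have -> : 2 * (8 * step_sign_const R / (s1 * b) + 24 * M / b ^+ 3) =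
    step_sign_const R * 4 * (2 / L) + 4 * M * s1 / b ^+ 2 * (6 / L).
  by rewrite /L; field; rewrite !gt_eqF.
apply: lerD; apply: ler_wpM2l.
- by rewrite mulr_ge0// ltW.
- exact: mean_gauss_le.
- by rewrite divr_ge0 ?sqr_ge0// !mulr_ge0// ltW.
- exact: mean_sqr_gauss_le.
Qed.
End normal_approximation.

Section berry_esseen.
Context d (T : measurableType d) (R : realType) (P : probability T R)
  (U : nat -> {RV P >-> R}).
Hypothesis indU : mutually_independent U.
Hypothesis lawU : forall k (A : set R), measurable A ->
     distribution P (U k) A = uniform_prob (@ltr01 R) A.
Implicit Types (t s th q : R) (z : R[i]).
Local Notation v := (var_rate R).

Lemma norm_Re_cis_mul_le th z q : normc (z - 1) <= q -> `|Re (cis th * z)| <= 1 + q.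
Proof.
move=> z_le; rewrite (le_trans (norm_Re_le _))// ComplexField.Normc.normcM normc_cis mul1r.
rewrite -[z](subrK 1) (le_trans (normc_leD _ _))// addrC.
by rewrite ComplexField.Normc.normc1 lerD2l.
Qed.

Lemma norm_Re_cis_mul_sub_cos_le th z q : normc (z - 1) <= q -> `|Re (cis th * z) - cos th| <= q.
Proof.
move=> z_le; have -> : Re (cis th * z) - cos th = Re (cis th * (z - 1)).
  by rewrite mulrBr mulr1 ReD ReN.
by rewrite (le_trans (norm_Re_le _))// ComplexField.Normc.normcM normc_cis mul1r.
Qed.

Lemma mean_cos_centered_tau t s th : 0 < t -> mean P (fun w => cos (s * centered_tau U t w + th)) =
  expR (- (v * s ^+ 2 / 2 / t)) * Re (cis th * fixpt s (1 / t)).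
Proof.
move=> t0; rewrite -Re_realM mulrCA -(cmean_cis_centered_tau indU lawU t0) -cmeanZl.
  by congr (mean _ _); apply/funext => w; rewrite cosD ReM/=; ring.
exact: bounded_cfun_cis_tau.
Qed.

Lemma centered_tau_cf : exists s1 K : R, [/\ 0 < s1, 0 < K &
  forall t s th, 0 < t <= 1 / 2 -> 0 <= s <= s1 ->
  `|mean P (fun w => cos (s * centered_tau U t w + th))| <= expR (- (v * s ^+ 2 / t / 4)) /\
  `|mean P (fun w => cos (s * centered_tau U t w + th)) - cos th * expR (- (v * s ^+ 2 / t / 2))| <=
   K / t * s ^+ 3 * expR (- (v * s ^+ 2 / t / 4))].
Proof.
have [s0 [K [s00 K0 tail]]] := fixpt_tail R; have v0 := var_rate_gt0 R.
exists (Num.min s0 (v / (4 * K))), K; split => //.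
  by rewrite lt_min s00 divr_gt0// mulr_gt0.
move=> t s th /andP[t0 t_half] /andP[s_ge0]; rewrite le_min => /andP[s_le sK].
have y2 : 2 <= 1 / t by rewrite ler_pdivlMr//; lra.
have := tail s; rewrite (ger0_norm s_ge0) => /(_ s_le (1 / t) y2).
rewrite mulrA mulr1; set q := K * s ^+ 3 / t => fixpt_sub1_le.
rewrite mean_cos_centered_tau// (mulrAC _ 2^-1); set a := v * s ^+ 2 / t.
have q0 : 0 <= q by rewrite divr_ge0 ?mulr_ge0 ?exprn_ge0 ?(ltW K0) ?(ltW t0).
have q_le : q <= a / 4.
  have Ks_le : K * s <= v / 4 by move: sK; rewrite ler_pdivlMr ?mulr_gt0//; lra.
  have -> : q = K * s * (s ^+ 2 / t) by rewrite /q exprS !mulrA.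
  have -> : a / 4 = v / 4 * (s ^+ 2 / t) by rewrite /a; field; rewrite gt_eqF.
  by rewrite ler_wpM2r// divr_ge0 ?sqr_ge0// ltW.
have gauss_growth : expR (- (a / 2)) * expR q <= expR (- (a / 4)).
  by rewrite -expRD ler_expR; lra.
split.
  rewrite normrM (ger0_norm (expR_ge0 _)) (le_trans _ gauss_growth)// ler_pM2l ?expR_gt0//.
  by have := norm_Re_cis_mul_le th fixpt_sub1_le; rewrite subrKC.
rewrite [cos th * _]mulrC -mulrBr normrM (ger0_norm (expR_ge0 _)) (mulrAC K) -/q.
apply: (@le_trans _ _ (expR (- (a / 2)) * (q * expR q))); last by rewrite mulrCA ler_wpM2l.
rewrite ler_pM2l ?expR_gt0// (le_trans _ (expR_sub1_le q))//.
exact: norm_Re_cis_mul_sub_cos_le.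
Qed.

Lemma berry_esseen_centered_tau : exists2 C : R, 0 <= C & forall t x : R, 0 < t <= 1 / 2 ->
  `|fine (P [set w | centered_tau U t w <= x]) -
    fine (std_normal R [set g | Num.sqrt (v / t) * g <= x])| <= C * Num.sqrt t.
Proof.
have [s1 [K [s10 K0 cf]]] := centered_tau_cf; have v0 := var_rate_gt0 R.
have mass0 := jackson_mass_gt0 R; have const0 := step_sign_const_gt0 R.
have sqrtv0 : 0 < Num.sqrt v by rewrite sqrtr_gt0.
exists ((8 * step_sign_const R / s1 + 24 * K / v) / (jackson_mass R * Num.sqrt v)).
  by rewrite divr_ge0 ?addr_ge0 ?divr_ge0 ?mulr_ge0 ?sqrtr_ge0 ?(ltW s10) ?(ltW const0)
    ?(ltW mass0) ?(ltW K0) ?(ltW v0).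
move=> t x t_itv; have t0 : 0 < t by move: t_itv; lra.
have sqrtt0 : 0 < Num.sqrt t by rewrite sqrtr_gt0.
have bE : Num.sqrt (v / t) = Num.sqrt v / Num.sqrt t by rewrite sqrtrM ?sqrtrV// ltW.
have sqrb s : (Num.sqrt (v / t) * s) ^+ 2 = v * s ^+ 2 / t.
  by rewrite exprMn sqr_sqrtr ?divr_ge0 ?ltW// mulrAC.
have b0 : 0 < Num.sqrt (v / t) by rewrite sqrtr_gt0 divr_gt0.
have mtau := measurable_centered_tau U t; have itau := integrable_centered_tau indU lawU t0.
apply: le_trans (normal_approximation mtau itau (s1 := s1) (M := K / t) b0 s10 _ _ x) _.
- by move=> s th s_itv; rewrite sqrb; have [] := cf t s th t_itv s_itv.
- by move=> s th s_itv; rewrite sqrb; have [] := cf t s th t_itv s_itv.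
have -> : K / t = K / Num.sqrt t ^+ 2 by rewrite sqr_sqrtr// ltW.
have -> : 24 * K / v = 24 * K / Num.sqrt v ^+ 2 by rewrite sqr_sqrtr// ltW.
by rewrite bE; apply: eq_ler; field; rewrite !gt_eqF.
Qed.
End berry_esseen.

(** * The distribution function of the normal law *)

Section normal_cdf.
Variable R : realType.
Implicit Types (a b c r t x y z M e : R).
Local Notation pdf := (normal_pdf (0 : R) 1).
Local Notation gauss := (std_normal R).

Let gauss_fin_num (A : set R) : measurable A -> gauss A \is a fin_num.
Proof. by move=> mA; exact: fin_num_measure. Qed.

Lemma std_normal_scaled_le b x : 0 < b -> fine (gauss [set g : R | b * g <= x]) = Phi (x / b).
Proof.
move=> b0; congr (fine (gauss _)); apply/seteqP; split => g /=; rewrite in_itv/=;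
by rewrite ler_pdivlMr// mulrC.
Qed.

Lemma Phi_le1 x : Phi x <= 1.
Proof. by rewrite -lee_fin fineK ?gauss_fin_num//; exact: probability_le1. Qed.

Lemma Phi_ge0 x : 0 <= Phi x.
Proof. exact: fine_ge0. Qed.

Lemma PhiB_itv a b M : a <= b -> (forall z, a <= z <= b -> pdf z <= M) ->
  0 <= Phi b - Phi a <= M * (b - a).
Proof.
move=> ab pdf_le.
have Phi_split : gauss `]-oo, b]%classic = (gauss `]-oo, a]%classic + gauss `]a, b]%classic)%E.
  rewrite -measureU//.
    congr (gauss _); apply/seteqP; split => z /=; rewrite !in_itv/=.
      by move=> zb; case: (leP z a) => za; [left|right].
    by move=> [/le_trans->//|/andP[]].
  by apply/seteqP; split => z //=; rewrite !in_itv/= => -[za /andP[/lt_le_trans/(_ za)]]; rewrite ltxx.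
rewrite /Phi -/(gauss _) Phi_split fineD ?gauss_fin_num// addrC addKr fine_ge0//=.
rewrite -lee_fin fineK ?gauss_fin_num//.
have -> : (M * (b - a))%:E = (\int[@lebesgue_measure R]_(x in `]a, b]) M%:E)%E.
  have lebesgue_ab : lebesgue_measure (`]a, b]%classic : set R) = (b - a)%:E.
    by rewrite lebesgue_measure_itv/= lte_fin -EFinD; case: ltgtP ab => // -> _; rewrite subrr.
  by rewrite integral_cst// [X in (_ * X)%E]lebesgue_ab -EFinM.
apply: ge0_le_integral => //.
- by move=> z _; rewrite lee_fin normal_pdf_ge0.
- by apply/measurable_EFinP; apply: measurable_funTS; exact: measurable_normal_pdf.
- by move=> z; rewrite /= in_itv/= => /andP[az zb]; rewrite lee_fin pdf_le// ltW.
Qed.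

Lemma Phi_nondecreasing : {homo (@Phi R) : a b / a <= b}.
Proof.
move=> a b ab; have := PhiB_itv ab (fun z _ => std_normal_pdf_le1 z).
by rewrite subr_ge0 => /andP[].
Qed.

Lemma norm_PhiB_le_pdf a b M :
  (forall z, Num.min a b <= z <= Num.max a b -> pdf z <= M) -> `|Phi b - Phi a| <= M * `|b - a|.
Proof.
wlog ab : a b / a <= b => [wlog_le pdf_le|].
  have [/wlog_le|/ltW/wlog_le] := leP a b; first exact.
  by rewrite minC maxC distrC (distrC b); apply.
rewrite min_l ?max_r// => /(PhiB_itv ab)/andP[PhiB_ge0 PhiB_le].
by rewrite (ger0_norm PhiB_ge0) ger0_norm ?subr_ge0.
Qed.

Lemma norm_PhiB_le a b : `|Phi b - Phi a| <= `|b - a|.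
Proof. by rewrite -[leRHS]mul1r; apply: norm_PhiB_le_pdf => z _; exact: std_normal_pdf_le1. Qed.

Lemma sqrt1D_itv t : `|t| <= 1 / 2 -> 2 / 3 <= Num.sqrt (1 + t) <= 5 / 4.
Proof.
rewrite ler_norml => /andP[t_ge t_le].
have q2 : Num.sqrt (1 + t) ^+ 2 = 1 + t by rewrite sqr_sqrtr//; lra.
by have := sqrtr_ge0 (1 + t) => q0; apply/andP; split; nra.
Qed.

Lemma norm_div_sqrt1D_sub_le x t : `|t| <= 1 / 2 ->
  `|x / Num.sqrt (1 + t) - x| <= 3 / 2 * `|x * t|.
Proof.
move=> t_half; have /andP[q_ge _] := sqrt1D_itv t_half; move: t_half; rewrite ler_norml => t_itv.
have q2 : Num.sqrt (1 + t) ^+ 2 = 1 + t by rewrite sqr_sqrtr//; lra.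
move: q2 q_ge; set q := Num.sqrt _ => q2 q_ge; have q0 : 0 < q by lra.
have -> : x / q - x = - (x * t) / (q * (1 + q)).
  by rewrite (_ : t = q ^+ 2 - 1); [field; rewrite !gt_eqF//; lra | lra].
rewrite normrM normrN normfV mulrC ler_wpM2r//.
have den_ge : 2 / 3 <= q * (1 + q) by nra.
rewrite ger0_norm; last by lra.
by rewrite -[3 / 2]invrK lef_pV2 ?posrE ?invf_div//; lra.
Qed.

Lemma norm_between_ge c r x z : 0 <= c -> c <= 1 -> c <= r ->
  Num.min x (x * r) <= z <= Num.max x (x * r) -> c * `|x| <= `|z|.
Proof.
move=> c0 c1 cr; rewrite ge_min le_max => /andP[z_ge z_le].
have [x0|x0] := leP 0 x.
  rewrite (ger0_norm x0) (le_trans _ (ler_norm z))//.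
  by case/orP: z_ge => z_ge; apply: le_trans z_ge; nra.
rewrite (ltr0_norm x0) -normrN (le_trans _ (ler_norm (- z)))//.
by case/orP: z_le => z_le; nra.
Qed.

(* The Gaussian decay of the density absorbs the factor x ^+ 2 of the displacement. *)
Lemma norm_Phi_div_sqrt1D_sub_le x k : 0 <= k -> `|x * k| <= 1 / 2 ->
  `|Phi (x / Num.sqrt (1 + x * k)) - Phi x| <= 6 * k.
Proof.
move=> k0 xk; have /andP[q_ge q_le] := sqrt1D_itv xk.
have displacement := norm_div_sqrt1D_sub_le x xk.
move: q_ge q_le displacement; set q := Num.sqrt _ => q_ge q_le.
rewrite mulrA -expr2 (ger0_norm (mulr_ge0 (sqr_ge0 x) k0)) => displacement.
have invq_ge : 4 / 5 <= q^-1 by rewrite -[4 / 5]invrK lef_pV2 ?posrE ?invf_div//; lra.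
have pdf_le z : Num.min x (x / q) <= z <= Num.max x (x / q) ->
    pdf z <= expR (- (8 / 25 * x ^+ 2)).
  move=> z_between; rewrite (le_trans (std_normal_pdf_le z))// ler_expR lerN2.
  have z_ge : 4 / 5 * `|x| <= `|z| by apply: norm_between_ge z_between; lra.
  have : (4 / 5 * `|x|) ^+ 2 <= `|z| ^+ 2 by rewrite lerXn2r ?nnegrE// mulr_ge0//; lra.
  by rewrite exprMn !real_normK ?num_real//; lra.
apply: le_trans (norm_PhiB_le_pdf pdf_le) _.
apply: le_trans (ler_wpM2l (expR_ge0 _) displacement) _.
have decay : expR (- (8 / 25 * x ^+ 2)) * x ^+ 2 <= 4.
  rewrite expRN mulrC ler_pdivrMr ?expR_gt0//.
  by have := expR_ge1Dx (8 / 25 * x ^+ 2); have := sqr_ge0 x; lra.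
by have := ler_wpM2r k0 decay; lra.
Qed.

Definition normal_abs_moment : R := mean gauss (fun g => `|g|).

Lemma normal_abs_moment_ge0 : 0 <= normal_abs_moment.
Proof. exact: mean_ge0. Qed.

Let integrable_abs_div a : Rintegrable gauss (fun g => a^-1 * `|g|).
Proof.
exact: (integrableZl measurableT a^-1 (integrable_norm_fun (integrable_std_normal_id R))).
Qed.

Let mean_abs_div a : mean gauss (fun g => a^-1 * `|g|) = normal_abs_moment / a.
Proof. by rewrite meanZl 1?mulrC//; exact: integrable_norm_fun (integrable_std_normal_id R). Qed.

Let Phi_mean x : Phi x = mean gauss (\1_`]-oo, x]).
Proof. by rewrite mean_indic. Qed.

Let bounded_indic x : bounded_mfun (\1_`]-oo, x] : measurableTypeR R -> R).
Proof. exact: bounded_mfun_indic. Qed.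

Lemma PhiN_tail_le a : 0 < a -> Phi (- a) <= normal_abs_moment / a.
Proof.
move=> a0; rewrite Phi_mean -mean_abs_div; apply: le_mean => [||g].
- exact: bounded_mfun_integrable.
- exact: integrable_abs_div.
rewrite indicE; case: (boolP (_ \in _)) => [|_] /=; last by rewrite mulr_ge0// invr_ge0 ltW.
rewrite inE/= in_itv/= => g_le; rewrite mulrC ler_pdivlMr// mul1r.
by rewrite -normrN (le_trans _ (ler_norm _))//; lra.
Qed.

Lemma Phi_tail_ge a : 0 < a -> 1 - normal_abs_moment / a <= Phi a.
Proof.
move=> a0; have iindic := bounded_mfun_integrable gauss (bounded_indic a).
rewrite Phi_mean -mean_abs_div lerBlDr -meanD//; rewrite -[leLHS](mean_cst gauss).
apply: le_mean => [||g].
- exact/bounded_mfun_integrable/bounded_mfun_cst.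
- exact: (integrableD measurableT iindic (integrable_abs_div a)).
rewrite indicE; case: (boolP (_ \in _)) => [_|] /=.
  by rewrite lerDl mulr_ge0// invr_ge0 ltW.
rewrite notin_setE/= in_itv/= => /negP; rewrite -ltNge => /ltW ag.
by rewrite add0r mulrC ler_pdivlMr// mul1r (le_trans ag)// ler_norm.
Qed.

(* Monotonicity extends an approximation of Phi from [-a, a] to the line, up to the tails of Phi. *)
Lemma norm_sub_Phi_le_tails (F : R -> R) a e : 0 < a -> {homo F : y z / y <= z} ->
  (forall y, 0 <= F y <= 1) -> (forall y, `|y| <= a -> `|F y - Phi y| <= e) ->
  forall y, `|F y - Phi y| <= e + normal_abs_moment / a.
Proof.
move=> a0 F_mono F01 F_close y; have tail0 : 0 <= normal_abs_moment / a.
  by rewrite divr_ge0 ?normal_abs_moment_ge0// ltW.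
have [/F_close|] := leP `|y| a; first by lra.
have norm_a : `|a| = a by rewrite gtr0_norm.
have := F_close a; have := F_close (- a); rewrite normrN norm_a lexx => /(_ isT) + /(_ isT).
have := Phi_tail_ge a0; have := PhiN_tail_le a0; have := Phi_le1 y; have := Phi_ge0 y.
have := F01 y; rewrite !ler_norml ltr_normr => ? ? ? ? ? ? ? /orP[ay|ya].
  by have := F_mono _ _ (ltW ay); have := Phi_nondecreasing (ltW ay); lra.
have ya' : y <= - a by lra.
by have := F_mono _ _ ya'; have := Phi_nondecreasing ya'; lra.
Qed.
End normal_cdf.

(** * The law of the largest interval *)

Section max_cdf.
Context d (T : measurableType d) (R : realType) (P : probability T R)
  (U : nat -> {RV P >-> R}).
Implicit Types (n : nat) (x y : R).
Local Notation v := (var_rate R).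

Definition max_cdf n x : R := fine (P [set w | Mn (fun k => U k w) n <= x]).

Lemma max_cdf_fineK n x : (max_cdf n x)%:E = P [set w | Mn (fun k => U k w) n <= x].
Proof. by rewrite fineK// fin_num_measure//; exact: measurable_Mn_le. Qed.

Lemma max_cdf01 n x : 0 <= max_cdf n x <= 1.
Proof.
rewrite fine_ge0//= -lee_fin max_cdf_fineK.
by apply: probability_le1; exact: measurable_Mn_le.
Qed.

Lemma max_cdf_nondecreasing n : {homo max_cdf n : x y / x <= y}.
Proof.
move=> x y xy; rewrite -lee_fin !max_cdf_fineK; apply: le_measure.
- by rewrite inE; exact: measurable_Mn_le.
- by rewrite inE; exact: measurable_Mn_le.
- by move=> w /= Mn_le; exact: le_trans Mn_le xy.
Qed.

(* Standard deviation of the largest interval relative to its typical length [2 / n]. *)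
Definition rel_dev n : R := Num.sqrt (v / 2) / Num.sqrt n%:R.

Definition level n x : R := 2 / n%:R * (1 + x * rel_dev n).

Let sqrt_rate_gt0 : 0 < Num.sqrt (v / 2).
Proof. by rewrite sqrtr_gt0 divr_gt0// var_rate_gt0. Qed.

Lemma rel_dev_gt0 n : (0 < n)%N -> 0 < rel_dev n.
Proof. by move=> n0; rewrite divr_gt0// sqrtr_gt0 ltr0n. Qed.

Lemma sqr_rel_dev n : rel_dev n ^+ 2 = v / 2 / n%:R.
Proof. by rewrite expr_div_n !sqr_sqrtr// divr_ge0// ltW// var_rate_gt0. Qed.

Lemma level_nondecreasing n : (0 < n)%N -> {homo level n : x y / x <= y}.
Proof.
move=> n0 x y xy; rewrite ler_pM2l ?divr_gt0 ?ltr0n// lerD2l ler_pM2r//.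
exact: rel_dev_gt0.
Qed.

Lemma scaled_Mn_leE n x : (0 < n)%N ->
  [set w | Num.sqrt (n%:R ^+ 3 / (16 * ln 2 - 10)) * (Mn (fun k => U k w) n - 2 / n%:R) <= x] =
  [set w | Mn (fun k => U k w) n <= level n x].
Proof.
move=> n0; have v0 := var_rate_gt0 R; have k0 := rel_dev_gt0 n0; have k2 := sqr_rel_dev n.
have N0 : 0 < n%:R :> R by rewrite ltr0n.
have -> : Num.sqrt (n%:R ^+ 3 / (16 * ln 2 - 10)) = n%:R / (2 * rel_dev n).
  rewrite (_ : n%:R ^+ 3 / _ = (n%:R / (2 * rel_dev n)) ^+ 2).
    by rewrite sqrtr_sqr ger0_norm// divr_ge0 ?mulr_ge0// ltW.
  rewrite (_ : 16 * ln 2 - 10 = 2 * v); last by rewrite /var_rate; ring.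
  by rewrite expr_div_n exprMn k2; field; rewrite !gt_eqF.
have scale0 : 0 < n%:R / (2 * rel_dev n) by apply: divr_gt0 => //; exact: mulr_gt0.
have xE : x = n%:R / (2 * rel_dev n) * (level n x - 2 / n%:R).
  by rewrite /level; field; rewrite !gt_eqF.
have le_level M : (n%:R / (2 * rel_dev n) * (M - 2 / n%:R) <= x) = (M <= level n x).
  by rewrite {1}xE ler_pM2l// lerD2r.
by apply/seteqP; split => w /=; rewrite le_level.
Qed.

Section central_level.
Variables (n : nat) (x : R).
Hypotheses (n6 : (6 <= n)%N) (xk : `|x * rel_dev n| <= 1 / 2).
Local Notation N := (n%:R : R).
Local Notation k := (rel_dev n).
Local Notation q := (Num.sqrt (1 + x * k)).

Let N6 : 6 <= N. Proof. by rewrite (ler_nat _ 6 n). Qed.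

Let N0 : 0 < N. Proof. by have := N6; lra. Qed.

Let k0 : 0 < k. Proof. by apply: rel_dev_gt0; exact: leq_trans n6. Qed.

Let xk_itv : - (1 / 2) <= x * k <= 1 / 2. Proof. by rewrite -ler_norml. Qed.

Let q2 : q ^+ 2 = 1 + x * k. Proof. by rewrite sqr_sqrtr//; have := xk_itv; lra. Qed.

Let q0 : 0 < q. Proof. by have /andP[] := sqrt1D_itv xk; lra. Qed.

Lemma level_gt0 : 0 < level n x.
Proof. by rewrite mulr_gt0 ?divr_gt0//; have := xk_itv; lra. Qed.

Lemma level_le : level n x <= 4 / N.
Proof.
rewrite (_ : 4 / N = 2 / N * 2); last by ring.
by rewrite ler_pM2l ?divr_gt0//; have := xk_itv; lra.
Qed.

Lemma level_le_half : level n x <= 1 / 2.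
Proof.
rewrite (_ : 1 / 2 = 2 / N * (N / 4)); last by field; rewrite gt_eqF.
by rewrite ler_pM2l ?divr_gt0//; have := N6; have := xk_itv; lra.
Qed.

Lemma sqrt_level_le : Num.sqrt (level n x) <= 2 / Num.sqrt N.
Proof.
have -> : 2 / Num.sqrt N = Num.sqrt (4 / N).
  rewrite (_ : 4 / N = (2 / Num.sqrt N) ^+ 2); last first.
    by rewrite expr_div_n sqr_sqrtr ?ltW//; congr (_ / _); ring.
  by rewrite sqrtr_sqr ger0_norm ?divr_ge0 ?sqrtr_ge0.
exact: ler_wsqrtr level_le.
Qed.

Lemma sqrt_rate_level : Num.sqrt (v / level n x) = k * N / q.
Proof.
rewrite (_ : v / level n x = (k * N / q) ^+ 2).
  by rewrite sqrtr_sqr ger0_norm// divr_ge0 ?mulr_ge0// ltW.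
move: q2 q0; set r := q => r2 r0.
by rewrite expr_div_n exprMn sqr_rel_dev /level -r2; field; rewrite !gt_eqF.
Qed.

Lemma centered_level_quantile : (N + 1 - 2 / level n x) / (k * N / q) = x / q + q / (k * N).
Proof.
move: q2 q0; set r := q => r2 r0.
have -> : x = (r ^+ 2 - 1) / k by rewrite r2; field; rewrite gt_eqF.
by rewrite /level divfK ?gt_eqF// subrKC; field; rewrite !gt_eqF.
Qed.

Lemma norm_Phi_quantile_sub_le : `|Phi (x / q + q / (k * N)) - Phi x| <= 5 / 4 / (k * N) + 6 * k.
Proof.
have kN0 : 0 < k * N by rewrite mulr_gt0.
have := norm_PhiB_le (x / q) (x / q + q / (k * N)); rewrite [_ - x / _]addrC addKr => shift.
have shift_le : `|q / (k * N)| <= 5 / 4 / (k * N).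
  rewrite ger0_norm; last by rewrite divr_ge0// ltW.
  by rewrite ler_pM2r ?invr_gt0//; have /andP[] := sqrt1D_itv xk.
have scale := norm_Phi_div_sqrt1D_sub_le (ltW k0) xk.
rewrite -(subrK (Phi (x / q)) (Phi (_ + _))) -addrA (le_trans (ler_normD _ _))// lerD//.
exact: le_trans shift shift_le.
Qed.
End central_level.

Hypothesis indU : mutually_independent U.
Hypothesis lawU : forall k (A : set R), measurable A ->
     distribution P (U k) A = uniform_prob (@ltr01 R) A.

Lemma max_cdf_centered_tau n t : 0 < t ->
  max_cdf n t = fine (P [set w | centered_tau U t w <= n%:R + 1 - 2 / t]).
Proof.
move=> t0; rewrite /max_cdf (prob_Mn_le indU lawU t0); congr (fine (P _)).
by apply/seteqP; split => w /=; rewrite /centered_tau; lra.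
Qed.

Lemma max_cdf_level_central : exists2 C : R, 0 <= C & forall n x, (6 <= n)%N ->
  `|x * rel_dev n| <= 1 / 2 -> `|max_cdf n (level n x) - Phi x| <= C / Num.sqrt n%:R.
Proof.
have [C C0 approx] := berry_esseen_centered_tau indU lawU.
exists (2 * C + (5 / 4 / Num.sqrt (v / 2) + 6 * Num.sqrt (v / 2))).
  by rewrite !addr_ge0 ?divr_ge0 ?mulr_ge0 ?sqrtr_ge0.
move=> n x n6 xk; have t0 := level_gt0 n6 xk.
have N0 : 0 < n%:R :> R by rewrite ltr0n (leq_trans _ n6).
have k0 : 0 < rel_dev n by apply: rel_dev_gt0; exact: leq_trans n6.
have rate0 : 0 < rel_dev n * n%:R / Num.sqrt (1 + x * rel_dev n).
  by apply: divr_gt0; [exact: mulr_gt0 | have /andP[] := sqrt1D_itv xk; lra].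
have := approx (level n x) (n%:R + 1 - 2 / level n x); rewrite t0 level_le_half// => /(_ isT).
rewrite -max_cdf_centered_tau// sqrt_rate_level// std_normal_scaled_le// centered_level_quantile//.
move=> /le_trans/(_ (ler_wpM2l C0 (sqrt_level_le n6 xk))) => max_cdf_close.
have Phi_close := norm_Phi_quantile_sub_le n6 xk.
have -> : (2 * C + (5 / 4 / Num.sqrt (v / 2) + 6 * Num.sqrt (v / 2))) / Num.sqrt n%:R =
    C * (2 / Num.sqrt n%:R) + (5 / 4 / (rel_dev n * n%:R) + 6 * rel_dev n).
  have -> : rel_dev n * n%:R = Num.sqrt (v / 2) * Num.sqrt n%:R.
    by rewrite /rel_dev -{2}(sqr_sqrtr (ltW N0)); field; rewrite gt_eqF ?sqrtr_gt0.
  by rewrite /rel_dev; field; rewrite (gt_eqF sqrt_rate_gt0) gt_eqF ?sqrtr_gt0.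
rewrite -(subrK (Phi (x / Num.sqrt (1 + x * rel_dev n) +
  Num.sqrt (1 + x * rel_dev n) / (rel_dev n * n%:R))) (max_cdf _ _)) -addrA.
by rewrite (le_trans (ler_normD _ _))// lerD.
Qed.

Lemma max_cdf_level : exists2 C : R, 0 <= C & forall n x, (0 < n)%N ->
  `|max_cdf n (level n x) - Phi x| <= C / Num.sqrt n%:R.
Proof.
have [C C0 central] := max_cdf_level_central; have moment0 := normal_abs_moment_ge0 R.
exists (C + 2 * Num.sqrt (v / 2) * normal_abs_moment R + 3).
  by rewrite !addr_ge0// !mulr_ge0 ?sqrtr_ge0.
move=> n x n0; have k0 := rel_dev_gt0 n0; have N0 : 0 < n%:R :> R by rewrite ltr0n.
have r0 : 0 < Num.sqrt n%:R :> R by rewrite sqrtr_gt0.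
have tail0 : 0 <= 2 * Num.sqrt (v / 2) * normal_abs_moment R / Num.sqrt n%:R.
  by rewrite divr_ge0 ?mulr_ge0 ?sqrtr_ge0.
rewrite 2!mulrDl; have [n6|n_lt6] := leqP 6 n; last first.
  have three_ge : 1 <= 3 / Num.sqrt n%:R :> R.
    rewrite ler_pdivlMr// mul1r -[3]ger0_norm// -sqrtr_sqr ler_wsqrtr//.
    by rewrite -natrX ler_nat (leq_trans (ltnW n_lt6)).
  have C_ge0 : 0 <= C / Num.sqrt n%:R by rewrite divr_ge0// ltW.
  have := max_cdf01 n (level n x); have := Phi_ge0 x; have := Phi_le1 x.
  rewrite ler_norml; lra.
have cut0 : 0 < (2 * rel_dev n)^-1 by rewrite invr_gt0 mulr_gt0.
have := norm_sub_Phi_le_tails (F := fun y => max_cdf n (level n y)) (e := C / Num.sqrt n%:R) cut0.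
rewrite invrK => /(_ _ _ _ x) close; apply: le_trans (close _ _ _) _.
- by move=> y z yz; apply/max_cdf_nondecreasing/level_nondecreasing.
- by move=> y; exact: max_cdf01.
- move=> y y_le; apply: central => //; rewrite normrM (gtr0_norm k0) -ler_pdivlMr//.
  by rewrite div1r -invfM.
rewrite -addrA lerD2l /rel_dev; have := divr_ge0 (ler0n R 3) (ltW r0); lra.
Qed.
End max_cdf.

Theorem theorem1p2 (R : realType) (d : measure_display) (T : measurableType d)
  (P : probability T R) (U : nat -> {RV P >-> R}) :
  (* U k stands for U_{k+1}: i.i.d. uniform on [0,1] *)
  mutually_independent U ->
  (forall k (A : set R), measurable A ->
     distribution P (U k) A = uniform_prob (@ltr01 R) A) ->
  let sigma2 : R := 16 * ln 2 - 10 in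
  exists C : R, 0 <= C /\
    forall (n : nat), (0 < n)%N -> forall x : R,
      (`| P [set w | (Num.sqrt (n%:R ^+ 3 / sigma2) *
                       (Mn (fun k => U k w) n - 2 / n%:R) <= x)%R]
          - (Phi x)%:E | <= (C / Num.sqrt n%:R)%:E)%E.
Proof.
move=> indU lawU sigma2; have [C C0 max_cdf_close] := max_cdf_level indU lawU.
exists C; split => // n n0 x; rewrite /sigma2 scaled_Mn_leE// -max_cdf_fineK -EFinD/= lee_fin.
exact: max_cdf_close.
Qed.
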